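(* Let $A\in\mathbb{Z}^{m\times n}$ have nonzero columns and encoding length $L$. The Maximum Support Kernel Algorithm finds a solution of $Ax=0,\ x\ge0$ of maximum support in $O\left((m^3n+mn^2)L\right)$ arithmetic operations.
   Context: Notation: $[n]=\{1,\dots,n\}$; $a_1,\dots,a_n$ are the columns of $A$; $A_X$ is the submatrix of columns indexed by $X\subseteq[n]$; $\hat v=v/\|v\|_2$ for $v\ne0$; $\hat A=[\hat a_1,\dots,\hat a_n]$; $\vec e_k$ is the $k$th unit vector; for symmetric positive definite $Q$, $\langle v,w\rangle_Q=v^\top Qw$, $\|v\|_Q=\sqrt{\langle v,v\rangle_Q}$; $(\cdot)^+$ is the Moore–Penrose pseudo-inverse; $\Pi^K_B=I-B^\top(BB^\top)^+B$ is the orthogonal projection matrix onto $\ker(B)$. The encoding length $L$ is the total number of bits needed to write the entries of $A$ in binary. The support of $x$ is $\{i: x_i\ne0\}$; a solution of $Ax=0$, $x\ge0$ has maximum support if its support is the unique inclusion-wise maximal one among all solutions. Further $$\Delta_A=\max\Big\{\prod_{j\in B}\|a_j\|: B\subseteq[n],\ |B|=\mathrm{rk}(A_B)\Big\},\qquad \theta_A=\frac1{m^2\Delta_A^2}.$$ Maximum Support Kernel Algorithm, with $\varepsilon=\frac1{11m}$. Input: $A\in\mathbb{Z}^{m\times n}$. 1. Compute $\theta:=\theta_A$ and $\Pi:=\Pi^K_{\hat A}$. Set $x_j:=1$ for all $j\in[n]$, $y:=\hat Ax$, $S:=[n]$, $T:=\emptyset$, $Q:=I_m$. 2. While $S\ne\emptyset$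 and $\Pi x\not>0$: let $k:=\arg\min_{i\in S}\langle a_i,y\rangle_Q/\|a_i\|_Q$. - If $\langle a_k,y\rangle_Q<-\varepsilon\|a_k\|_Q\|y\|_Q$: update $x:=x-\frac{\langle\hat a_k,y\rangle_Q}{\|\hat a_k\|_Q^2}\vec e_k$, $\ y:=y-\frac{\langle a_k,y\rangle_Q}{\|a_k\|_Q^2}a_k$. - Otherwise: rescale $Q:=\frac1{(1+3\varepsilon)^2}\Big(Q+\frac{3Qyy^\top Q}{\|y\|_Q^2}\Big)$; set $T:=T\cup\{k\in S\setminus T:\|\hat a_k\|_Q>\theta^{-1}\}$; and if $\mathrm{rk}(A_{S\setminus T})<\mathrm{rk}(A_S)$, perform Remove$(T)$: $S:=S\setminus T$, $T:=\emptyset$, reset $x_j:=1$ for all $j\in S$, $y:=\hat A_Sx$, and recompute $\Pi:=\Pi^K_{\hat A_S}$ ($x$ is now indexed by $S$). 3. If $\Pi x>0$, return $\bar x\in\mathbb{R}^n$ with $\bar x_i=(\Pi x)_i/\|a_i\|_2$ for $i\in S$ and $\bar x_i=0$ for $i\notin S$. If $S=\emptyset$, return $\bar x=0$. *)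

(* Defs.v *)
From mathcomp Require Import all_boot all_order all_algebra.
From mathcomp Require classical_sets.
From mathcomp Require Import reals.
Set Implicit Arguments.
Unset Strict Implicit.
Unset Printing Implicit Defensive.
Import Order.TTheory GRing.Theory Num.Theory.
Local Open Scope ring_scope.

(* One sign bit plus the number of binary digits of |z|:
   up_log 2 (k + 1) = ceil (log_2 (k + 1)) is that number of digits. *)
Definition bitsize (z : int) : nat := (1 + up_log 2 (absz z).+1)%N.

Definition encoding_length (m n : nat) (A : 'M[int]_(m, n)) : nat :=
  (\sum_(i < m) \sum_(j < n) bitsize (A i j))%N.

Section LinearAlgebra.
Variable R : realType.

Definition norm2 (p : nat) (v : 'cV[R]_p) : R :=
  Num.sqrt (\sum_i v i 0 ^+ 2).

Definition dotQ (p : nat) (Q : 'M[R]_p) (v w : 'cV[R]_p) : R :=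
  (v^T *m Q *m w) 0 0.

Definition normQ (p : nat) (Q : 'M[R]_p) (v : 'cV[R]_p) : R :=
  Num.sqrt (dotQ Q v v).

Definition normalize (p : nat) (v : 'cV[R]_p) : 'cV[R]_p :=
  (norm2 v)^-1 *: v.

Definition hat (p q : nat) (B : 'M[R]_(p, q)) : 'M[R]_(p, q) :=
  \matrix_(i, j) normalize (col j B) i 0.

(* The columns of B indexed by X, in increasing order of index; the k-th
   column of the result is column [enum_val k] of B. *)
Definition cols (p q : nat) (B : 'M[R]_(p, q)) (X : {set 'I_q}) :
    'M[R]_(p, #|X|) :=
  colsub (fun k : 'I_#|X| => enum_val k) B.

Definition entries (q : nat) (x : 'cV[R]_q) (X : {set 'I_q}) : 'cV[R]_#|X| :=
  rowsub (fun k : 'I_#|X| => enum_val k) x.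

Definition penrose (p q : nat) (B : 'M[R]_(p, q)) (P : 'M[R]_(q, p)) : Prop :=
  [/\ B *m P *m B = B, P *m B *m P = P,
      (B *m P)^T = B *m P & (P *m B)^T = P *m B].

Definition mp_inverse (p q : nat) (B : 'M[R]_(p, q)) : 'M[R]_(q, p) :=
  classical_sets.xget 0 (penrose B).

Lemma trmx_mulmx_eq0 (p q : nat) (M : 'M[R]_(p, q)) : M *m M^T = 0 -> M = 0.
Proof.
move=> M0; apply/matrixP => i j; rewrite mxE.
have /eqP : \sum_k (M i k) ^+ 2 = 0.
  move/matrixP: M0 => /(_ i i); rewrite !mxE => M0; rewrite -[RHS]M0.
  by apply: eq_bigr => k _; rewrite mxE expr2.
rewrite psumr_eq0 => [|k _]; last exact: sqr_ge0.
by move/allP => /(_ j (mem_index_enum _)); rewrite sqrf_eq0 => /eqP.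
Qed.

Lemma row_free_gram_unit (p q : nat) (M : 'M[R]_(p, q)) :
  row_free M -> M *m M^T \in unitmx.
Proof.
move=> freeM; rewrite -row_free_unit -kermx_eq0; apply/eqP.
set K := kermx _.
have KG : K *m (M *m M^T) = 0 by exact: mulmx_ker.
have KM : K *m M = 0.
  by apply: trmx_mulmx_eq0; rewrite trmx_mul mulmxA -(mulmxA K) KG mul0mx.
by apply: (row_free_inj freeM); rewrite KM mul0mx.
Qed.

Lemma penrose_factor (p q r : nat) (C : 'M[R]_(p, r)) (D : 'M[R]_(r, q)) :
  C^T *m C \in unitmx -> D *m D^T \in unitmx ->
  penrose (C *m D)
    (D^T *m invmx (D *m D^T) *m (invmx (C^T *m C) *m C^T)).
Proof.
move=> uC uD.
pose E := D^T *m invmx (D *m D^T); pose F := invmx (C^T *m C) *m C^T.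
have DE : D *m E = 1%:M by rewrite mulmxA mulmxV.
have FC : F *m C = 1%:M by rewrite -mulmxA mulVmx.
have BP : C *m D *m (E *m F) = C *m F by rewrite mulmxA -(mulmxA C) DE mulmx1.
have PB : E *m F *m (C *m D) = E *m D.
  by rewrite mulmxA -(mulmxA E F C) FC mulmx1.
rewrite -/E -/F; split.
- by rewrite BP mulmxA -(mulmxA C F C) FC mulmx1.
- by rewrite PB mulmxA -(mulmxA E D E) DE mulmx1.
- by rewrite BP !trmx_mul trmxK trmx_inv trmx_mul trmxK mulmxA.
- by rewrite PB !trmx_mul trmxK trmx_inv trmx_mul trmxK mulmxA.
Qed.

Lemma mp_inverseP (p q : nat) (B : 'M[R]_(p, q)) : penrose B (mp_inverse B).
Proof.
apply: classical_sets.xgetPex; rewrite -{1}(mulmx_base B).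
have uD : row_base B *m (row_base B)^T \in unitmx.
  exact/row_free_gram_unit/row_base_free.
have uC : (col_base B)^T *m col_base B \in unitmx.
  have := @row_free_gram_unit _ _ (col_base B)^T; rewrite trmxK; apply.
  by rewrite /row_free mxrank_tr; exact: col_base_full.
by eexists; exact: penrose_factor uC uD.
Qed.

Lemma penrose_unique (p q : nat) (B : 'M[R]_(p, q)) (P P' : 'M[R]_(q, p)) :
  penrose B P -> penrose B P' -> P = P'.
Proof.
case=> P1 P2 P3 P4 [P1' P2' P3' P4'].
have e1 : B *m P = B *m P'.
  by rewrite -P3 -{1}P1' -mulmxA trmx_mul P3 P3' mulmxA P1.
have e2 : P *m B = P' *m B.
  by rewrite -P4 -{1}P1' -mulmxA mulmxA trmx_mul P4 P4' -mulmxA [B *m _]mulmxA P1.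
by rewrite -P2 -mulmxA e1 mulmxA e2 P2'.
Qed.

Definition ker_proj (p q : nat) (B : 'M[R]_(p, q)) : 'M[R]_q :=
  1%:M - B^T *m mp_inverse (B *m B^T) *m B.

End LinearAlgebra.

Section Kernel.
Variables (R : realType) (m n : nat) (A : 'M[int]_(m, n)).

Definition Areal : 'M[R]_(m, n) := map_mx (intr : int -> R) A.

Definition column (j : 'I_n) : 'cV[R]_m := col j Areal.

Definition supp (x : 'cV[R]_n) : {set 'I_n} := [set i | x i 0 != 0].

Definition kernel_solution (x : 'cV[R]_n) : Prop :=
  Areal *m x = 0 /\ (forall i, 0 <= x i 0).

Definition maximal_support (U : {set 'I_n}) : Prop :=
  (exists2 x, kernel_solution x & supp x = U) /\
  (forall z, kernel_solution z -> U \subset supp z -> supp z = U).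

Definition maximum_support_solution (x : 'cV[R]_n) : Prop :=
  kernel_solution x /\ (forall U, maximal_support U <-> U = supp x).

(* The default value 0 is never attained: B = set0 contributes 1. *)
Definition Delta : R :=
  \big[Num.max/0]_(B : {set 'I_n} | #|B| == \rank (cols Areal B))
    \prod_(j in B) norm2 (column j).

Definition theta : R := (m%:R ^+ 2 * Delta ^+ 2)^-1.

Definition epsilon : R := (11 * m%:R)^-1.

(* Only the entries of [st_x] with index in [st_S] are meaningful.  The matrix
   Pi is not stored: it is recomputed exactly when S changes, so that it is at
   all times the function [Pi_of] of S. *)
Record state := State {
  st_x : 'cV[R]_n;
  st_y : 'cV[R]_m;
  st_S : {set 'I_n};
  st_T : {set 'I_n};
  st_Q : 'M[R]_m }.

Definition hat_cols (S : {set 'I_n}) : 'M[R]_(m, #|S|) := hat (cols Areal S).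

Definition Pi_of (S : {set 'I_n}) : 'M[R]_#|S| := ker_proj (hat_cols S).

Definition Pix (st : state) : 'cV[R]_#|st_S st| :=
  Pi_of (st_S st) *m entries (st_x st) (st_S st).

Definition restart (S : {set 'I_n}) (Q : 'M[R]_m) : state :=
  let x := const_mx 1 in State x (hat_cols S *m entries x S) S set0 Q.

Definition init_state : state := restart [set: 'I_n] 1%:M.

Definition positive_Pix (st : state) : Prop := forall k, 0 < Pix st k 0.

Definition finished (st : state) : Prop :=
  st_S st = set0 \/ positive_Pix st.

Definition is_argmin (st : state) (k : 'I_n) : Prop :=
  let ratio i :=
    dotQ (st_Q st) (column i) (st_y st) / normQ (st_Q st) (column i) in
  k \in st_S st /\ (forall i, i \in st_S st -> ratio k <= ratio i).

Definition update_test (st : state) (k : 'I_n) : bool :=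
  let: State x y S0 T Q := st in
  dotQ Q (column k) y < - epsilon * normQ Q (column k) * normQ Q y.

Definition update (st : state) (k : 'I_n) : state :=
  let: State x y S0 T Q := st in
  let a := column k in
  let ha := normalize a in
  State (x - (dotQ Q ha y / normQ Q ha ^+ 2) *: delta_mx k 0)
        (y - (dotQ Q a y / normQ Q a ^+ 2) *: a) S0 T Q.

Definition rescaleQ (Q : 'M[R]_m) (y : 'cV[R]_m) : 'M[R]_m :=
  ((1 + 3 * epsilon) ^+ 2)^-1 *:
    (Q + (normQ Q y ^+ 2)^-1 *: (3 *: (Q *m y *m y^T *m Q))).

Definition rescale (st : state) : state :=
  let: State x y S0 T Q := st in
  let Q' := rescaleQ Q y in
  let T' := T :|:
    [set k in S0 :\: T | theta^-1 < normQ Q' (normalize (column k))] in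
  if (\rank (cols Areal (S0 :\: T')) < \rank (cols Areal S0))%N
  then restart (S0 :\: T') Q'
  else State x y S0 T' Q'.

(* One iteration of the while loop; the choice among several minimizers is
   left open. *)
Definition step (st st' : state) : Prop :=
  ~ finished st /\
  exists2 k, is_argmin st k &
    st' = if update_test st k then update st k else rescale st.

Definition is_run (N : nat) (run : nat -> state) : Prop :=
  run 0%N = init_state /\
  (forall i, (i < N)%N -> step (run i) (run i.+1)).

(* If S is empty the second clause is vacuous and the vector returned is 0. *)
Definition returns (st : state) (xbar : 'cV[R]_n) : Prop :=
  [/\ finished st,
      forall k : 'I_#|st_S st|,
        xbar (enum_val k) 0 = Pix st k 0 / norm2 (column (enum_val k)) &
      forall i, i \notin st_S st -> xbar i 0 = 0].

End Kernel.

(* A real random access machine.  Its memory consists of index registers,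
   holding natural numbers, and of two-dimensional arrays of real numbers. The
   cell (a, i, j) designates the entry of array a whose row and column are the
   current contents of the index registers i and j.  Programs are finite
   texts, which contain no real constants other than natural numbers. *)
Definition cell := (nat * nat * nat)%type.

Inductive real_binop := RAdd | RSub | RMul | RDiv.

Inductive cmd :=
| Skip
| IConst (i c : nat)
| ICopy (i j : nat)
| ISucc (i j : nat)
| IPred (i j : nat)
| RConst (d : cell) (c : nat)
| RCopy (d s : cell)
| RBin (d : cell) (o : real_binop) (s1 s2 : cell)
| RSqrt (d s : cell)
| Seq (c1 c2 : cmd)
| If (t : test) (c1 c2 : cmd)
| While (t : test) (c : cmd)
| Mark
with test :=
| ILt (i j : nat)
| RLt (s1 s2 : cell).

Section Machine.
Variable R : realType.

Record store := Store { reg : nat -> nat; arr : nat -> nat -> nat -> R }.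

Definition set_reg (s : store) (i v : nat) : store :=
  Store (fun k => if k == i then v else reg s k) (arr s).

Definition get (s : store) (c : cell) : R :=
  let: (a, i, j) := c in arr s a (reg s i) (reg s j).

Definition set_cell (s : store) (c : cell) (v : R) : store :=
  let: (a, i, j) := c in
  Store (reg s) (fun b k l =>
    if [&& b == a, k == reg s i & l == reg s j] then v else arr s b k l).

Definition eval_binop (o : real_binop) (u v : R) : R :=
  match o with
  | RAdd => u + v
  | RSub => u - v
  | RMul => u * v
  | RDiv => u / v
  end.

Definition eval_test (t : test) (s : store) : bool :=
  match t with
  | ILt i j => (reg s i < reg s j)%N
  | RLt c1 c2 => get s c1 < get s c2
  end.

(* [exec c s s' log t]: started in store s, the program c halts in store s'
   after t elementary operations.  Every arithmetic operation on real numbers,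
   including square roots, every comparison, and every operation on index
   registers counts as one.  [Mark] has no effect on the computation: it only
   appends the current store to the trace [log]. *)
Inductive exec : cmd -> store -> store -> seq store -> nat -> Prop :=
| ExSkip s : exec Skip s s [::] 0
| ExIConst s i c : exec (IConst i c) s (set_reg s i c) [::] 1
| ExICopy s i j : exec (ICopy i j) s (set_reg s i (reg s j)) [::] 1
| ExISucc s i j : exec (ISucc i j) s (set_reg s i (reg s j).+1) [::] 1
| ExIPred s i j : exec (IPred i j) s (set_reg s i (reg s j).-1) [::] 1
| ExRConst s d c : exec (RConst d c) s (set_cell s d c%:R) [::] 1
| ExRCopy s d s1 : exec (RCopy d s1) s (set_cell s d (get s s1)) [::] 1
| ExRBin s d o s1 s2 :
    exec (RBin d o s1 s2) s
      (set_cell s d (eval_binop o (get s s1) (get s s2))) [::] 1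
| ExRSqrt s d s1 :
    exec (RSqrt d s1) s (set_cell s d (Num.sqrt (get s s1))) [::] 1
| ExSeq c1 c2 s s1 s2 l1 l2 t1 t2 :
    exec c1 s s1 l1 t1 -> exec c2 s1 s2 l2 t2 ->
    exec (Seq c1 c2) s s2 (l1 ++ l2) (t1 + t2)
| ExIf b c1 c2 s s1 l t :
    exec (if eval_test b s then c1 else c2) s s1 l t ->
    exec (If b c1 c2) s s1 l t.+1
| ExWhileStop b c s :
    ~~ eval_test b s -> exec (While b c) s s [::] 1
| ExWhileStep b c s s1 s2 l1 l2 t1 t2 :
    eval_test b s -> exec c s s1 l1 t1 -> exec (While b c) s1 s2 l2 t2 ->
    exec (While b c) s s2 (l1 ++ l2) (t1 + t2).+1
| ExMark s : exec Mark s s [:: s] 0.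

(* The input: m and n in index registers 0 and 1, A in array 0, and 0
   everywhere else. *)
Definition input_store (m n : nat) (A : 'M[int]_(m, n)) : store :=
  Store
    (fun i => match i with 0 => m | 1 => n | _ => 0 end%N)
    (fun a i j =>
       if (a == 0)%N then
         match insub i, insub j with
         | Some i', Some j' => (A i' j')%:~R
         | _, _ => 0
         end
       else 0).

(* Row 0 of arrays 1, 2, 3 holds x (on S), S and T (as 0/1 vectors); row 0 of
   array 4 is the output.  y is determined by x and S, and Q by the iterates
   so far; an implementation may represent them as it likes. *)
Definition holds_state (m n : nat) (s : store) (st : state R m n) : Prop :=
  forall j : 'I_n,
    [/\ j \in st_S st -> arr s 1 0 j = st_x st j 0,
        arr s 2 0 j = (j \in st_S st)%:R &
        arr s 3 0 j = (j \in st_T st)%:R].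

Definition output (n : nat) (s : store) : 'cV[R]_n := \col_j arr s 4 0 j.

(* On input A the program P halts after t elementary operations, having
   carried out a complete run of the algorithm, iterate by iterate, and
   outputs the vector which that run returns. *)
Definition executes_algorithm (P : cmd) (m n : nat) (A : 'M[int]_(m, n))
    (t : nat) (xbar : 'cV[R]_n) : Prop :=
  exists s' log N (run : nat -> state R m n),
    [/\ exec P (input_store A) s' log t,
        is_run A N run,
        size log = N.+1,
        forall i, (i <= N)%N -> holds_state (nth s' log i) (run i) &
        returns A (run N) xbar /\ output n s' = xbar].

End Machine.

(* Main.v *)
Require Import Defs.
From mathcomp Require Import all_boot all_order all_algebra.
From mathcomp Require Import reals.
From mathcomp Require Import ring lra zify.
Set Implicit Arguments.
Unset Strict Implicit.
Unset Printing Implicit Defensive.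
Import Order.TTheory GRing.Theory Num.Theory.
Local Open Scope ring_scope.

(* If z >= 0 solves A z = 0, then the sum of the z_j ||a_j||_Q does not increase
   under a rescaling, because no <a_j, y>_Q is very negative. By Caratheodory's
   theorem and the bound Delta_A on the coordinates of elementary solutions,
   each column of the support therefore keeps ||a_j^||_Q <= 1 / theta, and only
   columns outside the maximum support are removed; when Pi x > 0, all the
   remaining columns belong to it.
   The Gram determinant of a basis chosen among the columns of A_S at least
   doubles with each rescaling. Hadamard's inequality bounds it in terms of
   theta, and by Fischer's inequality a removal loses a factor 2^O(L) for each
   lost dimension: there are O(m L) rescalings. Each update multiplies ||y||_Q^2
   by at most 1 - eps^2, and ||y||_Q^2 is bounded below as long as Pi x has a
   nonpositive entry: there are O(m^3 L) updates.
   An update costs O(n) operations because the program maintains A^T Q A,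
   A^T Q y and Pi x instead of Q and y. *)

(** [Delta] is a maximum over exponentially many sets, so computing theta needs an algorithm of its
    own. Nonzero integer columns have norm at least 1, hence the maximum is attained on a basis of
    the column matroid, and the greedy choice of a longest independent column finds it in O(m^2 n^2)
    operations. The norms of the columns in T are not controlled, which threatens the upper bound on
    the volume. The remedy is that the columns of S outside T always keep the full rank of A_S: a
    rescaling that breaks this is followed by a removal. A basis with bounded norms is therefore
    always at hand. A removal also resets y and so destroys the progress of the updates; this loss,
    like the loss of volume, is charged to the lost rank. The machine code is the compilation of a
    small language that has both a functional semantics on stores and a cost function. The compiler
    is verified once, and the simulation of the algorithm is then proved for that semantics
    alone. *)

(** * Quadratic forms of semidefinite matrices *)

Section Forms.
Variables (R : realType) (p : nat).
Implicit Types (Q : 'M[R]_p) (u v w : 'cV[R]_p) (a : R).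

Lemma dotQDl Q u v w : dotQ Q (u + v) w = dotQ Q u w + dotQ Q v w.
Proof. by rewrite /dotQ linearD /= !mulmxDl mxE. Qed.

Lemma dotQDr Q u v w : dotQ Q u (v + w) = dotQ Q u v + dotQ Q u w.
Proof. by rewrite /dotQ mulmxDr mxE. Qed.

Lemma dotQZl Q a v w : dotQ Q (a *: v) w = a * dotQ Q v w.
Proof. by rewrite /dotQ linearZ /= -!scalemxAl mxE. Qed.

Lemma dotQZr Q a v w : dotQ Q v (a *: w) = a * dotQ Q v w.
Proof. by rewrite /dotQ -scalemxAr mxE. Qed.

Lemma dotQNl Q v w : dotQ Q (- v) w = - dotQ Q v w.
Proof. by rewrite -scaleN1r dotQZl mulN1r. Qed.

Lemma dotQNr Q v w : dotQ Q v (- w) = - dotQ Q v w.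
Proof. by rewrite -scaleN1r dotQZr mulN1r. Qed.

Lemma dotQ0l Q w : dotQ Q 0 w = 0.
Proof. by rewrite -(scale0r 0) dotQZl mul0r. Qed.

Lemma dotQ0r Q w : dotQ Q w 0 = 0.
Proof. by rewrite -(scale0r 0) dotQZr mul0r. Qed.

Lemma dotQ_suml (I : finType) (P : pred I) Q (F : I -> 'cV[R]_p) w :
  dotQ Q (\sum_(i | P i) F i) w = \sum_(i | P i) dotQ Q (F i) w.
Proof.
by elim/big_rec2: _ => [|i x y _ IH]; rewrite ?dotQ0l // dotQDl IH.
Qed.

Lemma dotQ_sumr (I : finType) (P : pred I) Q (F : I -> 'cV[R]_p) w :
  dotQ Q w (\sum_(i | P i) F i) = \sum_(i | P i) dotQ Q w (F i).
Proof.
by elim/big_rec2: _ => [|i x y _ IH]; rewrite ?dotQ0r // dotQDr IH.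
Qed.

Lemma dotQC Q v w : Q^T = Q -> dotQ Q v w = dotQ Q w v.
Proof.
move=> sQ; have -> : dotQ Q w v = (w^T *m Q *m v)^T 0 0 by rewrite mxE.
by rewrite !trmx_mul trmxK sQ mulmxA.
Qed.

Lemma dotQ1E v w : dotQ 1%:M v w = \sum_i v i 0 * w i 0.
Proof. by rewrite /dotQ mulmx1 mxE; apply: eq_bigr => i _; rewrite mxE. Qed.

Lemma dotQ1vE v : dotQ 1%:M v v = \sum_i v i 0 ^+ 2.
Proof. by rewrite dotQ1E. Qed.

Lemma dotQ1_ge0 v : 0 <= dotQ 1%:M v v.
Proof. by rewrite dotQ1vE; apply: sumr_ge0 => i _; rewrite sqr_ge0. Qed.

Lemma dotQ1_eq0 v : dotQ 1%:M v v = 0 -> v = 0.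
Proof.
rewrite dotQ1vE => /eqP; rewrite psumr_eq0 => [|i _]; last exact: sqr_ge0.
move=> /allP h; apply/colP => i; apply/eqP; rewrite mxE.
by rewrite -(sqrf_eq0 (v i 0)); apply: h; rewrite mem_index_enum.
Qed.

Lemma norm2_sqr v : norm2 v ^+ 2 = dotQ 1%:M v v.
Proof. by rewrite sqr_sqrtr -dotQ1vE ?dotQ1_ge0. Qed.

Lemma norm2_ge0 v : 0 <= norm2 v.
Proof. exact: sqrtr_ge0. Qed.

(** Definiteness of the iterates is carried separately, as a lower bound by a multiple of the
    identity form ([inv_low]). *)
Definition psd Q := Q^T = Q /\ forall v, 0 <= dotQ Q v v.

Lemma psd1 : psd 1%:M.
Proof. by split=> [|v]; rewrite ?trmx1 // dotQ1_ge0. Qed.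

Lemma cauchy_schwarz Q v w :
  psd Q -> dotQ Q v w ^+ 2 <= dotQ Q v v * dotQ Q w w.
Proof.
move=> [sQ pQ].
have key t : 0 <= dotQ Q v v + 2 * t * dotQ Q v w + t ^+ 2 * dotQ Q w w.
  have := pQ (v + t *: w).
  by rewrite !(dotQDl, dotQDr, dotQZl, dotQZr) (dotQC w v sQ) => h; nra.
have := pQ w; rewrite le_eqVlt => /predU1P [w0|w0].
  rewrite -w0 mulr0; case: (eqVneq (dotQ Q v w) 0) => [->|b0].
    by rewrite expr0n.
  (* For isotropic [w] the polynomial [key] is affine in t; at this t it would take the value -1. *)
  have := key (- (dotQ Q v v + 1) / (2 * dotQ Q v w)); rewrite -w0 mulr0 addr0.
  rewrite mulrAC [_ * (_ / _)]mulrC mulfVK ?mulf_neq0 ?pnatr_eq0 //.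
  by rewrite subr_ge0 gerDl ler10.
have := key (- dotQ Q v w / dotQ Q w w) => h.
have -> : dotQ Q v w ^+ 2 = dotQ Q v v * dotQ Q w w -
  (dotQ Q v v + 2 * (- dotQ Q v w / dotQ Q w w) * dotQ Q v w +
   (- dotQ Q v w / dotQ Q w w) ^+ 2 * dotQ Q w w) * dotQ Q w w.
  by field; rewrite gt_eqF.
by rewrite gerBl mulr_ge0 // ltW.
Qed.

Lemma normQ_ge0 Q v : 0 <= normQ Q v.
Proof. exact: sqrtr_ge0. Qed.

Lemma normQ_sqr Q v : psd Q -> normQ Q v ^+ 2 = dotQ Q v v.
Proof. by case=> _ pQ; rewrite sqr_sqrtr. Qed.

Lemma dotQ_le_norm Q v w :
  psd Q -> `|dotQ Q v w| <= normQ Q v * normQ Q w.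
Proof.
move=> pQ; rewrite -(@ler_sqr _ `|_|) ?nnegrE ?mulr_ge0 ?normQ_ge0 //.
by rewrite real_normK ?num_real // exprMn !normQ_sqr // cauchy_schwarz.
Qed.

Lemma normQZ Q a v : normQ Q (a *: v) = `|a| * normQ Q v.
Proof.
by rewrite /normQ dotQZl dotQZr mulrA -expr2 sqrtrM ?sqr_ge0 // sqrtr_sqr.
Qed.

Lemma normQ_gt0 Q v : 0 < dotQ Q v v -> 0 < normQ Q v.
Proof. by rewrite sqrtr_gt0. Qed.

End Forms.

(** * Schur complements; the inequalities of Hadamard and Fischer *)

Section Determinants.
Variable R : realType.

Lemma psd_gram (p r : nat) (Q : 'M[R]_p) (W : 'M[R]_(r, p)) :
  psd Q -> psd (W *m Q *m W^T).
Proof.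
case=> sQ pQ; split=> [|v]; first by rewrite !trmx_mul trmxK sQ mulmxA.
by have := pQ (W^T *m v); rewrite /dotQ trmx_mul trmxK !mulmxA.
Qed.

Lemma psd_diag_ge0 (p : nat) (Q : 'M[R]_p) i : psd Q -> 0 <= Q i i.
Proof.
case=> _ /(_ (delta_mx i 0)); rewrite /dotQ trmx_delta -rowE -colE.
by rewrite !mxE.
Qed.

Lemma det_schur (k d : nat) (P : 'M[R]_k) (B : 'M_(k, d)) C (D : 'M_d) :
  P \in unitmx ->
  \det (block_mx P B C D) = \det P * \det (D - C *m invmx P *m B).
Proof.
move=> uP; have -> : block_mx P B C D = block_mx 1%:M 0 (C *m invmx P) 1%:M *m
    block_mx P B 0 (D - C *m invmx P *m B).
  rewrite mulmx_block !mul1mx !mulmx0 !mul0mx !addr0.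
  by rewrite -mulmxA mulVmx // mulmx1 addrC subrK.
by rewrite det_mulmx det_lblock !det1 !mul1r det_ublock.
Qed.

Section Schur.
Variables (k d : nat) (G : 'M[R]_(k + d)).
Hypotheses (pG : psd G) (uP : ulsubmx G \in unitmx).
Let P := ulsubmx G.
Let B := ursubmx G.

Let GE : G = block_mx P B B^T (drsubmx G).
Proof. by rewrite -{1}(submxK G) /B trmx_ursub pG.1. Qed.

Definition schur : 'M[R]_d := drsubmx G - B^T *m invmx P *m B.

Lemma det_schur_psd : \det G = \det P * \det schur.
Proof. by rewrite {1}GE det_schur. Qed.

Let sP : P^T = P.
Proof. by rewrite trmx_ulsub pG.1. Qed.

(** The form of the Schur complement at [v] is the form of [G] at the vector with blocks [- u] and
    [v]. *)
Lemma psd_schur : psd schur.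
Proof.
split.
  rewrite /schur linearB /= !trmx_mul trmxK trmx_drsub pG.1 trmx_inv sP.
  by rewrite mulmxA.
move=> v; set u := invmx P *m B *m v.
have uTP : u^T *m P = v^T *m B^T.
  by rewrite !trmx_mul trmx_inv sP -!mulmxA mulVmx // mulmx1.
have := pG.2 (col_mx (- u) v).
rewrite /dotQ {1}GE tr_col_mx mul_row_block mul_row_col.
rewrite [(- u)^T]linearN !mulNmx uTP addNr mul0mx add0r mulmxDl mulNmx.
have -> : u^T *m B = v^T *m (B^T *m invmx P *m B).
  by rewrite !trmx_mul trmx_inv sP !mulmxA.
by rewrite /schur mulmxBr mulmxBl addrC.
Qed.

(** The subtracted diagonal entry is the form of [G] at the vector with blocks [invmx P *m col i B]
    and 0, hence nonnegative. *)
Lemma schur_diag_le i : schur i i <= G (rshift k i) (rshift k i).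
Proof.
have -> : schur i i =
    G (rshift k i) (rshift k i) - (B^T *m invmx P *m B) i i.
  by rewrite /schur !mxE.
rewrite gerBl.
have := pG.2 (col_mx (invmx P *m col i B) 0).
rewrite /dotQ {1}GE tr_col_mx trmx0 mul_row_block mul_row_col mulmx0 addr0.
rewrite !mul0mx addr0 trmx_mul trmx_inv sP mulmxKV // tr_col -row_mul.
by rewrite colE mulmxA mulmxA -colE !mxE.
Qed.

End Schur.

(** Hadamard's inequality, by induction on the size: splitting off the first row leaves a Schur
    complement, which is again semidefinite and has no larger diagonal entries. For singular [G] the
    diagonal only has to be nonnegative. *)
Lemma det_psd (n : nat) (G : 'M[R]_n) :
  psd G -> 0 <= \det G <= \prod_i G i i.
Proof.
elim: n G => [|n IH] G pG; first by rewrite det_mx00 big_ord0 ler01 lexx.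
have dG i : 0 <= G i i by exact: psd_diag_ge0.
have [G0|G0] := eqVneq (\det G) 0.
  by rewrite G0 lexx prodr_ge0.
have uG : G \in unitmx by rewrite unitmxE unitfE.
pose G' : 'M[R]_(1 + n) := G.
have P00 : ulsubmx G' = (G 0 0)%:M.
  rewrite [LHS]mx11_scalar !mxE; congr (_ _ _)%:M; exact: val_inj.
(* If this entry vanished, Cauchy-Schwarz would force the whole first column to vanish. *)
have G00 : G 0 0 != 0.
  apply: contraNneq G0 => g0; apply/eqP.
  have h : G *m delta_mx 0 0 = 0 :> 'cV_n.+1.
    apply/colP => i; rewrite -colE mxE [RHS]mxE.
    have := cauchy_schwarz (delta_mx i 0) (delta_mx 0 0) pG.
    rewrite /dotQ !trmx_delta -!rowE -!colE !mxE g0 mulr0 => h.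
    by apply/eqP; rewrite -sqrf_eq0 eq_le h sqr_ge0.
  apply: contraTeq isT => _; move/(congr1 (mulmx (invmx G))): h.
  rewrite mulKmx // mulmx0 => /matrixP /(_ 0 0); rewrite !mxE eqxx => /eqP.
  by rewrite oner_eq0.
have uP : ulsubmx G' \in unitmx by rewrite P00 unitmxE det_scalar1 unitfE.
have pG' : psd G' by exact: pG.
have -> : \det G = G 0 0 * \det (schur G').
  by rewrite -[\det G]/(\det G') (det_schur_psd pG' uP) P00 det_scalar1.
have /andP[s0 s1] := IH _ (psd_schur pG' uP).
have g0 := dG 0; rewrite mulr_ge0 //= big_ord_recl.
apply: ler_wpM2l => //; apply: (le_trans s1); apply: ler_prod => i _.
rewrite (psd_diag_ge0 _ (psd_schur pG' uP)) (le_trans (schur_diag_le pG' uP i)) //.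
by have -> : rshift 1 i = lift ord0 i by exact: val_inj.
Qed.

(** A weak form of Fischer's inequality: Hadamard's inequality, applied to the Schur complement,
    replaces the determinant of the second block by the product of its diagonal. *)
Lemma fischer (k d : nat) (G : 'M[R]_(k + d)) :
  psd G -> ulsubmx G \in unitmx -> psd (ulsubmx G) ->
  \det G <= \det (ulsubmx G) * \prod_i G (rshift k i) (rshift k i).
Proof.
move=> pG uP pP; rewrite (det_schur_psd pG uP).
have /andP[p0 _] := det_psd pP; apply: ler_wpM2l => //.
have /andP[_ h] := det_psd (psd_schur pG uP); apply: (le_trans h).
apply: ler_prod => i _.
by rewrite (psd_diag_ge0 _ (psd_schur pG uP)) schur_diag_le.
Qed.

(** The matrix determinant lemma: the two sides are the expansions of [M] along its two diagonal
    blocks. *)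
Lemma det_add1_rank1 (r : nat) (u : 'cV[R]_r) (v : 'rV[R]_r) :
  \det (1%:M + u *m v) = 1 + (v *m u) 0 0.
Proof.
pose M := block_mx 1%:M (- u) v (1%:M : 'M_1).
have <- : \det M = 1 + (v *m u) 0 0.
  rewrite det_schur ?unitmx1 // det1 mul1r invmx1 mulmx1 mulmxN opprK det_mx11.
  by rewrite mxE [X in X + _]mxE.
have -> : M = block_mx 1%:M (- u) 0 1%:M *m block_mx (1%:M + u *m v) 0 v 1%:M.
  by rewrite mulmx_block !mul1mx !mulmx1 !mul0mx !add0r mulNmx addrK.
by rewrite det_mulmx det_ublock det_lblock !det1 !mul1r mulr1.
Qed.

Lemma gram_unit (p r : nat) (Q : 'M[R]_p) (W : 'M[R]_(r, p)) :
  (forall v, v != 0 -> 0 < dotQ Q v v) -> row_free W ->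
  W *m Q *m W^T \in unitmx.
Proof.
move=> pQ fW; rewrite -row_free_unit -kermx_eq0; apply/eqP/row_matrixP => i.
rewrite row0; set v := row i _; apply/(row_free_inj fW); rewrite mul0mx.
have vG : v *m (W *m Q *m W^T) = 0.
  by apply/sub_kermxP; exact: row_sub.
apply: trmx_inj; rewrite trmx0; apply: contraTeq isT => h.
have := pQ _ h; rewrite /dotQ trmxK trmx_mul !mulmxA.
by rewrite !mulmxA in vG; rewrite vG mul0mx mxE ltxx.
Qed.

End Determinants.

(** * Independent selections of rows and Caratheodory's theorem *)

Definition join_fun (T : Type) (k d : nat) (f : 'I_k -> T) (g : 'I_d -> T)
    (i : 'I_(k + d)) : T :=
  match split i with inl a => f a | inr b => g b end.

Lemma rowsub_join (R : Type) (n p k d : nat) (H : 'M[R]_(n, p))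
    (f : 'I_k -> 'I_n) (g : 'I_d -> 'I_n) :
  rowsub (join_fun f g) H = col_mx (rowsub f H) (rowsub g H).
Proof.
by apply/matrixP => i j; rewrite !mxE /join_fun; case: split => a; rewrite mxE.
Qed.

Section RowSelections.
Variables (F : fieldType) (n p : nat) (H : 'M[F]_(n, p)).

Lemma row_free_row_neq0 (k : nat) (M : 'M[F]_(k, p)) i :
  row_free M -> row i M != 0.
Proof.
move=> fM; apply/eqP => M0; have : delta_mx 0 i *m M = 0 *m M :> 'rV_p.
  by rewrite -rowE M0 mul0mx.
move/(row_free_inj fM)/matrixP => /(_ 0 i); rewrite !mxE !eqxx => /eqP.
by rewrite oner_eq0.
Qed.

Lemma row_free_sel_inj (k : nat) (f : 'I_k -> 'I_n) :
  row_free (rowsub f H) -> injective f.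
Proof.
move=> fr i j eij; apply/eqP; apply: contraT => nij.
have /(row_free_inj fr)/matrixP/(_ 0 i) : delta_mx 0 i *m rowsub f H =
    delta_mx 0 j *m rowsub f H :> 'rV_p.
  by rewrite -!rowE; apply/rowP => l; rewrite !mxE eij.
by rewrite !mxE !eqxx (negPf nij) andbF => /eqP; rewrite oner_eq0.
Qed.

Lemma row_sel_sub (k : nat) (f : 'I_k -> 'I_n) i :
  (row (f i) H <= rowsub f H)%MS.
Proof.
have -> : row (f i) H = row i (rowsub f H) by apply/rowP => j; rewrite !mxE.
exact: row_sub.
Qed.

(** Independence modulo the rows already selected is independence after multiplication by their
    cokernel matrix, so a maximal free selection of rows of [M] is the extension. *)
Lemma extend_row_free (k : nat) (f : 'I_k -> 'I_n) (U : {set 'I_n}) :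
  row_free (rowsub f H) ->
  exists d (g : 'I_d -> 'I_n), [/\ row_free (rowsub (join_fun f g) H),
    forall i, g i \in U &
    forall j, j \in U -> (row j H <= rowsub (join_fun f g) H)%MS].
Proof.
move=> frf; pose K := cokermx (rowsub f H).
(* Zeroing the rows outside [U] keeps the maximal free selection inside [U]. *)
pose HU := \matrix_j (if j \in U then row j H else 0).
pose M := HU *m K; pose g : 'I_(\rank M) -> 'I_n := maxrankfun M.
have frg : row_free (rowsub g M) := maxrowsub_free M.
have rowg (X : 'M[F]_(n, p)) i : row i (rowsub g X) = row (g i) X.
  by apply/rowP => j; rewrite !mxE.
have gU i : g i \in U.
  apply: contraNT (row_free_row_neq0 i frg) => gi.
  by rewrite rowg row_mul rowK (negPf gi) mul0mx.
have Mg : rowsub g M = rowsub g H *m K.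
  apply/row_matrixP => i; rewrite rowg !row_mul rowg rowK gU.
  by congr (_ *m _).
exists _, g; split=> // [|j jU]; rewrite rowsub_join.
  apply: inj_row_free => u; rewrite -(hsubmxK u) mul_row_col.
  move=> u0; have ug : rsubmx u = 0.
    apply: (row_free_inj frg); rewrite mul0mx Mg mulmxA.
    have /(congr1 (mulmx^~ K)) := u0.
    by rewrite mulmxDl -(mulmxA _ _ K) mulmx_coker mulmx0 add0r mul0mx.
  move: u0; rewrite ug mul0mx addr0 => u0.
  have -> : lsubmx u = 0 by apply: (row_free_inj frf); rewrite mul0mx.
  exact: row_mx0.
have : (row j M <= rowsub g M)%MS by rewrite eq_maxrowsub row_sub.
rewrite row_mul rowK jU Mg => /submxP [c].
rewrite mulmxA => /eqP; rewrite -subr_eq0 -mulmxBl -submxE => h.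
rewrite -(subrK (c *m rowsub g H) (row j H)) -addsmxE addmx_sub //.
  exact: submx_trans h (addsmxSl _ _).
exact: submx_trans (submxMl _ _) (addsmxSr _ _).
Qed.

End RowSelections.

(** Induction on the size of the support of [c]: along a linear dependency of the rows in the
    support, the coefficients are moved until one more of them vanishes. *)
Lemma caratheodory (F : realFieldType) (n p : nat) (H : 'M[F]_(n, p))
    (c : 'rV[F]_n) :
  (forall j, 0 <= c 0 j) ->
  exists r (f : 'I_r -> 'I_n) (e : 'rV[F]_r),
    [/\ row_free (rowsub f H), e *m rowsub f H = c *m H,
        forall i, 0 <= e 0 i & forall i, c 0 (f i) != 0].
Proof.
have [k] := ubnP #|[set j | c 0 j != 0]|; elim: k c => // k IH c ck c0.
pose S := [set j | c 0 j != 0]; pose f (i : 'I_#|S|) := enum_val i.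
have fS i : c 0 (f i) != 0 by have := enum_valP i; rewrite inE.
have [fr|] := boolP (row_free (rowsub f H)).
  exists _, f, (\row_i c 0 (f i)); split=> // [|i]; last by rewrite mxE.
  apply/rowP => l; rewrite [RHS]mxE (bigID (mem S)) /= [X in _ + X]big1 ?addr0.
    by rewrite big_enum_val mxE; apply: eq_bigr => i _; rewrite !mxE.
  by move=> j; rewrite inE negbK => /eqP ->; rewrite mul0r.
rewrite -kermx_eq0 => /rowV0Pn [u /sub_kermxP u0 un0].
pose d := u *m rowsub f 1%:M.
have dH : d *m H = 0.
  by rewrite -mulmxA mul_rowsub_mx mul1mx.
have df i : d 0 (f i) = u 0 i.
  rewrite mxE (bigD1 i) //= big1 ?addr0 ?mxE ?eqxx ?mulr1 // => l li.
  by rewrite !mxE (inj_eq enum_val_inj) (negPf li) mulr0.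
have dS j : c 0 j = 0 -> d 0 j = 0.
  move=> cj; rewrite mxE big1 // => i _; rewrite !mxE.
  by have := fS i; case: (f i =P j) => [->|_ _]; rewrite ?cj ?eqxx ?mulr0.
(* Up to sign the dependency has a positive coordinate, so that subtracting it does reach zero
   somewhere. *)
wlog [j0 dj0] : u u0 un0 @d dH df dS / exists j, 0 < d 0 j.
  move=> wl; have [i ui] : exists i, u 0 i != 0.
    apply/existsP; apply: contraNT un0; rewrite negb_exists => /forallP u1.
    by apply/eqP/rowP => i; rewrite mxE; have := u1 i; rewrite negbK => /eqP.
  have [up|] := ltP 0 (u 0 i).
    by apply: (wl u) => //; exists (f i); rewrite df.
  rewrite le_eqVlt (negPf ui) /= => un.
  have dN : (- u) *m rowsub f 1%:M = - d by rewrite mulNmx.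
  apply: (wl (- u)); rewrite ?oppr_eq0 ?dN //.
  - by rewrite mulNmx u0 oppr0.
  - by rewrite mulNmx dH oppr0.
  - by move=> l; rewrite !mxE -df mxE.
  - by move=> j /dS dj; rewrite mxE dj oppr0.
  - by exists (f i); rewrite mxE df oppr_gt0.
(* The coordinate of minimal ratio is the first to reach zero, while all others are still
   nonnegative. *)
clearbody d; pose jm := [arg min_(j < j0 | 0 < d 0 j) (c 0 j / d 0 j)]%O.
have [dm mn] : 0 < d 0 jm /\
    forall j, 0 < d 0 j -> c 0 jm / d 0 jm <= c 0 j / d 0 j.
  by rewrite /jm; case: arg_minP.
pose t := c 0 jm / d 0 jm.
have t0 : 0 <= t by rewrite divr_ge0 // ltW.
pose c' := c - t *: d.
have c'H : c' *m H = c *m H by rewrite mulmxBl -scalemxAl dH scaler0 subr0.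
have c'E j : c' 0 j = c 0 j - t * d 0 j by rewrite !mxE.
have c'S j : c 0 j = 0 -> c' 0 j = 0.
  by move=> cj; rewrite c'E cj dS // mulr0 subr0.
have c'0 j : 0 <= c' 0 j.
  rewrite c'E subr_ge0; have [dj|dj] := ltP 0 (d 0 j).
    by rewrite -ler_pdivlMr // mn.
  by rewrite (le_trans _ (c0 j)) // mulr_ge0_le0.
have c'm : c' 0 jm = 0 by rewrite c'E /t divfK ?subrr // gt_eqF.
have cm : c 0 jm != 0 by apply: contraTneq dm => /dS ->; rewrite ltxx.
have lt : (#|[set j | (c' 0 j != 0)%R]| < #|S|)%N.
  apply: proper_card; apply/properP; split.
    apply/subsetP => j; rewrite !inE; apply: contra => /eqP /c'S ->.
    by rewrite eqxx.
  by exists jm; rewrite !inE // c'm eqxx.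
have [|r [g [e [fr eH e0 gc]]]] := IH c' _ c'0.
  exact: leq_trans lt (ltnSE ck).
exists r, g, e; split=> //; first by rewrite eH.
by move=> i; apply: contra (gc i) => /eqP /c'S ->.
Qed.

Lemma prod_le_Delta_sel (R : realType) (m n : nat) (A : 'M[int]_(m, n)) r
    (f : 'I_r -> 'I_n) :
  injective f -> \rank (rowsub f (Areal R A)^T) = r ->
  \prod_i norm2 (column R A (f i)) <= Delta R A.
Proof.
move=> fI rkf; pose B := [set f i | i in [set: 'I_r]].
have cB : #|B| = r by rewrite card_imset // cardsT card_ord.
have -> : \prod_i norm2 (column R A (f i)) = \prod_(j in B) norm2 (column R A j).
  rewrite big_imset /=; last by move=> i j _ _; exact: fI.
  by apply: eq_bigl => i; rewrite inE.
suff rk : \rank (cols (Areal R A) B) = r by apply: le_bigmax_cond; rewrite rk cB.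
rewrite -mxrank_tr -[RHS]rkf.
have -> : (cols (Areal R A) B)^T = rowsub (fun k : 'I_#|B| => enum_val k)
    (Areal R A)^T by apply/matrixP => i j; rewrite !mxE.
apply/eqmx_rank/andP; split; apply/row_subP => i; last first.
  have fB : f i \in B by rewrite imset_f ?inE.
  have -> : row i (rowsub f (Areal R A)^T) = row (enum_rank_in fB (f i))
    (rowsub (fun k : 'I_#|B| => enum_val k) (Areal R A)^T).
    by apply/rowP => j; rewrite !mxE enum_rankK_in.
  exact: row_sub.
have /imsetP [j _ ej] := enum_valP i.
have -> : row i (rowsub (fun k : 'I_#|B| => enum_val k) (Areal R A)^T) =
    row (f j) (Areal R A)^T by apply/rowP => l; rewrite !mxE ej.
exact: row_sel_sub.
Qed.

Lemma mulmx3E (R : pzRingType) (p q r s : nat) (X : 'M[R]_(p, q))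
    (Y : 'M_(q, r)) (Z : 'M_(r, s)) i j :
  (X *m Y *m Z) i j = (row i X *m Y *m col j Z) 0 0.
Proof.
rewrite -row_mul [LHS]mxE [RHS]mxE; apply: eq_bigr => l _.
by rewrite [row _ _ _ _]mxE [col _ _ _ _]mxE.
Qed.

(** * Normalised columns and their Gram determinants *)

Section Columns.
Variables (R : realType) (m n : nat) (A : 'M[int]_(m, n)).
Hypothesis hA : forall j, col j A != 0.
Local Notation a := (column R A).
Local Notation nu j := (norm2 (a j)).
Local Notation h j := (normalize (a j)).
Local Notation Dl := (Delta R A).

Definition unit_rows : 'M[R]_(n, m) := \matrix_j (h j)^T.
Local Notation H := unit_rows.

(** The squared volume, in the form [Q], of the parallelepiped spanned by the selected normalised
    columns. *)
Definition gram_det r (f : 'I_r -> 'I_n) (Q : 'M[R]_m) : R :=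
  \det (rowsub f H *m Q *m (rowsub f H)^T).

Lemma row_unit_rows j : row j H = (h j)^T.
Proof. exact: rowK. Qed.

Lemma columnE i j : a j i 0 = (A i j)%:~R.
Proof. by rewrite !mxE. Qed.

Lemma nu_sqrE j : nu j ^+ 2 = (\sum_i A i j ^+ 2)%:~R.
Proof.
rewrite norm2_sqr dotQ1vE rmorph_sum; apply: eq_bigr => i _.
by rewrite columnE rmorphXn.
Qed.

(** The squared norm of a nonzero integer vector is a positive integer. *)
Lemma nu_ge1 j : 1 <= nu j.
Proof.
rewrite -(@ler_sqr _ 1) ?nnegrE ?norm2_ge0 ?ler01 // expr1n nu_sqrE.
rewrite ler1z -gtz0_ge1 lt_neqAle sumr_ge0 => [|i _]; last exact: sqr_ge0.
rewrite andbT eq_sym psumr_eq0 => [|i _]; last exact: sqr_ge0.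
apply: contra (hA j) => /allP all0; apply/eqP/colP => i; rewrite !mxE.
by apply/eqP; rewrite -(sqrf_eq0 (A i j)); apply: all0; rewrite mem_index_enum.
Qed.

Lemma nu_gt0 j : 0 < nu j.
Proof. exact: lt_le_trans (nu_ge1 j). Qed.

Lemma nu_neq0 j : nu j != 0.
Proof. by rewrite gt_eqF ?nu_gt0. Qed.

Lemma column_unit j : a j = nu j *: h j.
Proof. by rewrite scalerA mulfV ?scale1r ?nu_neq0. Qed.

Lemma dotQ1_unit j : dotQ 1%:M (h j) (h j) = 1.
Proof.
rewrite dotQZl dotQZr -norm2_sqr mulrA -expr2 -exprMn mulVf ?expr1n //.
exact: nu_neq0.
Qed.

Lemma gramE r (f : 'I_r -> 'I_n) Q i j :
  (rowsub f H *m Q *m (rowsub f H)^T) i j = dotQ Q (h (f i)) (h (f j)).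
Proof.
rewrite mulmx3E /dotQ; congr ((_ *m _ *m _) 0 0).
  by apply/rowP => l; rewrite !mxE.
by apply/colP => l; rewrite !mxE.
Qed.

Lemma gram_det_le r (f : 'I_r -> 'I_n) Q :
  psd Q -> gram_det f Q <= \prod_i dotQ Q (h (f i)) (h (f i)).
Proof.
move=> /(@psd_gram _ _ _ _ (rowsub f H)) /det_psd /andP[_ le].
by apply: (le_trans le); rewrite (eq_bigr _ (fun i _ => gramE f Q i i)).
Qed.

Lemma gram_det_le1 r (f : 'I_r -> 'I_n) : gram_det f 1%:M <= 1.
Proof.
apply: (le_trans (gram_det_le f (psd1 R m))).
by rewrite big1 // => i _; rewrite dotQ1_unit.
Qed.

Lemma gram_det_gt0 r (f : 'I_r -> 'I_n) (Q : 'M[R]_m) :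
  psd Q -> (forall v, v != 0 -> 0 < dotQ Q v v) -> row_free (rowsub f H) ->
  0 < gram_det f Q.
Proof.
move=> pQ dQ fr; have := gram_unit dQ fr; rewrite unitmxE unitfE => u.
rewrite lt_neqAle eq_sym u /=.
by have /andP[] := det_psd (psd_gram (rowsub f H) pQ).
Qed.

Lemma dotQ1_gt0 (v : 'cV[R]_m) : v != 0 -> 0 < dotQ 1%:M v v.
Proof.
move=> v0; rewrite lt_neqAle dotQ1_ge0 andbT eq_sym.
by apply: contra_neq v0; exact: dotQ1_eq0.
Qed.

Lemma rowsub_real r (f : 'I_r -> 'I_n) :
  rowsub f (Areal R A)^T = diag_mx (\row_i nu (f i)) *m rowsub f H.
Proof.
apply/matrixP => i j; rewrite mul_diag_mx !mxE mulrA mulfV ?mul1r //.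
exact: nu_neq0.
Qed.

Lemma prod_le_Delta r (f : 'I_r -> 'I_n) :
  row_free (rowsub f H) -> \prod_i nu (f i) <= Dl.
Proof.
move=> fr; apply: prod_le_Delta_sel; first exact: row_free_sel_inj fr.
rewrite rowsub_real eqmxMfull; first exact/eqP.
rewrite row_full_unit unitmxE det_diag unitfE prodf_seq_neq0.
by apply/allP => i _; rewrite mxE nu_neq0.
Qed.

Lemma Delta_ge1 : 1 <= Dl.
Proof.
apply: (bigmax_sup set0); last by rewrite big_set0.
by rewrite eqn_leq rank_leq_col andbT (leq_trans (eq_leq (cards0 _))).
Qed.

Lemma Delta_gt0 : 0 < Dl.
Proof. exact: lt_le_trans Delta_ge1. Qed.

(** The Gram determinant of the integer columns themselves is a positive integer, hence at least 1.
    Normalising divides it by the squared product of their norms, which [Delta] bounds. *)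
Lemma gram_det1_ge r (f : 'I_r -> 'I_n) :
  row_free (rowsub f H) -> 1 <= Dl ^+ 2 * gram_det f 1%:M.
Proof.
move=> fr; have d0 := gram_det_gt0 (psd1 R m) dotQ1_gt0 fr.
pose B := rowsub f A^T; pose p := \prod_i nu (f i).
have p0 : 0 < p by apply: prodr_gt0 => i _; exact: nu_gt0.
have key : (\det (B *m B^T))%:~R = p ^+ 2 * gram_det f 1%:M.
  rewrite -det_map_mx map_mxM -map_trmx.
  have -> : map_mx intr B = rowsub f (Areal R A)^T.
    by apply/matrixP => i j; rewrite !mxE.
  rewrite rowsub_real trmx_mul tr_diag_mx mulmxA -(mulmxA (diag_mx _)).
  rewrite !det_mulmx !det_diag /gram_det mulmx1 /p.
  by under eq_bigr do rewrite mxE; ring.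
apply: (@le_trans _ _ (p ^+ 2 * gram_det f 1%:M)).
  rewrite -key ler1z -gtz0_ge1 -(ltr0z R) key mulr_gt0 ?exprn_gt0 //.
rewrite ler_pM2r // ler_sqr ?nnegrE ?(ltW p0) ?(ltW Delta_gt0) //.
exact: prod_le_Delta.
Qed.

(* Replacing the j-th row of a basis by y multiplies the Gram determinant by
   the square of the j-th coordinate of y, which Hadamard's inequality and
   integrality then bound. *)
Lemma coef_bound r (f : 'I_r -> 'I_n) (c : 'rV[R]_r) (y : 'cV[R]_m) j :
  row_free (rowsub f H) -> y^T = c *m rowsub f H ->
  c 0 j ^+ 2 <= Dl ^+ 2 * dotQ 1%:M y y.
Proof.
move=> fr yE; pose E := \matrix_i (if i == j then c else delta_mx 0 i).
pose W := rowsub f H.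
have dE : \det E = c 0 j.
  have tE : E = 1%:M + delta_mx j 0 *m (c - delta_mx 0 j).
    apply/row_matrixP => i; rewrite rowK linearD /= row_mul row1.
    case: eqP => [->|/eqP ij].
      by rewrite rowE mul_delta_mx [delta_mx 0 0]mx11_scalar mxE mul_scalar_mx
        scale1r addrC subrK.
    by rewrite rowE mul_delta_mx_0 // mul0mx addr0.
  rewrite tE det_add1_rank1 -colE !mxE !eqxx /=.
  by ring.
have EW : forall i, row i (E *m W) = if i == j then y^T else (h (f i))^T.
  move=> i; rewrite row_mul rowK; case: eqP => [_|_]; first by rewrite -yE.
  by rewrite -rowE -row_unit_rows; apply/rowP => l; rewrite !mxE.
have pE := psd_gram (E *m W) (psd1 R m).
have /andP[_] := det_psd pE.
have -> : \det (E *m W *m 1%:M *m (E *m W)^T) = c 0 j ^+ 2 * gram_det f 1%:M.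
  by rewrite !mulmx1 trmx_mul -mulmxA [W *m _]mulmxA !det_mulmx det_tr dE
    /gram_det mulmx1; ring.
have -> : \prod_i (E *m W *m 1%:M *m (E *m W)^T) i i = dotQ 1%:M y y.
  rewrite (bigD1 j) //= big1 ?mulr1 => [|i ij].
    by rewrite mulmx3E EW eqxx -tr_row EW eqxx trmxK.
  by rewrite mulmx3E EW (negPf ij) -tr_row EW (negPf ij) trmxK; exact: dotQ1_unit.
move=> le; have ge := gram_det1_ge fr.
have D0 : 0 < Dl ^+ 2 by rewrite exprn_gt0 // Delta_gt0.
apply: (@le_trans _ _ (c 0 j ^+ 2 * (Dl ^+ 2 * gram_det f 1%:M))).
  by rewrite ler_peMr ?sqr_ge0.
by rewrite mulrCA ler_pM2l.
Qed.

End Columns.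

(** * Norms of columns in the support of a solution *)

Section Support.
Variables (R : realType) (m n : nat) (A : 'M[int]_(m, n)).
Hypothesis hA : forall j, col j A != 0.
Local Notation a := (column R A).
Local Notation nu j := (norm2 (a j)).
Local Notation h j := (normalize (a j)).
Local Notation Dl := (Delta R A).
Local Notation H := (unit_rows R A).

Lemma rows_gt0 (j : 'I_n) : (0 < m)%N.
Proof.
rewrite lt0n; apply: contra (hA j) => /eqP m0; apply/eqP/colP => i.
by have := ltn_ord i; rewrite [X in (_ < X)%N]m0.
Qed.

Lemma Areal_mul (z : 'cV[R]_n) : Areal R A *m z = \sum_j z j 0 *: a j.
Proof.
apply/colP => i; rewrite !mxE summxE; apply: eq_bigr => j _.
by rewrite !mxE mulrC.
Qed.

Lemma mul_unit_rows (c : 'rV[R]_n) : (c *m H)^T = \sum_j c 0 j *: h j.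
Proof.
apply/colP => i; rewrite !mxE summxE; apply: eq_bigr => j _.
by rewrite !mxE.
Qed.

Lemma mul_unit_rows_sel r (f : 'I_r -> 'I_n) (c : 'rV[R]_r) :
  (c *m rowsub f H)^T = \sum_i c 0 i *: h (f i).
Proof.
apply/colP => i; rewrite !mxE summxE; apply: eq_bigr => j _.
by rewrite !mxE.
Qed.

Lemma theta_inv : (theta R A)^-1 = m%:R ^+ 2 * Dl ^+ 2.
Proof. by rewrite invrK. Qed.

Lemma normQ_column Q j : normQ Q (a j) = nu j * normQ Q (h j).
Proof. by rewrite {1}(column_unit R hA) normQZ ger0_norm ?norm2_ge0. Qed.

(** Solving [z] for column k writes [- h k] as a nonnegative combination of other columns, which
    Caratheodory makes independent, with coefficients e_i at most Delta. The hypothesis on the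
    weights gives ||h_k||_Q + sum e_i ||h_(f i)||_Q <= 1 + sum e_i, and the triangle inequality
    bounds the first term by the second. Hence 2 ||h_k||_Q <= 1 + m Delta <= 2 / theta. *)
Lemma support_norm_bound Q (z : 'cV[R]_n) k :
  psd Q -> kernel_solution A z -> z k 0 != 0 ->
  (forall z', kernel_solution A z' -> (forall j, z j 0 = 0 -> z' j 0 = 0) ->
     \sum_j z' j 0 * normQ Q (a j) <= \sum_j z' j 0 * nu j) ->
  normQ Q (h k) <= (theta R A)^-1.
Proof.
move=> pQ [Az z0] zk pot.
have zk0 : 0 < z k 0 by rewrite lt_neqAle eq_sym zk z0.
pose c : 'rV[R]_n := \row_j (if j == k then 0 else z j 0 * nu j / (z k 0 * nu k)).
have c0 j : 0 <= c 0 j.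
  by rewrite mxE; case: eqP => // _; rewrite divr_ge0 ?mulr_ge0 ?norm2_ge0.
have [r [f [e [fr eH e0 ce]]]] := caratheodory H c0.
have hk : - h k = \sum_i e 0 i *: h (f i).
  rewrite -mul_unit_rows_sel eH mul_unit_rows.
  move: Az; rewrite Areal_mul (bigD1 k) //= => /eqP.
  rewrite addr_eq0 => /eqP zA.
  rewrite (bigD1 k) //= mxE eqxx scale0r add0r.
  have zn : z k 0 * nu k != 0 by rewrite mulf_neq0 // (nu_neq0 R hA).
  apply: (scalerI zn); rewrite scalerN -scalerA -(column_unit R hA) zA opprK.
  rewrite scaler_sumr; apply: eq_bigr => j jk.
  rewrite mxE (negPf jk) scalerA mulrC divfK // -scalerA.
  by rewrite -(column_unit R hA).
(* The elementary solution behind [hk]; dividing by the norms turns multipliers of [h j] into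
   multipliers of [a j]. *)
pose z' : 'cV[R]_n := \col_j ((\sum_(i | f i == j) e 0 i) / nu j +
  (j == k)%:R / nu k).
have sum_z' (V : lmodType R) (F : 'I_n -> V) :
    \sum_j z' j 0 *: (nu j *: F j) = F k + \sum_i e 0 i *: F (f i).
  under eq_bigr => j _ do rewrite mxE scalerDl scalerA scalerA
    divfK ?(nu_neq0 R hA) //.
  rewrite big_split /= addrC; congr (_ + _).
    rewrite (bigD1 k) //= eqxx mul1r mulVf ?(nu_neq0 R hA) // scale1r.
    rewrite big1 ?addr0 // => j /negPf ->; by rewrite !mul0r scale0r.
  under eq_bigr do rewrite scaler_suml.
  rewrite [RHS](partition_big f xpredT) //=; apply: eq_bigr => j _.
  by apply: eq_bigr => i /eqP ->.
have kz' : kernel_solution A z'.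
  split; last first.
    move=> j; rewrite mxE addr_ge0 ?divr_ge0 ?norm2_ge0 ?ler0n //.
    by rewrite sumr_ge0.
  rewrite Areal_mul; under eq_bigr do rewrite (column_unit R hA).
  by rewrite sum_z' -hk subrr.
have sz' j : z j 0 = 0 -> z' j 0 = 0.
  move=> zj; rewrite mxE big1 ?mul0r ?add0r => [|i /eqP fi].
    by case: (j =P k) zk => [<-|_ _]; rewrite ?zj ?eqxx ?mulr0n ?mul0r.
  by have := ce i; rewrite fi mxE zj !mul0r if_same eqxx.
have := pot z' kz' sz'.
under eq_bigr do rewrite normQ_column.
have := sum_z' R^o (fun j => normQ Q (h j)) => /= ->.
have -> : \sum_j z' j 0 * nu j = 1 + \sum_i e 0 i.
  have := sum_z' R^o (fun j => 1); rewrite /GRing.scale /=.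
  under eq_bigr do rewrite mulr1.
  by move=> ->; congr (_ + _); apply: eq_bigr => j _; rewrite mulr1.
rewrite /GRing.scale /= => le1.
(* The triangle inequality, by pairing both sides of [hk] with [h k] and dividing by its norm. *)
have le2 : normQ Q (h k) <= \sum_i e 0 i * normQ Q (h (f i)).
  have [->|nk] := eqVneq (normQ Q (h k)) 0.
    by rewrite sumr_ge0 // => i _; rewrite mulr_ge0 ?normQ_ge0.
  have nk0 : 0 < normQ Q (h k) by rewrite lt_neqAle eq_sym nk normQ_ge0.
  rewrite -(ler_pM2r nk0) -expr2 normQ_sqr // mulr_suml.
  rewrite -[X in dotQ Q X]opprK hk dotQNl dotQ_suml -sumrN.
  apply: ler_sum => i _; rewrite dotQZl -mulrN -mulrA ler_wpM2l //.
  by apply: (le_trans (ler_norm _)); rewrite normrN dotQ_le_norm.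
have le3 : \sum_i e 0 i <= m%:R * Dl.
  have rm : (r <= m)%N by rewrite -(eqP fr) rank_leq_col.
  have D0 := Delta_gt0 R A.
  apply: (@le_trans _ _ (\sum_(i < r) Dl)).
    apply: ler_sum => i _; rewrite -ler_sqr ?nnegrE ?(ltW D0) //.
    have := @coef_bound R _ _ A hA _ f e (- h k) i fr.
    rewrite dotQNl dotQNr opprK (dotQ1_unit R hA) mulr1; apply.
    by rewrite hk -mul_unit_rows_sel trmxK.
  by rewrite sumr_const card_ord -[leLHS]mulr_natl ler_wpM2r ?ler_nat // ltW.
have m1 : 1 <= m%:R :> R by rewrite ler1n (rows_gt0 k).
have D1 := Delta_ge1 R A; rewrite theta_inv.
have mD : 1 <= m%:R * Dl by rewrite -[leLHS]mulr1 ler_pM.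
apply: (@le_trans _ _ (m%:R * Dl)); first by lra.
by rewrite -exprMn expr2 ler_peMr // (le_trans ler01).
Qed.

End Support.

(** * The orthogonal projection onto a kernel *)

Section KernelProjection.
Variables (R : realType) (p q : nat) (B : 'M[R]_(p, q)).

(** A characterisation free of the pseudo-inverse, against which the projection computed by the
    program can be compared. *)
Definition is_ker_proj (P : 'M[R]_q) : Prop :=
  [/\ B *m P = 0, P^T = P & exists X, 1%:M - P = B^T *m X].

Lemma is_ker_proj_unique P1 P2 : is_ker_proj P1 -> is_ker_proj P2 -> P1 = P2.
Proof.
move=> [BP1 sP1 [X1 e1]] [BP2 sP2 [X2 e2]].
have f P X Q : P^T = P -> B *m P = 0 -> 1%:M - Q = B^T *m X -> P *m Q = P.
  move=> sP BP e; have -> : Q = 1%:M - B^T *m X by rewrite -e opprB addrC subrK.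
  rewrite mulmxBr mulmx1 mulmxA -{2}sP -trmx_mul BP trmx0 mul0mx.
  by rewrite subr0.
have e12 := f _ _ _ sP1 BP1 e2; have e21 := f _ _ _ sP2 BP2 e1.
by rewrite -[LHS]e12 -[RHS]sP2 -[X in _ = X^T]e21 trmx_mul sP1 sP2.
Qed.

(** The pseudo-inverse of the symmetric matrix [B *m B^T] is symmetric by uniqueness.
    [B *m ker_proj B] is a matrix whose product with its own transpose vanishes by the first Penrose
    identity. *)
Lemma is_ker_projP : is_ker_proj (ker_proj B).
Proof.
have [h1 h2 h3 h4] := mp_inverseP (B *m B^T).
set P := mp_inverse _ in h1 h2 h3 h4 *.
have sM : (B *m B^T)^T = B *m B^T by rewrite trmx_mul trmxK.
have sP : P^T = P.
  apply: (@penrose_unique _ _ _ (B *m B^T)); last by split.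
  have e1 : (B *m B^T *m P^T) = (P *m (B *m B^T))^T by rewrite trmx_mul sM.
  have e2 : (P^T *m (B *m B^T)) = (B *m B^T *m P)^T by rewrite [RHS]trmx_mul sM.
  split; rewrite ?e1 ?e2 ?trmxK //.
  - apply: trmx_inj; rewrite trmx_mul trmxK sM.
    by rewrite (mulmxA _ P) h1.
  - by rewrite -trmx_mul (mulmxA P) h2.
split.
- have Z : B *m ker_proj B = (1%:M - B *m B^T *m P) *m B.
    by rewrite mulmxBl mul1mx /ker_proj mulmxBr mulmx1 !mulmxA.
  apply: trmx_mulmx_eq0; rewrite Z trmx_mul mulmxA -(mulmxA _ B).
  by rewrite mulmxBl mul1mx h1 subrr mul0mx.
- by rewrite /ker_proj -/P linearB /= !trmx_mul trmxK trmx1 sP mulmxA.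
- by exists (P *m B); rewrite /ker_proj -/P opprB addrC subrK mulmxA.
Qed.

Lemma ker_proj_id (w : 'cV[R]_q) : B *m w = 0 -> ker_proj B *m w = w.
Proof. by move=> Bw; rewrite /ker_proj mulmxBl mul1mx -(mulmxA _ B) Bw mulmx0 subr0. Qed.

Lemma mul_ker_proj : B *m ker_proj B = 0.
Proof. by case: is_ker_projP. Qed.

(* The correction x - Pi x is the shortest solution of B w = B x. *)
Lemma ker_proj_shortest (x w : 'cV[R]_q) : B *m w = B *m x ->
  dotQ 1%:M (x - ker_proj B *m x) (x - ker_proj B *m x) <= dotQ 1%:M w w.
Proof.
have [BP sP _] := is_ker_projP; set P := ker_proj B in BP sP * => eBw.
have -> : x - P *m x = w - P *m w.
  have : P *m (x - w) = x - w by apply: ker_proj_id; rewrite mulmxBr eBw subrr.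
  rewrite mulmxBr => /eqP; rewrite subr_eq => /eqP ->.
  by rewrite opprD opprB addrA [x + _]addrCA subrr addr0.
set v := w - P *m w.
have wE : w = v + P *m w by rewrite subrK.
have Pv : P *m v = 0 by rewrite mulmxBr (ker_proj_id (w := P *m w)) ?subrr // mulmxA BP mul0mx.
have o : dotQ 1%:M v (P *m w) = 0.
  rewrite dotQC ?trmx1 // /dotQ mulmx1 trmx_mul sP -mulmxA Pv mulmx0.
  by rewrite mxE.
clearbody v; rewrite {1 2}wE !dotQDl !dotQDr o (dotQC (P *m w)) ?trmx1 // o addr0 add0r.
by rewrite lerDl dotQ1_ge0.
Qed.

End KernelProjection.

(** * Bases of sets of columns; positivity of the projection *)

Section Bases.
Variables (R : realType) (m n : nat) (A : 'M[int]_(m, n)).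
Hypothesis hA : forall j, col j A != 0.
Local Notation a := (column R A).
Local Notation nu j := (norm2 (a j)).
Local Notation h j := (normalize (a j)).
Local Notation Dl := (Delta R A).
Local Notation H := (unit_rows R A).
Local Notation rk S := (\rank (cols (Areal R A) S)).
Implicit Types S U : {set 'I_n}.

(** Bases are selections rather than sets, so that an extension appends rows and the Gram matrix
    takes the block form of Fischer's inequality. *)
Definition is_basis S r (f : 'I_r -> 'I_n) :=
  [/\ row_free (rowsub f H), forall i, f i \in S &
      forall j, j \in S -> (row j H <= rowsub f H)%MS].

Lemma unit_row_sub_cols S j :
  j \in S -> (row j H <= (cols (Areal R A) S)^T)%MS.
Proof.
move=> jS; have -> : row j H =
    (nu j)^-1 *: row (enum_rank_in jS j) (cols (Areal R A) S)^T.
  by apply/rowP => i; rewrite !mxE enum_rankK_in.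
by rewrite scalemx_sub // row_sub.
Qed.

Lemma cols_sub S p (W : 'M[R]_(p, m)) :
  (forall j, j \in S -> (row j H <= W)%MS) -> ((cols (Areal R A) S)^T <= W)%MS.
Proof.
move=> hS; apply/row_subP => i.
have -> : row i (cols (Areal R A) S)^T = nu (enum_val i) *: row (enum_val i) H.
  apply/rowP => l; rewrite !mxE mulrA mulfV ?mul1r //.
  exact: (nu_neq0 R hA).
by rewrite scalemx_sub // hS // enum_valP.
Qed.

Lemma sel_sub_cols S r (f : 'I_r -> 'I_n) :
  (forall i, f i \in S) -> (rowsub f H <= (cols (Areal R A) S)^T)%MS.
Proof.
move=> fS; apply/row_subP => i.
have -> : row i (rowsub f H) = row (f i) H by apply/rowP => l; rewrite !mxE.
exact: unit_row_sub_cols.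
Qed.

Lemma basis_rank S r (f : 'I_r -> 'I_n) : is_basis S f -> rk S = r.
Proof.
move=> [fr fS sp]; rewrite -mxrank_tr -[RHS](eqP fr).
by apply/eqmx_rank/andP; rewrite sel_sub_cols // cols_sub.
Qed.

Lemma rank_le_rows S : (rk S <= m)%N.
Proof. exact: rank_leq_row. Qed.

Lemma basis_exists S : exists r (f : 'I_r -> 'I_n), is_basis S f.
Proof.
pose f0 (i : 'I_0) : 'I_n := False_rect _ (notF (ltn_ord i)).
have fr0 : row_free (rowsub f0 H) by rewrite /row_free eqn_leq rank_leq_row.
have [d [g [fr gS sp]]] := extend_row_free S fr0.
exists _, (join_fun f0 g); split=> // i; rewrite /join_fun; case: split => // j.
by case: (notF (ltn_ord j)).
Qed.

Lemma basis_sub S U r (f : 'I_r -> 'I_n) :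
  is_basis U f -> U \subset S -> rk U = rk S -> is_basis S f.
Proof.
move=> bU US eqr; have [fr fU _] := bU.
have fS i : f i \in S by apply: (subsetP US).
split=> // j jS; apply: (submx_trans (unit_row_sub_cols jS)).
rewrite -(geq_leqif (mxrank_leqif_sup (sel_sub_cols fS))) mxrank_tr.
by rewrite -eqr (basis_rank bU) (eqP fr).
Qed.

Lemma basis_extend S U r (f : 'I_r -> 'I_n) :
  is_basis U f -> U \subset S ->
  exists d (g : 'I_d -> 'I_n), (forall i, g i \in S) /\ is_basis S (join_fun f g).
Proof.
move=> [fr fU _] US; have [d [g [frj gS sp]]] := extend_row_free S fr.
exists d, g; split=> //; split=> // i; rewrite /join_fun.
by case: split => // j; exact: (subsetP US).
Qed.

Lemma gram_det_join (Q : 'M[R]_m) k d (f : 'I_k -> 'I_n) (g : 'I_d -> 'I_n) :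
  psd Q -> (forall v, v != 0 -> 0 < dotQ Q v v) -> row_free (rowsub f H) ->
  gram_det A (join_fun f g) Q <=
    gram_det A f Q * \prod_i dotQ Q (h (g i)) (h (g i)).
Proof.
move=> pQ dQ fr; set G := rowsub (join_fun f g) H *m Q *m
  (rowsub (join_fun f g) H)^T.
have ul : ulsubmx G = rowsub f H *m Q *m (rowsub f H)^T.
  rewrite /G rowsub_join tr_col_mx mul_col_mx mul_col_row.
  by rewrite block_mxKul.
have pG : psd G by exact: psd_gram.
have := fischer pG; rewrite ul.
have uu := gram_unit dQ fr; have pp := psd_gram (rowsub f H) pQ.
move=> /(_ uu pp) le; apply: (le_trans le).
rewrite ler_wpM2l //; first by case/andP: (det_psd pp).
apply: ler_prod => i _; rewrite (psd_diag_ge0 _ pG) /= gramE /join_fun.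
by rewrite (unsplitK (inr i)).
Qed.

Lemma hat_colsE S i k : hat_cols R A S i k = h (enum_val k) i 0.
Proof.
rewrite mxE; congr (normalize _ i 0); apply/colP => l.
by rewrite !mxE.
Qed.

Lemma hat_cols_mul S (w : 'cV[R]_#|S|) :
  hat_cols R A S *m w = \sum_k w k 0 *: h (enum_val k).
Proof.
apply/colP => i; rewrite mxE summxE; apply: eq_bigr => k _.
by rewrite hat_colsE !mxE mulrC.
Qed.

Lemma hat_cols_entries S (x : 'cV[R]_n) :
  hat_cols R A S *m entries x S = \sum_(j in S) x j 0 *: h j.
Proof.
rewrite hat_cols_mul [RHS]big_enum_val; apply: eq_bigr => k _.
by rewrite mxE.
Qed.

(** An entry of [Pi x] that is not positive leaves an entry at least 1 in x - Pi x. But the latter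
    is a shortest preimage of [y], and a basis provides a preimage with at most m nonzero entries,
    each at most Delta ||y|| in absolute value. *)
Lemma projection_positive S (x : 'cV[R]_n) (y : 'cV[R]_m) :
  (forall j, j \in S -> 1 <= x j 0) -> y = \sum_(j in S) x j 0 *: h j ->
  m%:R * Dl ^+ 2 * dotQ 1%:M y y < 1 ->
  forall k, 0 < (Pi_of R A S *m entries x S) k 0.
Proof.
move=> x1 yE small k; rewrite ltNge; apply/negP => neg.
set xs := entries x S in neg *; set w := xs - Pi_of R A S *m xs.
have wk : 1 <= w k 0.
  have -> : w k 0 = x (enum_val k) 0 - (Pi_of R A S *m xs) k 0.
    by rewrite [LHS]mxE [X in X + _]mxE [X in _ + X]mxE.
  rewrite lerBrDr.
  by rewrite -[leRHS]addr0 lerD // x1 // enum_valP.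
have w1 : 1 <= dotQ 1%:M w w.
  rewrite dotQ1vE (bigD1 k) //= -[leLHS]addr0 lerD ?expr_ge1 //.
    by rewrite (le_trans ler01).
  by apply: sumr_ge0 => i _; rewrite sqr_ge0.
have [r [f [fr fS sp]]] := basis_exists S.
have /submxP [c yc] : (y^T <= rowsub f H)%MS.
  rewrite yE linear_sum /= summx_sub // => j jS.
  by rewrite linearZ /= scalemx_sub // -row_unit_rows sp.
(* Right multiplication by [P] puts the basis coefficients at the positions of their columns within
   [S]; it preserves lengths. *)
pose P : 'M[R]_(r, #|S|) := \matrix_(i, l) (f i == enum_val l)%:R.
have Bw : hat_cols R A S *m (c *m P)^T = hat_cols R A S *m xs.
  rewrite hat_cols_entries -yE -[RHS]trmxK yc mul_unit_rows_sel hat_cols_mul.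
  under eq_bigr do rewrite mxE mxE scaler_suml.
  rewrite exchange_big; apply: eq_bigr => i _.
  rewrite (bigD1 (enum_rank_in (fS i) (f i))) //= big1 ?addr0.
    by rewrite mxE enum_rankK_in // eqxx mulr1.
  move=> l nl; rewrite mxE; case: eqP => [e|_]; last by rewrite mulr0 scale0r.
  by case/eqP: nl; apply: enum_val_inj; rewrite enum_rankK_in.
have PP : P *m P^T = 1%:M.
  apply/matrixP => i j; rewrite !mxE.
  rewrite (bigD1 (enum_rank_in (fS i) (f i))) //= big1 ?addr0.
    rewrite !mxE enum_rankK_in // eqxx mul1r eq_sym.
    by rewrite (inj_eq (row_free_sel_inj fr)).
  move=> l nl; rewrite mxE; case: eqP => [e|_]; last by rewrite mul0r.
  by case/eqP: nl; apply: enum_val_inj; rewrite enum_rankK_in.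
have := ker_proj_shortest Bw; rewrite -/(Pi_of R A S) -/w.
have -> : dotQ 1%:M (c *m P)^T (c *m P)^T = \sum_i c 0 i ^+ 2.
  rewrite /dotQ mulmx1 trmxK trmx_mul mulmxA -(mulmxA c) PP mulmx1 mxE.
  by apply: eq_bigr => i _; rewrite mxE.
have le : \sum_i c 0 i ^+ 2 <= m%:R * Dl ^+ 2 * dotQ 1%:M y y.
  have rm : (r <= m)%N by rewrite -(eqP fr) rank_leq_col.
  apply: (@le_trans _ _ (\sum_(i < r) (Dl ^+ 2 * dotQ 1%:M y y))).
    apply: ler_sum => i _; exact: (coef_bound hA i fr yc).
  rewrite sumr_const card_ord -[leLHS]mulr_natl -mulrA ler_wpM2r ?ler_nat //.
  by rewrite mulr_ge0 ?sqr_ge0 ?dotQ1_ge0.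
move=> le'; have := le_lt_trans (le_trans w1 (le_trans le' le)) small.
by rewrite ltxx.
Qed.

End Bases.

(** * The effect of one rescaling of Q *)

Section Rescaling.
Variables (R : realType) (m : nat).
Hypothesis m_gt0 : (0 < m)%N.
Local Notation eps := (epsilon R m).

Definition kappa : R := ((1 + 3 * eps) ^+ 2)^-1.

Lemma eps_gt0 : 0 < eps.
Proof. by rewrite invr_gt0 mulr_gt0 ?ltr0n. Qed.

Lemma m_eps : m%:R * eps = 11^-1.
Proof. by rewrite /epsilon invfM mulrCA mulfV ?mulr1 // pnatr_eq0 -lt0n. Qed.

Lemma eps_le : eps <= 11^-1.
Proof.
by rewrite -m_eps -[leLHS]mul1r ler_wpM2r ?ler1n // ltW // eps_gt0.
Qed.

Lemma kappa_gt0 : 0 < kappa.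
Proof. by rewrite invr_gt0 exprn_gt0 // addr_gt0 // mulr_gt0 // eps_gt0. Qed.

Lemma kappa_le1 : kappa <= 1.
Proof.
rewrite invf_le1 ?exprn_gt0 ?addr_gt0 ?mulr_gt0 ?eps_gt0 //.
by rewrite exprn_ege1 // lerDl mulr_ge0 // ltW // eps_gt0.
Qed.

Lemma exprD1_le (t : R) (k : nat) : 0 <= t -> (1 + t) ^+ k * (1 - k%:R * t) <= 1.
Proof.
move=> t0; elim: k => [|k IH]; first by rewrite mul0r subr0 mulr1.
apply: le_trans IH; rewrite exprSr -mulrA ler_wpM2l ?exprn_ge0 ?addr_ge0 //.
rewrite -natr1; have : 0 <= (k%:R + 1) * t ^+ 2 by rewrite mulr_ge0 ?sqr_ge0 ?addr_ge0.
by move=> h; rewrite -subr_ge0; apply: le_trans h _; rewrite le_eqVlt; apply/orP; left; apply/eqP; ring.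
Qed.

(** (1 + 3 eps)^m <= 1 / (1 - 3 m eps) = 11 / 8, whose square is below 2. The 11 in [epsilon] is the
    least integer for which this estimate stays below 2. *)
Lemma kappa_exp_m : 2^-1 <= kappa ^+ m.
Proof.
have t0 : 0 <= 3 * eps by rewrite mulr_ge0 // ltW // eps_gt0.
have := exprD1_le m t0; rewrite mulrCA m_eps => le.
have e0 : 0 <= (1 + 3 * eps) ^+ m by rewrite exprn_ge0 // addr_ge0.
have -> : kappa ^+ m = (((1 + 3 * eps) ^+ m) ^+ 2)^-1.
  by rewrite /kappa exprVn -!exprM mulnC.
have : 0 < (1 + 3 * eps) ^+ m by rewrite exprn_gt0 // ltr_pwDl.
set u := (_ ^+ m) in le e0 * => u0.
rewrite lef_pV2 ?posrE ?exprn_gt0 ?ltr_pwDl //.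
have : u <= 11 / 8 by lra.
by nra.
Qed.

Lemma dotQ_rescale (Q : 'M[R]_m) y v w : psd Q ->
  dotQ (rescaleQ Q y) v w =
    kappa * (dotQ Q v w + 3 * dotQ Q v y * dotQ Q y w / dotQ Q y y).
Proof.
move=> pQ; have key : (v^T *m (Q *m y *m y^T *m Q) *m w) 0 0 =
    dotQ Q v y * dotQ Q y w.
  have -> : v^T *m (Q *m y *m y^T *m Q) *m w =
      (v^T *m Q *m y) *m (y^T *m Q *m w) by rewrite !mulmxA.
  by rewrite mxE big_ord1.
rewrite -(normQ_sqr y pQ) {1}/dotQ /rescaleQ -/kappa.
rewrite -scalemxAr -scalemxAl mxE mulmxDr mulmxDl mxE.
rewrite -scalemxAr -scalemxAl [X in _ * (_ + X)]mxE.
rewrite -scalemxAr -scalemxAl [X in _ * (_ + _ * X)]mxE key.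
by rewrite /dotQ; ring.
Qed.

Lemma psd_rescale (Q : 'M[R]_m) y : psd Q -> psd (rescaleQ Q y).
Proof.
move=> pQ; have [sQ Q0] := pQ; split.
  rewrite /rescaleQ linearZ /= linearD /= linearZ /= linearZ /=.
  by rewrite !trmx_mul trmxK sQ !mulmxA.
move=> v; rewrite dotQ_rescale // (dotQC y v sQ) mulr_ge0 ?(ltW kappa_gt0) //.
by rewrite addr_ge0 // divr_ge0 // -mulrA mulr_ge0 // -expr2 sqr_ge0.
Qed.

Lemma dotQ_rescale_ge (Q : 'M[R]_m) y v : psd Q ->
  kappa * dotQ Q v v <= dotQ (rescaleQ Q y) v v.
Proof.
move=> pQ; have [sQ Q0] := pQ; rewrite dotQ_rescale // (dotQC y v sQ).
rewrite ler_wpM2l ?(ltW kappa_gt0) // lerDl.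
by rewrite divr_ge0 // -mulrA mulr_ge0 // -expr2 sqr_ge0.
Qed.

Lemma dotQ_rescale_le (Q : 'M[R]_m) y v : psd Q -> 0 < dotQ Q y y ->
  dotQ (rescaleQ Q y) v v <= 4 * dotQ Q v v.
Proof.
move=> pQ y0; have [sQ Q0] := pQ; rewrite dotQ_rescale // (dotQC y v sQ).
apply: (@le_trans _ _ (1 * (4 * dotQ Q v v))); last by rewrite mul1r.
apply: ler_pM; rewrite ?(ltW kappa_gt0) ?kappa_le1 //.
  by rewrite addr_ge0 // divr_ge0 ?(ltW y0) // -mulrA mulr_ge0 // -expr2 sqr_ge0.
have := cauchy_schwarz v y pQ; rewrite -ler_pdivrMr // => le.
by rewrite -!mulrA [_ * (_ / _)]mulrA -expr2; lra.
Qed.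

Lemma dotQ_rescale_self (Q : 'M[R]_m) y v : psd Q -> 0 < dotQ Q y y ->
  dotQ (rescaleQ Q y) v y = 4 * kappa * dotQ Q v y.
Proof.
by move=> pQ y0; rewrite dotQ_rescale // mulfK ?gt_eqF //; ring.
Qed.

(* From sqrt (a^2 + 3 b^2) <= a + b for 0 <= b <= a. *)
Lemma normQ_rescale_le (Q : 'M[R]_m) y v : psd Q -> 0 < dotQ Q y y ->
  normQ (rescaleQ Q y) v <=
    (1 + 3 * eps)^-1 * (normQ Q v + `|dotQ Q v y| / normQ Q y).
Proof.
move=> pQ y0; have [sQ Q0] := pQ.
have e0 : 0 < 1 + 3 * eps by rewrite addr_gt0 // mulr_gt0 // eps_gt0.
have ny := normQ_gt0 y0.
have r0 : 0 <= `|dotQ Q v y| / normQ Q y by rewrite divr_ge0 // ltW.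
rewrite -ler_sqr ?nnegrE ?normQ_ge0 ?mulr_ge0 ?addr_ge0 ?normQ_ge0 ?invr_ge0 ?(ltW e0) //.
rewrite normQ_sqr; last exact: psd_rescale.
rewrite dotQ_rescale // exprMn exprVn -/kappa ler_wpM2l ?(ltW kappa_gt0) //.
rewrite (dotQC y v sQ) -(normQ_sqr v pQ).
have -> : 3 * dotQ Q v y * dotQ Q v y / dotQ Q y y =
    3 * (`|dotQ Q v y| / normQ Q y) ^+ 2.
  by rewrite expr_div_n real_normK ?num_real // normQ_sqr //; ring.
have : `|dotQ Q v y| / normQ Q y <= normQ Q v.
  by rewrite ler_pdivrMr // dotQ_le_norm.
have := normQ_ge0 Q v; move: r0.
set p := _ / _; set q := normQ Q v => p0 q0 pq; nra.
Qed.

(** Since [y] lies in the span of [W], the Gram matrix is multiplied by the identity plus a rank-one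
    matrix, whose determinant is 1 + 3 because [u] has squared length [dotQ Q y y] in the form
    [G]. *)
Lemma gram_rescale (r : nat) (W : 'M[R]_(r, m)) (Q : 'M[R]_m) y (u : 'rV_r) :
  psd Q -> 0 < dotQ Q y y -> y^T = u *m W ->
  \det (W *m rescaleQ Q y *m W^T) = 4 * kappa ^+ r * \det (W *m Q *m W^T).
Proof.
move=> pQ y0 yE; have [sQ _] := pQ; set G := W *m Q *m W^T.
have uG : u *m G *m u^T = (dotQ Q y y)%:M.
  by rewrite [LHS]mx11_scalar /dotQ -[y]trmxK yE trmxK trmx_mul !mulmxA.
have -> : W *m rescaleQ Q y *m W^T =
    kappa *: (G *m (1%:M + (3 / dotQ Q y y) *: u^T *m (u *m G))).
  rewrite /rescaleQ normQ_sqr // -/kappa -[in LHS]scalemxAr -[in LHS]scalemxAl.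
  congr (_ *: _); rewrite !mulmxDr mulmx1 mulmxDl; congr (_ + _).
  rewrite -!(scalemxAr, scalemxAl) scalerA mulrC; congr (_ *: _).
  have yE' : y = W^T *m u^T by apply: trmx_inj; rewrite yE trmx_mul !trmxK.
  by rewrite yE yE' /G !mulmxA.
rewrite detZ det_mulmx det_add1_rank1 -scalemxAr uG !mxE eqxx mulr1n.
by rewrite divfK ?gt_eqF //; ring.
Qed.

Lemma gram_rescale_ge (r : nat) (W : 'M[R]_(r, m)) (Q : 'M[R]_m) y :
  psd Q -> 0 < dotQ Q y y -> (y^T <= W)%MS -> (r <= m)%N ->
  2 * \det (W *m Q *m W^T) <= \det (W *m rescaleQ Q y *m W^T).
Proof.
move=> pQ y0 /submxP [u yE] rm; rewrite (gram_rescale pQ y0 yE).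
have /andP[d0 _] := det_psd (psd_gram W pQ); apply: ler_wpM2r => //.
have : kappa ^+ m <= kappa ^+ r.
  by rewrite ler_wiXn2l ?(ltW kappa_gt0) ?kappa_le1.
by have := kappa_exp_m; lra.
Qed.

End Rescaling.

(** * The loop invariant *)

Section Analysis.
Variables (R : realType) (m n : nat) (A : 'M[int]_(m, n)).
Hypothesis hA : forall j, col j A != 0.
Hypothesis n_gt0 : (0 < n)%N.
Local Notation a := (column R A).
Local Notation nu j := (norm2 (a j)).
Local Notation h j := (normalize (a j)).
Local Notation Dl := (Delta R A).
Local Notation H := (unit_rows R A).
Local Notation rk S := (\rank (cols (Areal R A) S)).
Local Notation eps := (epsilon R m).
Local Notation kap := (kappa R m).
Local Notation th := (theta R A)^-1.
Local Notation state := (state R m n).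
Implicit Types (S : {set 'I_n}) (st : state).

Let m_gt0 : (0 < m)%N := rows_gt0 hA (Ordinal n_gt0).

(** The set T after a rescaling, before a possible removal. *)
Definition marked st : {set 'I_n} := st_T st :|:
  [set k in st_S st :\: st_T st |
     th < normQ (rescaleQ (st_Q st) (st_y st)) (h k)].

Definition rank_drops st := (rk (st_S st :\: marked st) < rk (st_S st))%N.

Lemma rescaleE st : rescale A st =
  if rank_drops st
  then restart A (st_S st :\: marked st) (rescaleQ (st_Q st) (st_y st))
  else State (st_x st) (st_y st) (st_S st) (marked st)
             (rescaleQ (st_Q st) (st_y st)).
Proof. by case: st. Qed.

(* nu, nr and nd count the updates, the rescalings and, among the latter,
   those followed by a removal. *)
Inductive reach : nat -> nat -> nat -> state -> Prop :=
| ReachInit : reach 0 0 0 (init_state R A)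
| ReachUpdate nu nr nd st k : reach nu nr nd st -> ~ finished A st ->
    is_argmin A st k -> update_test A st k -> reach nu.+1 nr nd (update A st k)
| ReachRescale nu nr nd st k : reach nu nr nd st -> ~ finished A st ->
    is_argmin A st k -> ~~ update_test A st k ->
    reach nu nr.+1 (nd + rank_drops st) (rescale A st).

(** The loss of volume granted per lost dimension: 4 / theta^2 bounds the squared norm, after the
    rescaling, of a column that drops out of a basis, and Delta^2 pays for the Gram determinant of
    the larger basis in the identity form. *)
Definition Lambda : R := 4 * th ^+ 2 * Dl ^+ 2.

(** Quantified over all bases, and relative to the identity form, so that each use may pick its
    basis: one avoiding T to bound the number of rescalings, one extending a basis of the surviving
    columns at a removal. *)
Definition volume_bound nr S (Q : 'M[R]_m) :=
  forall r (f : 'I_r -> 'I_n), is_basis R A S f ->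
    2 ^+ nr * gram_det A f 1%:M <= gram_det A f Q * Lambda ^+ (m - r).

(** [inv_norm] speaks only of the columns outside T; [inv_rank] ensures that these suffice to form a
    basis. The exponent in [inv_low] counts rescalings only, since updates do not touch Q. [inv_nd]
    pays for each removal with the rank that it loses. *)
Record loop_invariant (nr nd : nat) st : Prop := Invariant {
  inv_psd : psd (st_Q st);
  inv_low : forall v, kap ^+ nr * dotQ 1%:M v v <= dotQ (st_Q st) v v;
  inv_x : forall j, j \in st_S st -> 1 <= st_x st j 0;
  inv_y : st_y st = \sum_(j in st_S st) st_x st j 0 *: h j;
  inv_supp : forall z : 'cV[R]_n, kernel_solution A z -> supp z \subset st_S st :\: st_T st;
  inv_pot : forall z : 'cV[R]_n, kernel_solution A z ->
    \sum_j z j 0 * normQ (st_Q st) (a j) <= \sum_j z j 0 * nu j;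
  inv_norm : forall j, j \in st_S st :\: st_T st -> normQ (st_Q st) (h j) <= th;
  inv_rank : rk (st_S st :\: st_T st) = rk (st_S st);
  inv_vol : volume_bound nr (st_S st) (st_Q st);
  inv_nd : (nd + rk (st_S st) <= m)%N }.

Lemma inv_pos nr nd st v : loop_invariant nr nd st -> v != 0 -> 0 < dotQ (st_Q st) v v.
Proof.
move=> I v0; apply: lt_le_trans (inv_low I v); rewrite mulr_gt0 ?dotQ1_gt0 //.
by rewrite exprn_gt0 // kappa_gt0.
Qed.

Lemma column_neq0 j : a j != 0.
Proof.
by apply: contraNneq (nu_neq0 R hA j) => ->; rewrite -sqrf_eq0 norm2_sqr dotQ0l.
Qed.

Lemma inv_normQ_gt0 nr nd st j : loop_invariant nr nd st -> 0 < normQ (st_Q st) (a j).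
Proof. by move=> I; apply/normQ_gt0/(inv_pos I)/column_neq0. Qed.

Lemma unfinished_y nr nd st : loop_invariant nr nd st -> ~ finished A st ->
  1 <= m%:R * Dl ^+ 2 * dotQ 1%:M (st_y st) (st_y st).
Proof.
move=> I nf; rewrite leNgt; apply/negP => lt; apply: nf; right => k.
exact: (projection_positive hA (inv_x I) (inv_y I) lt).
Qed.

Lemma unfinished_pos nr nd st : loop_invariant nr nd st -> ~ finished A st ->
  0 < dotQ (st_Q st) (st_y st) (st_y st).
Proof.
move=> I nf; apply: (inv_pos I); apply/eqP => y0.
by have := unfinished_y I nf; rewrite y0 dotQ0l mulr0 ler10.
Qed.

Lemma th_ge1 : 1 <= th.
Proof.
rewrite theta_inv -exprMn exprn_ege1 // -[leLHS]mulr1 ler_pM ?ler1n //.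
exact: Delta_ge1.
Qed.

Lemma Lambda_ge1 : 1 <= Lambda.
Proof.
have := th_ge1; have := Delta_ge1 R A; rewrite /Lambda -[4 * _ * _]mulrA -exprMn.
set d := Dl; set t := th => d1 t1.
have : 1 <= (t * d) ^+ 2 by rewrite exprn_ege1 // -[leLHS]mulr1 ler_pM.
by lra.
Qed.

Lemma argmin_test nr nd st k : loop_invariant nr nd st ->
  is_argmin A st k -> ~~ update_test A st k ->
  forall i, i \in st_S st -> - eps * normQ (st_Q st) (a i) * normQ (st_Q st) (st_y st)
    <= dotQ (st_Q st) (a i) (st_y st).
Proof.
move=> I [kS kmin] ut i iS; have := kmin i iS.
have := ut; rewrite (_ : update_test A st k = (dotQ (st_Q st) (a k) (st_y st) <
  - eps * normQ (st_Q st) (a k) * normQ (st_Q st) (st_y st))); last by case: st {I kS kmin ut iS}.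
rewrite -leNgt -/(a k); set Q := st_Q st; set y := st_y st => le1 le2.
have nk : 0 < normQ Q (a k) := inv_normQ_gt0 k I.
have ni : 0 < normQ Q (a i) := inv_normQ_gt0 i I.
rewrite mulrAC -ler_pdivlMr //; apply: le_trans le2.
by rewrite ler_pdivlMr // mulrAC.
Qed.

Lemma gram_det_max r (f : 'I_r -> 'I_n) (Q : 'M[R]_m) (c : R) : psd Q ->
  (forall i, normQ Q (h (f i)) <= c) -> gram_det A f Q <= (c ^+ 2) ^+ r.
Proof.
move=> pQ le; apply: (le_trans (gram_det_le A f pQ)).
rewrite -[X in _ ^+ X]card_ord -prodr_const; apply: ler_prod => i _.
by rewrite pQ.2 -normQ_sqr //= ler_sqr ?nnegrE ?normQ_ge0 // (le_trans _ (le i)) ?normQ_ge0.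
Qed.

Lemma th_le_Lambda : th ^+ 2 <= Lambda.
Proof.
have := exprn_ege1 2 (Delta_ge1 R A); have := exprn_ege1 2 th_ge1.
rewrite /Lambda; set t := _ ^+ 2; set d := _ ^+ 2 => t1 d1; nra.
Qed.

(** For a basis avoiding T, Hadamard's inequality gives at most Lambda^r in the form Q, whereas in
    the identity form the Gram determinant is at least 1 / Delta^2. *)
Lemma rescalings_bound nr nd st : loop_invariant nr nd st ->
  2 ^+ nr <= Dl ^+ 2 * Lambda ^+ m.
Proof.
move=> I; have [r [f bf]] := basis_exists R A (st_S st :\: st_T st).
have [fr fS _] := bf.
have bS : is_basis R A (st_S st) f.
  exact: (basis_sub hA bf (subsetDl _ _) (inv_rank I)).
have rm : (r <= m)%N by rewrite -(eqP fr) rank_leq_col.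
have le1 := inv_vol I bS; have ge1 := gram_det1_ge hA fr.
have le2 : gram_det A f (st_Q st) <= Lambda ^+ r.
  apply: (le_trans (gram_det_max (c := th) (inv_psd I) _)).
    by move=> i; exact: (inv_norm I).
  by apply: lerXn2r th_le_Lambda; rewrite nnegrE ?sqr_ge0 // (le_trans ler01 Lambda_ge1).
have p0 : 0 <= 2 ^+ nr :> R by rewrite exprn_ge0.
apply: (@le_trans _ _ (Dl ^+ 2 * (2 ^+ nr * gram_det A f 1%:M))).
  by rewrite mulrCA ler_peMr.
rewrite ler_wpM2l ?sqr_ge0 //; apply: (le_trans le1).
rewrite -[in X in _ <= X](subnKC rm) exprD ler_wpM2r // exprn_ge0 //.
by rewrite (le_trans ler01 Lambda_ge1).
Qed.

Lemma rk_subset (U S : {set _}) : U \subset S -> (rk U <= rk S)%N.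
Proof.
move=> US; rewrite -[X in (X <= _)%N]mxrank_tr -[X in (_ <= X)%N]mxrank_tr; apply/mxrankS/(cols_sub hA) => j jU.
exact/unit_row_sub_cols/(subsetP US).
Qed.

Lemma normQ1 p (v : 'cV[R]_p) : normQ 1%:M v = norm2 v.
Proof. by rewrite /normQ /norm2 dotQ1vE. Qed.

Lemma gram_det_ge0 r (f : 'I_r -> 'I_n) (Q : 'M[R]_m) :
  psd Q -> 0 <= gram_det A f Q.
Proof. by move=> pQ; case/andP: (det_psd (psd_gram (rowsub f H) pQ)). Qed.

Lemma invariant_init : loop_invariant 0 0 (init_state R A).
Proof.
split=> /=.
- exact: psd1.
- by move=> v; rewrite expr0 mul1r.
- by move=> j _; rewrite mxE.
- by rewrite hat_cols_entries.
- by move=> z _; rewrite setD0 subsetT.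
- by move=> z _; apply: ler_sum => j _; rewrite normQ1.
- by move=> j _; rewrite /normQ (dotQ1_unit R hA) sqrtr1 th_ge1.
- by rewrite setD0.
- move=> r f _; rewrite expr0 mul1r ler_peMr ?gram_det_ge0 ?exprn_ege1 //.
    exact: psd1.
  exact: Lambda_ge1.
- exact: rank_le_rows.
Qed.

Lemma updateE st k : update A st k = State
  (st_x st - (dotQ (st_Q st) (h k) (st_y st) / normQ (st_Q st) (h k) ^+ 2) *:
    delta_mx k 0)
  (st_y st - (dotQ (st_Q st) (a k) (st_y st) / normQ (st_Q st) (a k) ^+ 2) *: a k)
  (st_S st) (st_T st) (st_Q st).
Proof. by case: st. Qed.

Lemma update_testE st k : update_test A st k = (dotQ (st_Q st) (a k) (st_y st) <
  - eps * normQ (st_Q st) (a k) * normQ (st_Q st) (st_y st)).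
Proof. by case: st. Qed.

Lemma dotQ_columnl (Q : 'M[R]_m) j y : dotQ Q (a j) y = nu j * dotQ Q (h j) y.
Proof. by rewrite {1}(column_unit R hA) dotQZl. Qed.

(** A passed test makes the coefficient [c] nonpositive, so the update can only increase an entry of
    x and x >= 1 persists on S. *)
Lemma invariant_update nr nd st k : loop_invariant nr nd st ->
  is_argmin A st k -> update_test A st k -> loop_invariant nr nd (update A st k).
Proof.
move=> I [kS _]; rewrite update_testE => ut; rewrite updateE.
set c := _ / normQ _ (h k) ^+ 2.
have nk := nu_gt0 R hA k.
have c0 : c <= 0.
  rewrite /c mulr_le0_ge0 ?invr_ge0 ?sqr_ge0 //.
  rewrite -(pmulr_rle0 _ nk) -dotQ_columnl; apply/ltW/(lt_le_trans ut).
  by rewrite !mulNr oppr_le0 !mulr_ge0 ?normQ_ge0 // ltW // eps_gt0.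
have cE : (dotQ (st_Q st) (a k) (st_y st) / normQ (st_Q st) (a k) ^+ 2) *: a k =
    c *: h k.
  rewrite {3}(column_unit R hA) scalerA dotQ_columnl (normQ_column hA).
  congr (_ *: _); rewrite /c; field.
  have := inv_normQ_gt0 k I; rewrite (normQ_column hA) pmulr_rgt0 // => /gt_eqF ->.
  by rewrite gt_eqF.
have xE j : (st_x st - c *: delta_mx k 0) j 0 = st_x st j 0 - c * (j == k)%:R.
  by rewrite !mxE andbT.
case: I => i1 i2 i3 i4 i5 i6 i7 i8 i9 i10; split=> //=.
- move=> j jS; rewrite xE (le_trans (i3 j jS)) // lerBrDl gerDr.
  by rewrite mulr_le0_ge0.
- rewrite cE i4 [in RHS](bigD1 k) //= (bigD1 k) //= xE eqxx mulr1 scalerBl.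
  rewrite addrAC; congr (_ + _); apply: eq_bigr => j /andP[_ /negPf jk].
  by rewrite xE jk mulr0 subr0.
Qed.

Section Rescale.
Variables (nr nd : nat) (st : state) (k : 'I_n).
Hypotheses (I : loop_invariant nr nd st) (nf : ~ finished A st).
Hypotheses (km : is_argmin A st k) (ut : ~~ update_test A st k).
Local Notation Q := (st_Q st).
Local Notation y := (st_y st).
Local Notation S := (st_S st).
Local Notation T := (st_T st).
Let Q' := rescaleQ Q y.
Let y0 : 0 < dotQ Q y y := unfinished_pos I nf.
Let pQ := inv_psd I.

Lemma rescale_psd : psd Q'.
Proof. exact: psd_rescale. Qed.

Lemma rescale_low v : kap ^+ nr.+1 * dotQ 1%:M v v <= dotQ Q' v v.
Proof.
apply: le_trans (dotQ_rescale_ge m_gt0 y v pQ).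
by rewrite exprS -mulrA ler_wpM2l ?(inv_low I) // ltW // kappa_gt0.
Qed.

(** Put d_j = <a_j, y>_Q / ||y||_Q. On the support of z the failed test gives |d_j| <= d_j + 2 eps
    ||a_j||_Q, and the z_j d_j sum to 0. The weighted sum is thus multiplied by at most (1 + 2 eps)
    / (1 + 3 eps). *)
Lemma rescale_pot (z : 'cV[R]_n) : kernel_solution A z ->
  \sum_j z j 0 * normQ Q' (a j) <= \sum_j z j 0 * nu j.
Proof.
move=> kz; have [Az z0] := kz; apply: le_trans (inv_pot I kz).
have zS j : z j 0 != 0 -> j \in S.
  move=> zj; have /subsetP/(_ j) := inv_supp I kz.
  by rewrite !inE zj => /(_ isT) /andP[].
have ny := normQ_gt0 y0; have e0 := eps_gt0 R m_gt0.
have sum0 : \sum_j z j 0 * (dotQ Q (a j) y / normQ Q y) = 0.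
  transitivity (dotQ Q (\sum_j z j 0 *: a j) y / normQ Q y).
    rewrite dotQ_suml mulr_suml; apply: eq_bigr => j _.
    by rewrite dotQZl mulrA.
  by rewrite -Areal_mul Az dotQ0l mul0r.
have e1 : 0 < 1 + 3 * eps by rewrite addr_gt0 // mulr_gt0.
apply: (@le_trans _ _ (\sum_j (1 + 3 * eps)^-1 * (z j 0 *
   (normQ Q (a j) * (1 + 2 * eps)) + z j 0 * (dotQ Q (a j) y / normQ Q y)))).
  apply: ler_sum => j _; have [->|zj] := eqVneq (z j 0) 0.
    by rewrite !mul0r addr0 mulr0.
  rewrite -mulrDr mulrCA ler_wpM2l //.
  apply: (le_trans (normQ_rescale_le m_gt0 (a j) pQ y0)).
  rewrite ler_wpM2l ?invr_ge0 ?(ltW e1) //.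
  have := argmin_test I km ut (zS j zj); rewrite -ler_pdivlMr // => le.
  have nj := normQ_ge0 Q (a j).
  have -> : `|dotQ Q (a j) y| / normQ Q y = `|dotQ Q (a j) y / normQ Q y|.
    by rewrite normf_div (ger0_norm (ltW ny)).
  move: le; set d := _ / _ => le.
  have ne := mulr_ge0 nj (ltW e0).
  by have [d0|d0] := lerP 0 d; rewrite ?(ger0_norm d0) ?(ltr0_norm d0); lra.
rewrite -mulr_sumr big_split /= sum0 addr0.
under eq_bigr do rewrite mulrA.
rewrite -mulr_suml mulrCA -[leRHS]mulr1; apply: ler_wpM2l.
  by apply: sumr_ge0 => j _; rewrite mulr_ge0 ?normQ_ge0.
by rewrite mulrC ler_pdivrMr // mul1r lerD2l; lra.
Qed.

Lemma marked_norm j : j \in S :\: marked st -> normQ Q' (h j) <= th.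
Proof.
rewrite !inE negb_or => /andP[/andP[jT]]; rewrite jT /= negb_and -leNgt.
by case/orP => [/negPf ->|].
Qed.

Lemma rescale_supp (z : 'cV[R]_n) :
  kernel_solution A z -> supp z \subset S :\: marked st.
Proof.
move=> kz; apply/subsetP => j; rewrite inE => zj.
have /subsetP/(_ j) := inv_supp I kz; rewrite !inE => /(_ zj) /andP[jT jS].
rewrite jS (negPf jT) /= andbT -leNgt.
by apply: (support_norm_bound hA rescale_psd kz zj) => z' kz' _; exact: rescale_pot.
Qed.

Lemma rescale_vol : volume_bound nr.+1 S Q'.
Proof.
move=> r f bf; have [fr fS sp] := bf.
have rm : (r <= m)%N by rewrite -(eqP fr) rank_leq_col.
have yW : (y^T <= rowsub f H)%MS.
  rewrite (inv_y I) linear_sum /= summx_sub // => j jS.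
  by rewrite linearZ /= scalemx_sub // -row_unit_rows sp.
have L0 : 0 <= Lambda ^+ (m - r).
  by rewrite exprn_ge0 // (le_trans ler01 Lambda_ge1).
apply: (@le_trans _ _ (2 * gram_det A f Q * Lambda ^+ (m - r))).
  by rewrite exprS -!mulrA ler_wpM2l // (inv_vol I).
by rewrite ler_wpM2r // (gram_rescale_ge m_gt0).
Qed.

(** A basis of the surviving columns is extended, by columns outside the old T because only their
    norms are controlled, to a basis of S. There the growth by 2 applies, and Fischer's inequality
    splits off the added columns. *)
Lemma rescale_vol_restart :
  rank_drops st -> volume_bound nr.+1 (S :\: marked st) Q'.
Proof.
move=> drop r f bf; have [fr fS sp] := bf.
have MU : S :\: marked st \subset S :\: T by rewrite setDS // subsetUl.
have [d [g [gU bfg]]] := basis_extend bf MU.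
have bS := basis_sub hA bfg (subsetDl _ _) (inv_rank I).
have [frg _ _] := bfg.
have rd : (r + d <= m)%N by rewrite -(eqP frg) rank_leq_col.
have d0 : (0 < d)%N.
  move: drop; rewrite /rank_drops (basis_rank hA bf) (basis_rank hA bS).
  by rewrite -[X in (X < _)%N]addn0 ltn_add2l.
have Q'pos v : v != 0 -> 0 < dotQ Q' v v.
  move=> v0; apply: lt_le_trans (rescale_low v).
  by rewrite mulr_gt0 ?dotQ1_gt0 // exprn_gt0 // kappa_gt0.
have L1 := Lambda_ge1; have L0 := le_trans ler01 L1.
have le1 := rescale_vol bS.
have le2 := gram_det_join g rescale_psd Q'pos fr.
have le3 : \prod_i dotQ Q' (h (g i)) (h (g i)) <= (4 * th ^+ 2) ^+ d.
  rewrite -[X in _ ^+ X]card_ord -prodr_const; apply: ler_prod => i _.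
  rewrite rescale_psd.2 /= (le_trans (dotQ_rescale_le m_gt0 _ pQ y0)) //.
  rewrite ler_wpM2l // -normQ_sqr // ler_sqr ?nnegrE ?normQ_ge0 //.
    by rewrite (inv_norm I).
  exact: le_trans ler01 th_ge1.
have ge1 := gram_det1_ge hA frg.
have g0 := gram_det_ge0 f rescale_psd.
have p0 : 0 <= 2 ^+ nr.+1 :> R by rewrite exprn_ge0.
(* In the identity form the smaller basis has Gram determinant at most 1, the larger one at least 1
   / Delta^2. *)
apply: (@le_trans _ _ (2 ^+ nr.+1)).
  by rewrite ler_piMr // gram_det_le1.
apply: (@le_trans _ _ (Dl ^+ 2 * (2 ^+ nr.+1 * gram_det A (join_fun f g) 1%:M))).
  by rewrite mulrCA ler_peMr.
apply: (@le_trans _ _ (Dl ^+ 2 *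
   (gram_det A f Q' * (4 * th ^+ 2) ^+ d * Lambda ^+ (m - (r + d))))).
  rewrite ler_wpM2l ?sqr_ge0 //; apply: (le_trans le1).
  rewrite ler_wpM2r ?exprn_ge0 //; apply: (le_trans le2).
  by rewrite ler_wpM2l.
have -> : (m - r = d + (m - (r + d)))%N.
  by rewrite subnDA subnKC // leq_subRL // (leq_trans (leq_addr _ _) rd).
(* A single factor Delta^2 is spent for all d lost dimensions together; [d0] makes room for it. *)
have leL : Dl ^+ 2 * (4 * th ^+ 2) ^+ d <= Lambda ^+ d.
  have t0 : 0 <= (4 * th ^+ 2) ^+ d by rewrite exprn_ge0 // mulr_ge0 // sqr_ge0.
  rewrite /Lambda [leRHS]exprMn mulrC ler_wpM2l //.
  rewrite -(prednK d0) [leRHS]exprS ler_peMr ?sqr_ge0 // exprn_ege1 //.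
  by rewrite exprn_ege1 // Delta_ge1.
have v0 := exprn_ge0 (m - (r + d)) L0.
rewrite exprD; have := ler_wpM2l (mulr_ge0 g0 v0) leL.
by congr (_ <= _); ring.
Qed.

Lemma invariant_rescale : loop_invariant nr.+1 (nd + rank_drops st) (rescale A st).
Proof.
rewrite rescaleE; case: ifP => drop; split=> /=.
- exact: rescale_psd.
- exact: rescale_low.
- by move=> j _; rewrite mxE.
- by rewrite hat_cols_entries.
- by move=> z kz; rewrite setD0; exact: rescale_supp.
- exact: rescale_pot.
- by move=> j; rewrite setD0; exact: marked_norm.
- by rewrite setD0.
- exact: rescale_vol_restart.
- by apply: leq_trans (inv_nd I); rewrite -addnA leq_add2l; exact: drop.
- exact: rescale_psd.
- exact: rescale_low.
- exact: (inv_x I).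
- exact: (inv_y I).
- exact: rescale_supp.
- exact: rescale_pot.
- exact: marked_norm.
- apply/eqP; rewrite eqn_leq rk_subset ?subsetDl //= leqNgt.
  exact: (negbT drop).
- exact: rescale_vol.
- by rewrite addn0 (inv_nd I).
Qed.

End Rescale.

Lemma reach_invariant nu nr nd st : reach nu nr nd st -> loop_invariant nr nd st.
Proof.
elim=> [|{}nu {}nr {}nd {}st k _ I nf km ut|{}nu {}nr {}nd {}st k _ I nf km ut].
- exact: invariant_init.
- exact: invariant_update.
- exact: (invariant_rescale I nf km ut).
Qed.

End Analysis.

(** * Norms and Delta in terms of the encoding length *)

Lemma sum_le_prod (R : realDomainType) (I : finType) (F : I -> R) :
  (forall i, 0 <= F i) -> \sum_i F i <= \prod_i (1 + F i).
Proof.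
move=> F0; suff : 1 + \sum_i F i <= \prod_i (1 + F i) by apply: le_trans; rewrite lerDr.
have F1 i : 0 <= 1 + F i by rewrite addr_ge0.
suff : 0 <= \sum_i F i /\ 1 + \sum_i F i <= \prod_i (1 + F i) by case.
elim/big_rec2: _ => [|i p s _ [s0 le]]; first by rewrite addr0.
split; first by rewrite addr_ge0.
by apply: le_trans (ler_wpM2l (F1 i) le); have := F0 i; nra.
Qed.

Section Encoding.
Variables (R : realType) (m n : nat) (A : 'M[int]_(m, n)).
Local Notation L := (encoding_length A).

Lemma dims_le_encoding : (m * n <= L)%N.
Proof.
rewrite /encoding_length -[X in (X * _)%N]card_ord -sum_nat_const.
apply: leq_sum => i _; rewrite -[X in (X <= _)%N]card_ord -sum1_card.
by apply: leq_sum => j _.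
Qed.

(** The sum of the squares a_ij^2 is at most the product of the 1 + a_ij^2, hence of the (1 +
    |a_ij|)^2, and 1 + |z| is at most 2 to the power [bitsize z]. *)
Lemma norm2_column_le j :
  norm2 (column R A j) <= 2 ^+ (\sum_i bitsize (A i j))%N.
Proof.
rewrite -ler_sqr ?nnegrE ?norm2_ge0 ?exprn_ge0 // norm2_sqr dotQ1vE.
apply: (le_trans (sum_le_prod _)) => [i|]; first exact: sqr_ge0.
rewrite expr_sum -prodrXl; apply: ler_prod => i _.
rewrite addr_ge0 ?sqr_ge0 //= !mxE.
have le : (`|A i j|.+1 <= 2 ^ bitsize (A i j))%N.
  apply: leq_trans (up_logP (p := 2) _ isT) _; rewrite leq_exp2l //.
have : (`|A i j|%N.+1)%:R <= 2 ^+ bitsize (A i j) :> R by rewrite -natrX ler_nat.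
rewrite -natr1; have -> : (`|A i j|%N)%:R = `|(A i j)%:~R| :> R.
  by rewrite -intr_norm -abszE.
rewrite -(real_normK (num_real (A i j)%:~R)).
by have := normr_ge0 ((A i j)%:~R : R); nra.
Qed.

Lemma Delta_le : Delta R A <= 2 ^+ L.
Proof.
apply: bigmax_le => [|B _]; first by rewrite exprn_ge0.
apply: (@le_trans _ _ (\prod_j 2 ^+ (\sum_i bitsize (A i j))%N)).
  rewrite big_mkcond; apply: ler_prod => j _; case: ifP => _.
    by rewrite norm2_ge0 norm2_column_le.
  by rewrite ler01 exprn_ege1 // ler1n.
by rewrite prodrXr /L exchange_big.
Qed.

End Encoding.

(** * Numbers of rescalings, updates and removals *)

Section Bounds.
Variables (R : realType) (m n : nat) (A : 'M[int]_(m, n)).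
Hypothesis hA : forall j, col j A != 0.
Hypothesis n_gt0 : (0 < n)%N.
Local Notation a := (column R A).
Local Notation nu j := (norm2 (a j)).
Local Notation h j := (normalize (a j)).
Local Notation Dl := (Delta R A).
Local Notation rk S := (\rank (cols (Areal R A) S)).
Local Notation eps := (epsilon R m).
Local Notation kap := (kappa R m).
Local Notation th := (theta R A)^-1.
Local Notation L := (encoding_length A).
Local Notation Y st := (dotQ (st_Q st) (st_y st) (st_y st)).
Implicit Types st : state R m n.

Let m_gt0 : (0 < m)%N := rows_gt0 hA (Ordinal n_gt0).
Let mL : (m <= L)%N.
Proof. by apply: leq_trans (dims_le_encoding A); rewrite leq_pmulr. Qed.
Let nL : (n <= L)%N.
Proof. by apply: leq_trans (dims_le_encoding A); rewrite leq_pmull. Qed.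
Let L_gt0 : (0 < L)%N := leq_trans m_gt0 mL.

Let nat_le2 k : (k <= L)%N -> k%:R <= 2 ^+ L :> R.
Proof.
by move=> kL; rewrite -natrX ler_nat (leq_trans kL) // ltnW // ltn_expl.
Qed.

Lemma th_le : th <= 2 ^+ (4 * L).
Proof.
rewrite theta_inv -exprMn (_ : (4 * L = (L + L) * 2)%N); last by lia.
have D0 := ltW (Delta_gt0 R A).
rewrite exprM ler_sqr ?nnegrE ?mulr_ge0 ?exprn_ge0 // exprD.
by rewrite ler_pM ?ler0n // ?nat_le2 ?Delta_le.
Qed.

Lemma Lambda_le : Lambda R A <= 2 ^+ (12 * L).
Proof.
have le1 : 4 <= 2 ^+ (2 * L) :> R.
  have le : 2 ^+ 2 <= 2 ^+ (2 * L) :> R by rewrite ler_weXn2l ?ler1n // leq_pmulr.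
  by apply: le_trans le; rewrite expr2; lra.
rewrite /Lambda (_ : (12 * L = 2 * L + 4 * L * 2 + L * 2)%N); last by lia.
have D0 := ltW (Delta_gt0 R A); have t1 := th_ge1 R hA n_gt0.
have t0 := le_trans ler01 t1.
rewrite exprD exprD; apply: ler_pM; rewrite ?mulr_ge0 ?sqr_ge0 //.
  by apply: ler_pM; rewrite ?ler0n ?sqr_ge0 // exprM ler_sqr ?nnegrE ?exprn_ge0 // th_le.
by rewrite exprM ler_sqr ?nnegrE ?exprn_ge0 // Delta_le.
Qed.

(** The exponents are 2 L for Delta^2 and 12 L m for Lambda^m. *)
Lemma rescalings_le nu nr nd st : reach A nu nr nd st -> (nr <= 14 * (m * L))%N.
Proof.
move=> re; have I := reach_invariant hA n_gt0 re.
have le := rescalings_bound hA n_gt0 I.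
have L0 := le_trans ler01 (Lambda_ge1 R hA n_gt0).
have : 2 ^+ nr <= 2 ^+ (L * 2 + 12 * L * m)%N :> R.
  apply: (le_trans le); rewrite exprD [2 ^+ (L * 2)]exprM
    [2 ^+ (12 * L * m)]exprM; apply: ler_pM.
  - exact: sqr_ge0.
  - exact: exprn_ge0.
  - by rewrite ler_sqr ?nnegrE ?exprn_ge0 ?Delta_le // ltW // Delta_gt0.
  - by apply: lerXn2r Lambda_le; rewrite nnegrE ?exprn_ge0.
rewrite ler_eXn2l ?ltr1n // => le'; apply: (leq_trans le').
by rewrite -mulnA (mulnC L m); have := leq_pmull L m_gt0; lia.
Qed.

Lemma kappa_exp_le k : 1 <= 2 ^+ k * kap ^+ (m * k).
Proof.
rewrite exprM -exprMn exprn_ege1 //.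
by have := kappa_exp_m R m_gt0; lra.
Qed.

(** In the identity form ||y||^2 is at least 1 / (m Delta^2), hence at least 2^(-3 L). The
    rescalings lower the form by no more than the factor kappa^(14 m L), which is at least 2^(-14
    L). *)
Lemma unfinished_Y nu nr nd st : reach A nu nr nd st -> ~ finished A st ->
  1 <= 2 ^+ (17 * L) * Y st.
Proof.
move=> re nf; have I := reach_invariant hA n_gt0 re.
have le1 := unfinished_y hA I nf; have le2 := inv_low I (st_y st).
have nrb := rescalings_le re; have d0 := dotQ1_ge0 (st_y st).
have k0 := kappa_gt0 R m_gt0; have k1 := kappa_le1 R m_gt0.
set d := dotQ 1%:M _ _ in le1 le2 d0; set y := Y st in le2 *.
have le3 : kap ^+ (m * (14 * L)) * d <= y.
  apply: le_trans le2; rewrite ler_wpM2r // ler_wiXn2l ?(ltW k0) //.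
  by apply: (leq_trans nrb); lia.
have le4 : m%:R * Dl ^+ 2 <= 2 ^+ (3 * L).
  rewrite (_ : (3 * L = L + L * 2)%N); last by lia.
  rewrite exprD exprM; apply: ler_pM; rewrite ?ler0n ?sqr_ge0 ?nat_le2 //.
  by rewrite ler_sqr ?nnegrE ?exprn_ge0 ?Delta_le // ltW // Delta_gt0.
have le5 : 1 <= 2 ^+ (3 * L) * d by apply: (le_trans le1); rewrite ler_wpM2r.
apply: (le_trans le5); rewrite (_ : (17 * L = 3 * L + 14 * L)%N); last by lia.
rewrite exprD -mulrA ler_wpM2l ?exprn_ge0 //.
apply: (@le_trans _ _ (2 ^+ (14 * L) * (kap ^+ (m * (14 * L)) * d))).
  by rewrite mulrA ler_peMl ?kappa_exp_le.
by rewrite ler_wpM2l ?exprn_ge0.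
Qed.

(** There are at most n^2 pairs of columns, each contributing at most theta^(-2): 2^(2 L) times 2^(8
    L). *)
Lemma Y_restart nr nd S (Q : 'M[R]_m) : loop_invariant A nr nd (restart A S Q) ->
  Y (restart A S Q) <= 2 ^+ (10 * L).
Proof.
move=> I; rewrite (inv_y I) /= dotQ_suml.
have t1 := th_ge1 R hA n_gt0; have t0 := le_trans ler01 t1.
apply: (@le_trans _ _ (\sum_(i in S) \sum_(j in S) th ^+ 2)).
  apply: ler_sum => i iS; rewrite dotQ_sumr; apply: ler_sum => j jS.
  rewrite !mxE !scale1r; apply: (le_trans (ler_norm _)).
  apply: (le_trans (dotQ_le_norm _ _ (inv_psd I))).
  by rewrite expr2 ler_pM ?normQ_ge0 // (inv_norm I) // setD0.
rewrite sumr_const sumr_const -mulrnA -[leLHS]mulr_natr.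
rewrite (_ : (10 * L = 4 * L * 2 + (L + L))%N); last by lia.
rewrite exprD exprM; apply: ler_pM; rewrite ?sqr_ge0 ?ler0n //.
  by rewrite ler_sqr ?nnegrE ?exprn_ge0 // th_le.
have cS : (#|S| <= L)%N by rewrite (leq_trans (max_card _)) // card_ord.
by rewrite natrM exprD ler_pM ?ler0n ?nat_le2.
Qed.

Lemma eps_sqr_le1 : 0 <= 1 - eps ^+ 2.
Proof.
have := eps_le R m_gt0; have := eps_gt0 R m_gt0.
by set e := eps => e0 e1; nra.
Qed.

(** Removing the component of y along a_k subtracts p^2 / F, and the test says that p^2 exceeds
    eps^2 F ||y||_Q^2. *)
Lemma Y_update nr nd st k : loop_invariant A nr nd st -> is_argmin A st k ->
  update_test A st k -> Y (update A st k) <= (1 - eps ^+ 2) * Y st.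
Proof.
move=> I [kS _]; rewrite update_testE updateE /=.
have pQ := inv_psd I; have [sQ Q0] := pQ.
have nk := inv_normQ_gt0 hA n_gt0 k I; set Q := st_Q st in pQ sQ Q0 nk *.
set y := st_y st => ut; rewrite !(dotQDl, dotQDr, dotQNl, dotQNr, dotQZl, dotQZr).
rewrite (dotQC y (a k) sQ) (normQ_sqr (a k) pQ).
have F0 : 0 < dotQ Q (a k) (a k) by rewrite -normQ_sqr // exprn_gt0.
set p := dotQ Q (a k) y in ut *; set F := dotQ Q (a k) (a k) in F0 *.
rewrite [leLHS](_ : _ = dotQ Q y y - p ^+ 2 / F); last first.
  by field; rewrite gt_eqF.
rewrite mulrBl mul1r lerD2l lerN2 ler_pdivlMr //.
have e0 := eps_gt0 R m_gt0; have ny := normQ_ge0 Q y.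
have -> : eps ^+ 2 * dotQ Q y y * F = (eps * normQ Q (a k) * normQ Q y) ^+ 2.
  by rewrite !exprMn !normQ_sqr // -/F; ring.
rewrite -[p ^+ 2]sqrrN ler_sqr ?nnegrE ?mulr_ge0 ?(ltW nk) ?(ltW e0) //.
  by move: ut; rewrite !mulNr; lra.
have : 0 <= eps * normQ Q (a k) * normQ Q y by rewrite !mulr_ge0 // ltW.
by move: ut; rewrite !mulNr; lra.
Qed.

(** A rescaling multiplies ||y||_Q^2 by 4 kappa <= 4. A removal resets it to at most 2^(10 L) when
    it was still at least 2^(-17 L); the ratio 2^(27 L) is charged to the lost rank. *)
Lemma Y_bound nu nr nd st : reach A nu nr nd st ->
  Y st <= (1 - eps ^+ 2) ^+ nu * 4 ^+ nr * 2 ^+ (10 * L) *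
    (2 ^+ (27 * L)) ^+ (m - rk (st_S st)).
Proof.
have q0 := eps_sqr_le1.
have gE : 2 ^+ (27 * L) = 2 ^+ (17 * L) * 2 ^+ (10 * L) :> R.
  by rewrite -exprD -mulnDl.
have G1 : 1 <= 2 ^+ (27 * L) :> R by rewrite exprn_ege1 ?ler1n.
have G0 := le_trans ler01 G1.
elim=> [|{}nu {}nr {}nd {}st k re IH nf km ut|{}nu {}nr {}nd {}st k re IH nf km ut].
- have I := invariant_init R hA n_gt0; have := Y_restart I.
  rewrite -/(init_state R A) => le; apply: (le_trans le).
  by rewrite !expr0 !mul1r ler_peMr ?exprn_ge0 // exprn_ege1.
- have I := reach_invariant hA n_gt0 re.
  apply: (le_trans (Y_update I km ut)); rewrite [_ ^+ nu.+1]exprS -!mulrA ler_wpM2l //.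
  by rewrite !mulrA updateE.
have I := reach_invariant hA n_gt0 re.
have y0 := unfinished_pos hA n_gt0 I nf; have pQ := inv_psd I.
have k0 := kappa_gt0 R m_gt0; have k1 := kappa_le1 R m_gt0.
have I' := invariant_rescale hA n_gt0 I nf km ut.
have P0 : 0 <= (1 - eps ^+ 2) ^+ nu * 4 ^+ nr * 2 ^+ (10 * L) *
    (2 ^+ (27 * L)) ^+ (m - rk (st_S st)).
  by rewrite !mulr_ge0 ?exprn_ge0.
have le1 := unfinished_Y re nf.
set u := (1 - eps ^+ 2) ^+ nu in IH P0 *; set v := 4 ^+ nr in IH P0 *.
set c := 2 ^+ (10 * L) in gE IH P0 *; set g := 2 ^+ (27 * L) in gE G0 G1 IH P0 *.
have u0 : 0 <= u by exact: exprn_ge0.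
have v0 : 0 <= v by exact: exprn_ge0.
have c0 : 0 <= c by exact: exprn_ge0.
set b := 2 ^+ (17 * L) in gE le1.
have b0 : 0 <= b by exact: exprn_ge0.
move: I'; rewrite rescaleE; case: ifP => drop I' /=; last first.
  rewrite dotQ_rescale_self // exprS -/v.
  have -> : u * (4 * v) * c * g ^+ (m - rk (st_S st)) =
    4 * (u * v * c * g ^+ (m - rk (st_S st))) by rewrite !mulrA (mulrC u 4).
  rewrite -mulrA; apply: ler_pM; rewrite ?mulr_ge0 ?(ltW k0) ?(ltW y0) //.
  by apply: le_trans IH; rewrite ler_piMl ?(ltW y0).
apply: (le_trans (Y_restart I')); rewrite -/c -mulrA mulrCA ler_peMr //.
apply: (le_trans le1); apply: (le_trans (ler_wpM2l b0 IH)).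
have -> : b * (u * v * c * g ^+ (m - rk (st_S st))) =
    u * (v * (g * g ^+ (m - rk (st_S st)))).
  by set d := g ^+ _; rewrite gE; ring.
rewrite -mulrA ler_wpM2l // exprS -/v -[leLHS]mul1r -!mulrA.
apply: ler_pM; rewrite ?mulr_ge0 ?exprn_ge0 ?ler1n //.
rewrite ler_wpM2l // -exprS; apply: ler_weXn2l => //.
by apply: ltn_sub2l => //; apply: leq_trans drop (rank_le_rows _ _ _).
Qed.

Lemma exprB1_le (t : R) (k : nat) : 0 <= t <= 1 -> (1 - t) ^+ k * (1 + k%:R * t) <= 1.
Proof.
case/andP=> t0 t1; elim: k => [|k IH]; first by rewrite mul0r addr0 mulr1.
apply: le_trans IH; rewrite exprSr -mulrA ler_wpM2l ?exprn_ge0 ?subr_ge0 //.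
rewrite -natr1; have : 0 <= (k%:R + 1) * t ^+ 2 by rewrite mulr_ge0 ?sqr_ge0 ?addr_ge0.
by nra.
Qed.

(** A round of [K] = 1 / eps^2 updates at least halves the upper bound of [Y_bound]. Comparison with
    the lower bound of [unfinished_Y] leaves at most 28 m L + 10 L + 27 m L + 17 L <= 82 m L such
    rounds, plus an incomplete one. *)
Lemma unfinished_updates nu nr nd st : reach A nu nr nd st -> ~ finished A st ->
  (nu <= 121 * 83 * (m ^ 3 * L))%N.
Proof.
move=> re nf; have q0 := eps_sqr_le1.
have I := reach_invariant hA n_gt0 re.
have le1 := unfinished_Y re nf; have le2 := Y_bound re.
have G0 : 1 <= 2 ^+ (27 * L) :> R by rewrite exprn_ege1 ?ler1n.
pose K := ((11 * m) ^ 2)%N; pose d := (nu %/ K)%N.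
have K0 : (0 < K)%N by rewrite expn_gt0 muln_gt0 m_gt0.
have nuE : (K * d <= nu)%N by rewrite mulnC leq_trunc_div.
have qK : 2 * (1 - eps ^+ 2) ^+ K <= 1.
  have e01 : 0 <= eps ^+ 2 <= 1 by rewrite sqr_ge0 -subr_ge0.
  have := exprB1_le K e01; rewrite mulrC /K natrX -exprMn natrM mulfV.
    by rewrite expr1n.
  by rewrite mulf_neq0 ?pnatr_eq0 // -lt0n.
have le3 : (1 - eps ^+ 2) ^+ nu * 2 ^+ d <= 1.
  apply: (@le_trans _ _ ((1 - eps ^+ 2) ^+ (K * d) * 2 ^+ d)).
    by rewrite ler_wpM2r ?exprn_ge0 // ler_wiXn2l // lerBlDr lerDl sqr_ge0.
  by rewrite exprM -exprMn mulrC exprn_ile1 // mulr_ge0 ?exprn_ge0.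
have nrb := rescalings_le re.
have le4 : 1 <= (1 - eps ^+ 2) ^+ nu * 2 ^+ (82 * (m * L)).
  apply: (le_trans le1); apply: (le_trans (ler_wpM2l _ le2)); first exact: exprn_ge0.
  rewrite mulrC -!mulrA; apply: ler_wpM2l; first exact: exprn_ge0.
  apply: (@le_trans _ _ (2 ^+ (28 * (m * L)) * (2 ^+ (10 * L) * (2 ^+ (27 * L * m) * 2 ^+ (17 * L))))).
    apply: ler_pM; rewrite ?mulr_ge0 ?exprn_ge0 //.
      have -> : 4 = 2 ^+ 2 :> R by rewrite -natrX.
      rewrite -exprM ler_weXn2l ?ler1n // (_ : 28 * _ = 2 * (14 * (m * L)))%N.
        by rewrite leq_mul2l.
      by rewrite [RHS]mulnA.
    rewrite ler_wpM2l ?exprn_ge0 // ler_wpM2r ?exprn_ge0 // [leRHS]exprM.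
    by apply: ler_weXn2l => //; exact: leq_subr.
  by rewrite -!exprD ler_eXn2l ?ltr1n //; nia.
have le5 : 2 ^+ d <= 2 ^+ (82 * (m * L)) :> R.
  have qn : 0 < (1 - eps ^+ 2) ^+ nu.
    rewrite lt_neqAle exprn_ge0 // andbT eq_sym; apply: contraTneq le4 => ->.
    by rewrite mul0r ler10.
  by rewrite -(ler_pM2l qn); apply: (le_trans le3).
move: le5; rewrite ler_eXn2l ?ltr1n // => le5.
have lt : (nu < K * d.+1)%N.
  by rewrite {1}(divn_eq nu K) mulnS addnC mulnC ltn_add2r ltn_pmod.
apply: ltnW; apply: (leq_trans lt).
apply: (@leq_trans (K * (83 * (m * L)))%N).
  rewrite leq_mul2l; apply/orP; right; apply: (leq_ltn_trans le5).
  by rewrite ltn_mul2r muln_gt0 m_gt0 L_gt0.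
by rewrite /K expnMn mulnACA (expnSr m 2) -[(m ^ 2 * m * L)%N]mulnA; exact: leqnn.
Qed.

(** The state before the last update was unfinished; the step from 83 to 84 absorbs that one
    update. *)
Lemma updates_le nu nr nd st : reach A nu nr nd st ->
  (nu <= 121 * 84 * (m ^ 3 * L))%N.
Proof.
elim=> [//|{}nu {}nr {}nd {}st k re _ nf _ _|//].
apply: (leq_ltn_trans (unfinished_updates re nf)).
by rewrite ltn_mul2r ltn_mul2l muln_gt0 expn_gt0 m_gt0 L_gt0.
Qed.

Lemma restarts_le nu nr nd st : reach A nu nr nd st -> (nd <= m)%N.
Proof.
move=> /(reach_invariant hA n_gt0) /inv_nd; exact: leq_trans (leq_addr _ _).
Qed.

End Bounds.

(** * Correctness of the returned vector and termination *)

Section Correctness.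
Variables (R : realType) (m n : nat) (A : 'M[int]_(m, n)).
Hypothesis hA : forall j, col j A != 0.
Hypothesis n_gt0 : (0 < n)%N.
Implicit Types st : state R m n.

(** The support of [xbar] is all of S, and [inv_supp] confines the support of every solution to
    S. *)
Lemma returns_maximum nu nr nd st xbar : reach A nu nr nd st ->
  returns A st xbar -> maximum_support_solution A xbar.
Proof.
move=> re [fin xS xN]; have I := reach_invariant hA n_gt0 re.
have pos : forall k, 0 < Pix A st k 0.
  case: fin => // S0 k; exfalso; have := ltn_ord k.
  by rewrite [X in (_ < X)%N](_ : _ = 0%N) // S0 cards0.
have nu0 j : 0 < norm2 (column R A j) := nu_gt0 R hA j.
have xpos j : j \in st_S st -> 0 < xbar j 0.
  by move=> jS; rewrite -(enum_rankK_in jS jS) xS divr_gt0.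
have kx : kernel_solution A xbar.
  split; last first.
    move=> i; have [iS|iS] := boolP (i \in st_S st); first exact/ltW/xpos.
    by rewrite xN.
  rewrite Areal_mul (bigID (mem (st_S st))) /= [X in _ + X]big1 ?addr0; last first.
    by move=> i iS; rewrite xN // scale0r.
  have := congr1 (mulmx^~ (entries (st_x st) (st_S st)))
    (mul_ker_proj (hat_cols R A (st_S st))).
  rewrite mul0mx -mulmxA -/(Pi_of R A _) -/(Pix A st) hat_cols_mul => e; rewrite -[RHS]e.
  rewrite [LHS]big_enum_val; apply: eq_bigr => k _.
  by rewrite xS /normalize scalerA.
have sx : supp xbar = st_S st.
  apply/setP => i; rewrite inE; have [iS|iS] := boolP (i \in st_S st).
    by rewrite gt_eqF ?xpos.
  by rewrite xN ?eqxx.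
have sub (z : 'cV[R]_n) : kernel_solution A z -> supp z \subset st_S st.
  by move=> kz; apply: (subset_trans (inv_supp I kz)); exact: subsetDl.
split=> // U; split=> [[[z kz <-] max]|->].
  by symmetry; apply: max => //; rewrite sx sub.
split; first by exists xbar.
by move=> z kz; rewrite sx => Sz; apply/eqP; rewrite eqEsubset sub.
Qed.

Lemma run_reach N (run : nat -> state R m n) : is_run A N run ->
  exists nu nr nd, [/\ (N = nu + nr)%N & reach A nu nr nd (run N)].
Proof.
move=> [r0 rs]; have : (N <= N)%N by [].
elim: {1 3 4}N => [_|k IH kN]; first by exists 0, 0, 0; rewrite r0; split=> //; exact: ReachInit.
have [nu [nr [nd [kE re]]]] := IH (ltnW kN).
have [nf [i im ->]] := rs k kN; case: ifP => ut.
  exists nu.+1, nr, nd; split; first by rewrite kE.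
  exact: ReachUpdate re nf im ut.
exists nu, nr.+1, (nd + rank_drops A (run k))%N; split; first by rewrite kE addnS.
by apply: (ReachRescale re nf im); rewrite ut.
Qed.

Lemma no_infinite_run :
  ~ exists run : nat -> state R m n, forall N, is_run A N run.
Proof.
move=> [run /(_ (121 * 84 * (m ^ 3 * encoding_length A) +
  14 * (m * encoding_length A)).+1)] /run_reach [nu [nr [nd [NE re]]]].
have := updates_le hA n_gt0 re; have := rescalings_le hA n_gt0 re.
by lia.
Qed.

End Correctness.

(** * A small language and its compiler *)

(* At level k, [ESum b e] binds register k, ranging below register b; e is
   then at level k + 1. *)
Inductive expr :=
| EC (c : nat)
| EV (c : cell)
| EB (o : real_binop) (e1 e2 : expr)
| ES (e : expr)
| EEq (i j : nat)
| EIf (e1 e2 e3 e4 : expr)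
| ESum (b : nat) (e : expr).

Inductive stmt :=
| SSkip
| SAsg (c : cell) (e : expr)
| SIdx (i j : nat)
| SSeq (p q : stmt)
| SIf (e1 e2 : expr) (p q : stmt)
| SFor (i b : nat) (p : stmt).

(* Registers below 10 belong to the program, the others are bound by sums;
   arrays from 100 on are scratch space of the compiled code. *)
Definition level := 10%N.
Definition tmp (d : nat) : cell := (100 + d, 2, 2)%N.

Fixpoint wfE (k : nat) (e : expr) : bool :=
  match e with
  | EC _ => true
  | EV (a, i, j) => [&& (a < 100)%N, (i < k)%N & (j < k)%N]
  | EB _ e1 e2 => wfE k e1 && wfE k e2
  | ES e => wfE k e
  | EEq i j => (i < k)%N && (j < k)%N
  | EIf e1 e2 e3 e4 => [&& wfE k e1, wfE k e2, wfE k e3 & wfE k e4]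
  | ESum b e => (b < 2)%N && wfE k.+1 e
  end.

(** [prot] lists the registers that must not be assigned: 0, 1, 2 and the counters of the enclosing
    loops. As loop bounds are registers 0 and 1, every loop makes exactly m or n passes and the cost
    can be read off the text. *)
Fixpoint wfS (prot : seq nat) (p : stmt) : bool :=
  match p with
  | SSkip => true
  | SAsg (a, i, j) e =>
      [&& (a < 100)%N, (i < level)%N, (j < level)%N & wfE level e]
  | SIdx i j => [&& (i < level)%N, (j < level)%N & i \notin prot]
  | SSeq p q => wfS prot p && wfS prot q
  | SIf e1 e2 p q => [&& wfE level e1, wfE level e2, wfS prot p & wfS prot q]
  | SFor i b p =>
      [&& (i < level)%N, (b < 2)%N, i \notin prot & wfS (i :: prot) p]
  end.

(** The value is left in [tmp d], while the scratch cells below [d] hold pending operands. The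
    machine only compares registers by order, so equality takes two tests. *)
Fixpoint compE (d k : nat) (e : expr) : cmd :=
  match e with
  | EC c => RConst (tmp d) c
  | EV c => RCopy (tmp d) c
  | EB o e1 e2 =>
      Seq (compE d k e1) (Seq (compE d.+1 k e2)
        (RBin (tmp d) o (tmp d) (tmp d.+1)))
  | ES e => Seq (compE d k e) (RSqrt (tmp d) (tmp d))
  | EEq i j => If (ILt i j) (RConst (tmp d) 0)
      (If (ILt j i) (RConst (tmp d) 0) (RConst (tmp d) 1))
  | EIf e1 e2 e3 e4 =>
      Seq (compE d k e1) (Seq (compE d.+1 k e2)
        (If (RLt (tmp d) (tmp d.+1)) (compE d k e3) (compE d k e4)))
  | ESum b e =>
      Seq (RConst (tmp d) 0) (Seq (IConst k 0)
        (While (ILt k b) (Seq (compE d.+1 k.+1 e)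
          (Seq (RBin (tmp d) RAdd (tmp d) (tmp d.+1)) (ISucc k k)))))
  end.

Fixpoint compS (p : stmt) : cmd :=
  match p with
  | SSkip => Skip
  | SAsg c e => Seq (compE 0 level e) (RCopy c (tmp 0))
  | SIdx i j => ICopy i j
  | SSeq p q => Seq (compS p) (compS q)
  | SIf e1 e2 p q =>
      Seq (compE 0 level e1) (Seq (compE 1 level e2)
        (If (RLt (tmp 0) (tmp 1)) (compS p) (compS q)))
  | SFor i b p =>
      Seq (IConst i 0) (While (ILt i b) (Seq (compS p) (ISucc i i)))
  end.

Definition dim (m n b : nat) : nat := if b == 0 then m else n.

Fixpoint costE (m n : nat) (e : expr) : nat :=
  match e with
  | EC _ | EV _ => 1
  | EB _ e1 e2 => costE m n e1 + (costE m n e2 + 1)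
  | ES e => costE m n e + 1
  | EEq _ _ => 3
  | EIf e1 e2 e3 e4 =>
      costE m n e1 + (costE m n e2 + (costE m n e3 + costE m n e4).+1)
  | ESum b e => 1 + (1 + (dim m n b * (costE m n e + (1 + 1)).+1 + 1))
  end%N.

Fixpoint cost (m n : nat) (p : stmt) : nat :=
  match p with
  | SSkip => 0
  | SAsg c e => costE m n e + 1
  | SIdx i j => 1
  | SSeq p q => cost m n p + cost m n q
  | SIf e1 e2 p q =>
      costE m n e1 + (costE m n e2 + (cost m n p + cost m n q).+1)
  | SFor i b p => 1 + (dim m n b * (cost m n p + 1).+1 + 1)
  end%N.

Fixpoint iter_up (T : Type) (N : nat) (f : nat -> T -> T) (s : T) : T :=
  if N is k.+1 then f k (iter_up k f s) else s.

Section Semantics.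
Variable R : realType.
Local Notation store := (store R).
Implicit Types s : store.

Fixpoint eval (k : nat) (e : expr) s : R :=
  match e with
  | EC c => c%:R
  | EV c => get s c
  | EB o e1 e2 => eval_binop o (eval k e1 s) (eval k e2 s)
  | ES e => Num.sqrt (eval k e s)
  | EEq i j => (reg s i == reg s j)%:R
  | EIf e1 e2 e3 e4 =>
      if eval k e1 s < eval k e2 s then eval k e3 s else eval k e4 s
  | ESum b e => \sum_(l < reg s b) eval k.+1 e (set_reg s k l)
  end.

Fixpoint den (p : stmt) s : store :=
  match p with
  | SSkip => s
  | SAsg c e => set_cell s c (eval level e s)
  | SIdx i j => set_reg s i (reg s j)
  | SSeq p q => den q (den p s)
  | SIf e1 e2 p q =>
      if eval level e1 s < eval level e2 s then den p s else den q s
  | SFor i b p =>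
      set_reg (iter_up (reg s b) (fun l s' => den p (set_reg s' i l)) s)
        i (reg s b)
  end.

(** Equality up to what compiled code may overwrite: registers from [k] on and the scratch
    arrays. *)
Definition agree (k : nat) s s' :=
  (forall i, (i < k)%N -> reg s i = reg s' i) /\
  (forall a, (a < 100)%N -> forall i j, arr s a i j = arr s' a i j).

Definition runs (c : cmd) s (t0 : nat) (Post : store -> Prop) :=
  exists s' t, [/\ exec c s s' [::] t, Post s' & (t <= t0)%N].

Lemma runs_prim c s s' (P : store -> Prop) :
  exec c s s' [::] 1 -> P s' -> runs c s 1 P.
Proof. by exists s', 1%N. Qed.

Lemma runs_seq c1 c2 s t1 t2 (P Q : store -> Prop) :
  runs c1 s t1 P -> (forall s', P s' -> runs c2 s' t2 Q) ->
  runs (Seq c1 c2) s (t1 + t2) Q.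
Proof.
move=> [s1 [u1 [e1 p1 l1]]] h; have [s2 [u2 [e2 p2 l2]]] := h s1 p1.
exists s2, (u1 + u2)%N; split=> //; last exact: leq_add.
exact: (ExSeq e1 e2).
Qed.

Lemma runs_le c s t1 t2 (P : store -> Prop) :
  runs c s t1 P -> (t1 <= t2)%N -> runs c s t2 P.
Proof.
by move=> [s1 [u1 [e1 p1 l1]]] h; exists s1, u1; split=> //; apply: leq_trans h.
Qed.

Lemma runs_post c s t (P Q : store -> Prop) :
  runs c s t P -> (forall s', P s' -> Q s') -> runs c s t Q.
Proof. by move=> [s1 [u1 [e1 p1 l1]]] h; exists s1, u1; split=> //; exact: h. Qed.

Lemma runs_if b c1 c2 s t (P : store -> Prop) :
  runs (if eval_test b s then c1 else c2) s t P -> runs (If b c1 c2) s t.+1 P.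
Proof.
by move=> [s1 [u1 [e1 p1 l1]]]; exists s1, u1.+1; split=> //; exact: ExIf.
Qed.

Lemma runs_while (I : nat -> store -> Prop) N t b c s :
  (forall l s', (l < N)%N -> I l s' -> eval_test b s' /\ runs c s' t (I l.+1)) ->
  (forall s', I N s' -> ~~ eval_test b s') -> I 0%N s ->
  runs (While b c) s (N * t.+1 + 1) (I N).
Proof.
move=> body stop I0.
suff gen k l s' : (l + k = N)%N -> I l s' -> runs (While b c) s' (k * t.+1 + 1) (I N).
  exact: (gen N 0%N).
elim: k l s' => [|k IH] l s' lk Il.
  rewrite addn0 in lk; rewrite lk in Il.
  by exists s', 1%N; split=> //; apply: ExWhileStop; exact: stop.
have lN : (l < N)%N by lia.
have [tb [s1 [u1 [e1 p1 l1]]]] := body l s' lN Il.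
have [|s2 [u2 [e2 p2 l2]]] := IH l.+1 s1 _ p1; first by lia.
exists s2, (u1 + u2).+1; split=> //; first exact: (ExWhileStep tb e1 e2).
by rewrite mulSn; lia.
Qed.

Lemma agree_set_reg k s s' v : agree k s s' ->
  agree k.+1 (set_reg s k v) (set_reg s' k v).
Proof.
move=> [ar aa]; split=> //= i ik; case: eqP => // /eqP ni.
by apply: ar; rewrite ltn_neqAle ni -ltnS.
Qed.

Lemma agree_get k s s' a i j : agree k s s' -> (a < 100)%N -> (i < k)%N ->
  (j < k)%N -> get s' (a, i, j) = get s (a, i, j).
Proof. by move=> [ar aa] ha hi hj; rewrite /= aa // !ar. Qed.

Definition exprPost d k e s s1 s2 :=
  [/\ agree k s s2, get s2 (tmp d) = eval k e s &
      forall d', (d' < d)%N -> get s2 (tmp d') = get s1 (tmp d')].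

Lemma agree_tmp d k s s' v : agree k s s' -> agree k s (set_cell s' (tmp d) v).
Proof.
move=> [ar aa]; split=> //= a ha i j; rewrite aa //.
by case: eqP => // e; exfalso; lia.
Qed.

Lemma get_tmp d s v : get (set_cell s (tmp d) v) (tmp d) = v.
Proof. by rewrite /= !eqxx. Qed.

Lemma get_tmp_neq d d' s v : d != d' ->
  get (set_cell s (tmp d') v) (tmp d) = get s (tmp d).
Proof. by move=> /negPf nd; rewrite /= eqn_add2l nd. Qed.

Lemma get_tmp_set_reg d s k v : (2 < k)%N ->
  get (set_reg s k v) (tmp d) = get s (tmp d).
Proof. by move=> k2; rewrite /= ltn_eqF. Qed.

Lemma exprPost_set d k e s s1 v : agree k s s1 -> v = eval k e s ->
  exprPost d k e s s1 (set_cell s1 (tmp d) v).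
Proof.
move=> ag ->; split; [exact: agree_tmp|exact: get_tmp|].
by move=> d' dd; rewrite get_tmp_neq // ltn_eqF.
Qed.

(** Two stores are needed: [s] defines the value and stays fixed, [s1] is the store of the machine,
    already polluted by the evaluation of earlier operands. *)
Lemma compE_ok m n e d k s s1 : wfE k e -> (2 < k)%N -> agree k s s1 ->
  reg s 0 = m -> reg s 1 = n ->
  runs (compE d k e) s1 (costE m n e) (exprPost d k e s s1).
Proof.
elim: e d k s s1 => [c|[[a i] j]|o e1 IH1 e2 IH2|e IH|i j|e1 IH1 e2 IH2 e3 IH3 e4 IH4|b e IH] d k s s1 /=.
- move=> _ k2 ag _ _; apply: runs_prim; first exact: ExRConst.
  exact: exprPost_set.
- move=> /and3P[ha hi hj] k2 ag _ _; apply: runs_prim; first exact: ExRCopy.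
  by apply: exprPost_set => //; rewrite (agree_get ag).
- move=> /andP[w1 w2] k2 ag m0 n0.
  apply: runs_seq (IH1 d k s s1 w1 k2 ag m0 n0) _ => s2 [ag2 g2 f2].
  apply: runs_seq (IH2 d.+1 k s s2 w2 k2 ag2 m0 n0) _ => s3 [ag3 g3 f3].
  apply: runs_prim; first exact: ExRBin.
  rewrite g3 (f3 d) // g2; split; [exact: agree_tmp|exact: get_tmp|].
  by move=> d' dd; rewrite get_tmp_neq ?ltn_eqF // f3 ?f2 // ltnS ltnW.
- move=> w k2 ag m0 n0.
  apply: runs_seq (IH d k s s1 w k2 ag m0 n0) _ => s2 [ag2 g2 f2].
  apply: runs_prim; first exact: ExRSqrt.
  rewrite g2; split; [exact: agree_tmp|exact: get_tmp|].
  by move=> d' dd; rewrite get_tmp_neq ?ltn_eqF // f2.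
- move=> /andP[hi hj] k2 ag _ _.
  have [ar _] := ag.
  apply: runs_if => /=; rewrite -(ar i hi) -(ar j hj).
  case: ltngtP => ij.
  + apply: (@runs_le _ _ 1) => //; apply: runs_prim; first exact: ExRConst.
    by apply: exprPost_set => //=; rewrite ltn_eqF.
  + apply: runs_if => /=; rewrite -(ar i hi) -(ar j hj) ij.
    apply: runs_prim; first exact: ExRConst.
    by apply: exprPost_set => //=; rewrite gtn_eqF.
  + apply: runs_if => /=; rewrite -(ar i hi) -(ar j hj) ij ltnn.
    apply: runs_prim; first exact: ExRConst.
    by apply: exprPost_set => //=; rewrite ij eqxx.
- move=> /and4P[w1 w2 w3 w4] k2 ag m0 n0.
  apply: runs_seq (IH1 d k s s1 w1 k2 ag m0 n0) _ => s2 [ag2 g2 f2].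
  apply: runs_seq (IH2 d.+1 k s s2 w2 k2 ag2 m0 n0) _ => s3 [ag3 g3 f3].
  apply: runs_if; rewrite [eval_test _ _]/(get s3 (tmp d) < get s3 (tmp d.+1)).
  rewrite g3 (f3 d) // g2.
  have fin e' : runs (compE d k e') s3 (costE m n e') (exprPost d k e' s s3) ->
    runs (compE d k e') s3 (costE m n e') (fun s4 => [/\ agree k s s4,
      get s4 (tmp d) = eval k e' s &
      forall d', (d' < d)%N -> get s4 (tmp d') = get s1 (tmp d')]).
    move=> [s4 [t [ex [ag4 g4 f4] le]]]; exists s4, t; split=> //; split=> //.
    by move=> d' dd; rewrite f4 // f3 ?f2 // ltnS ltnW.
  case: ifP => lt.
    have [s4 [t [ex [ag4 g4 f4] le]]] := fin _ (IH3 d k s s3 w3 k2 ag3 m0 n0).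
    exists s4, t; split=> //; last by apply: leq_trans le (leq_addr _ _).
    by split; [exact: ag4|rewrite g4 [RHS]/= ifT|exact: f4].
  have [s4 [t [ex [ag4 g4 f4] le]]] := fin _ (IH4 d k s s3 w4 k2 ag3 m0 n0).
  exists s4, t; split=> //; last by apply: leq_trans le (leq_addl _ _).
  by split; [exact: ag4|rewrite g4 [RHS]/= ifF|exact: f4].
move=> /andP[hb w] k2 ag m0 n0.
have dE : dim m n b = reg s b.
  by case: b hb => [|[|]] //; rewrite /dim /= ?m0 ?n0.
apply: runs_seq; first by apply: (runs_prim (P := eq _)); [exact: ExRConst|].
move=> s2 <-; apply: runs_seq; first by apply: (runs_prim (P := eq _)); [exact: ExIConst|].
move=> s3 <-; rewrite dE; set s4 := set_reg _ k 0.
pose I l s' := [/\ agree k.+1 (set_reg s k l) s',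
  get s' (tmp d) = \sum_(i < l) eval k.+1 e (set_reg s k i) &
  forall d', (d' < d)%N -> get s' (tmp d') = get s1 (tmp d')].
have step l s' : (l < reg s b)%N -> I l s' -> eval_test (ILt k b) s' /\
  runs (Seq (compE d.+1 k.+1 e) (Seq (RBin (tmp d) RAdd (tmp d) (tmp d.+1))
     (ISucc k k))) s' (costE m n e + (1 + 1)) (I l.+1).
  move=> lb [ag' g' f']; have [ar' _] := ag'; split.
    have bk : (b == k) = false by rewrite ltn_eqF // (ltn_trans hb).
    rewrite /= -(ar' k) // -(ar' b); last by rewrite ltnS ltnW // (ltn_trans hb).
    by rewrite /= eqxx bk.
  have m1 : reg (set_reg s k l) 0 = m by rewrite /= ltn_eqF // (ltn_trans _ k2).
  have n1 : reg (set_reg s k l) 1 = n by rewrite /= ltn_eqF // (ltn_trans _ k2).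
  apply: runs_seq (IH d.+1 k.+1 _ s' w (ltnW k2) ag' m1 n1) _ => s5 [ag5 g5 f5].
  apply: runs_seq; first by apply: (runs_prim (P := eq _)); [exact: ExRBin|].
  move=> s6 <-; apply: runs_prim; first exact: ExISucc.
  have ag6 := agree_tmp d (eval_binop RAdd (get s5 (tmp d)) (get s5 (tmp d.+1))) ag5.
  have [ar5 aa5] := ag5.
  split.
  + have [ar6 aa6] := ag6; split=> //= i ik; have := ar6 i ik; rewrite /=.
    by case: eqP => // ->; rewrite -(ar5 k) //= eqxx.
  + by rewrite get_tmp_set_reg // get_tmp [eval_binop _ _ _]/(_ + _) g5 (f5 d) // g'
      big_ord_recr.
  + move=> d' dd; rewrite get_tmp_set_reg // get_tmp_neq ?ltn_eqF // f5 ?f' //.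
    by rewrite ltnS ltnW.
have I0 : I 0%N s4.
  split.
  + exact/agree_set_reg/agree_tmp.
  + by rewrite big_ord0 get_tmp_set_reg // get_tmp.
  + by move=> d' dd; rewrite get_tmp_set_reg // get_tmp_neq ?ltn_eqF.
have stop s' : I (reg s b) s' -> ~~ eval_test (ILt k b) s'.
  move=> [[ar' _] _ _].
  have bk : (b == k) = false by rewrite ltn_eqF // (ltn_trans hb).
  rewrite /= -(ar' k) // -(ar' b); last by rewrite ltnS ltnW // (ltn_trans hb).
  by rewrite /= eqxx bk ltnn.
have [s5 [t [ex [ag5 g5 f5] le]]] := runs_while step stop I0.
exists s5, t; split=> //; split=> //.
have [ar5 aa5] := ag5; split=> // i ik; rewrite -ar5 //=; last exact: ltnW.
by rewrite ltn_eqF.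
Qed.

Lemma iter_up_ind (T : Type) (P : nat -> T -> Prop) N (f : nat -> T -> T) (x : T) :
  P 0%N x -> (forall k y, (k < N)%N -> P k y -> P k.+1 (f k y)) ->
  P N (iter_up N f x).
Proof.
move=> P0; elim: N => [//|N IH] PS /=.
by apply: (PS) => //; apply: IH => k y kN; apply: PS; exact: ltnW.
Qed.

Lemma den_reg prot p s i : wfS prot p -> i \in prot ->
  reg (den p s) i = reg s i.
Proof.
elim: p prot s => [|[[a i1] j1] e|i1 j1|p IHp q IHq|e1 e2 p IHp q IHq|i1 b p IHp] prot s //=.
- by move=> /and3P[_ _ ni] ip; case: eqP => // e; rewrite -e ip in ni.
- by move=> /andP[wp wq] ip; rewrite (IHq prot) // (IHp prot).
- by move=> /and4P[_ _ wp wq] ip; case: ifP => _; [exact: (IHp prot)|exact: (IHq prot)].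
move=> /and4P[_ _ ni wp] ip.
have ii : (i == i1) = false by apply: contraNF ni => /eqP <-.
rewrite ii; pose P (l : nat) s' := reg s' i = reg s i.
apply: (iter_up_ind (P := P)) => // k s' _ Ps'.
by rewrite /P (IHp (i1 :: prot)) //= ?ii // inE ip orbT.
Qed.

Lemma comp_ok m n prot p s s1 : wfS prot p ->
  [/\ 0 \in prot, 1 \in prot & 2 \in prot]%N ->
  agree level s s1 -> reg s 0 = m -> reg s 1 = n ->
  runs (compS p) s1 (cost m n p) (agree level (den p s)).
Proof.
elim: p prot s s1 => [|[[a i] j] e|i j|p IHp q IHq|e1 e2 p IHp q IHq|i b p IHp] prot s s1 /=.
- by move=> *; exists s1, 0%N; split=> //; exact: ExSkip.
- move=> /and4P[ha hi hj w] _ ag m0 n0.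
  apply: runs_seq (compE_ok 0 w isT ag m0 n0) _ => s2 [ag2 g2 f2].
  apply: runs_prim; first exact: ExRCopy.
  have [ar aa] := ag2; rewrite g2; split=> //= a' ha' i' j'.
  by rewrite !ar // aa.
- move=> /and3P[hi hj ni] _ [ar aa] m0 n0; apply: runs_prim; first exact: ExICopy.
  by split=> [i1 hi1 /=|]; last exact: aa; case: eqP => _; exact: ar.
- move=> /andP[wp wq] pr ag m0 n0; have [p0 p1 p2] := pr.
  apply: runs_seq (IHp prot s s1 wp pr ag m0 n0) _ => s2 ag2.
  by apply: (IHq prot) => //; rewrite (den_reg _ wp).
- move=> /and4P[w1 w2 wp wq] pr ag m0 n0.
  apply: runs_seq (compE_ok 0 w1 isT ag m0 n0) _ => s2 [ag2 g2 f2].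
  apply: runs_seq (compE_ok 1 w2 isT ag2 m0 n0) _ => s3 [ag3 g3 f3].
  apply: runs_if; rewrite [eval_test _ _]/(get s3 (tmp 0) < get s3 (tmp 1)).
  rewrite g3 (f3 0%N) // g2; case: ifP => lt12.
    apply: runs_le (leq_addr _ _).
    apply: runs_post (IHp prot s s3 wp pr ag3 m0 n0) _ => s4.
    by rewrite ifT.
  apply: runs_le (leq_addl _ _).
  apply: runs_post (IHq prot s s3 wq pr ag3 m0 n0) _ => s4.
  by rewrite ifF.
move=> /and4P[hi hb ni w] pr ag m0 n0; have [p0 p1 p2] := pr.
have dE : dim m n b = reg s b.
  by case: b hb => [|[|]] //; rewrite /dim /= ?m0 ?n0.
apply: runs_seq; first by apply: (runs_prim (P := eq _)); [exact: ExIConst|].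
move=> s2 <-; rewrite dE.
pose f l s' := den p (set_reg s' i l).
pose u l := iter_up l f s.
have ureg l j : j \in prot -> reg (u l) j = reg s j.
  move=> jp; apply: (iter_up_ind (P := fun _ s' => reg s' j = reg s j)) => // k s' _ e.
  rewrite /f (den_reg _ w) /= ?inE ?jp ?orbT //.
  by case: eqP => // ji; rewrite -ji jp in ni.
have bp : b \in prot by case: b hb {dE} => [|[|]].
have bl : (b < level)%N by case: b hb {dE bp} => [|[|]].
have bi : (b == i) = false by apply: contraNF ni => /eqP <-.
(* The semantics sets the counter before each pass, the machine increments it afterwards; [I]
   compares them when both counters are [l]. *)
pose I l s' := agree level (set_reg (u l) i l) s'.
apply: (runs_while (I := I)) => [l s' lb ag'|s' ag'|].
- have [ar' aa'] := ag'; split.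
    by rewrite /= -(ar' i) // -(ar' b) //= eqxx bi ureg.
  have prot' : [/\ 0 \in i :: prot, 1 \in i :: prot & 2 \in i :: prot]%N.
    by rewrite !inE p0 p1 p2 !orbT.
  have reg' j : j \in prot -> reg (set_reg (u l) i l) j = reg s j.
    move=> jp /=; case: eqP => [ji|_]; last exact: ureg.
    by rewrite -ji jp in ni.
  apply: runs_seq.
    apply: (IHp _ _ s' w prot' ag'); by rewrite reg'.
  move=> s3 [ar3 aa3]; apply: runs_prim; first exact: ExISucc.
  split=> [j hj /=|a ha j j' /=]; last exact: aa3.
  case: eqP => // _; last exact: ar3.
  by rewrite -ar3 // (den_reg _ w) ?inE ?eqxx //= eqxx.
- have [ar' _] := ag'.
  by rewrite /= -(ar' i) // -(ar' b) //= eqxx bi ureg // ltnn.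
have [ar aa] := ag; split=> //= j hj.
by rewrite ar.
Qed.

End Semantics.

(** * Frame properties and in-place maps *)

Fixpoint warr (p : stmt) : seq nat :=
  match p with
  | SSkip | SIdx _ _ => [::]
  | SAsg (a, _, _) _ => [:: a]
  | SSeq p q | SIf _ _ p q => warr p ++ warr q
  | SFor _ _ p => warr p
  end.

Fixpoint wreg (p : stmt) : seq nat :=
  match p with
  | SSkip | SAsg _ _ => [::]
  | SIdx i _ => [:: i]
  | SSeq p q | SIf _ _ p q => wreg p ++ wreg q
  | SFor i _ p => i :: wreg p
  end.

(** An expression that reads the array only at the entry about to be overwritten makes an in-place
    map coincide with a simultaneous one. *)
Fixpoint reads_only (a i j : nat) (e : expr) : bool :=
  match e with
  | EC _ | EEq _ _ => true
  | EV (b, i', j') => (b == a) ==> (i' == i) && (j' == j)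
  | EB _ e1 e2 => reads_only a i j e1 && reads_only a i j e2
  | ES e | ESum _ e => reads_only a i j e
  | EIf e1 e2 e3 e4 => [&& reads_only a i j e1, reads_only a i j e2,
      reads_only a i j e3 & reads_only a i j e4]
  end.

Definition vmap (a b : nat) (e : expr) : stmt := SFor 4 b (SAsg (a, 2, 4)%N e).
Definition mmap (a bi bj : nat) (e : expr) : stmt :=
  SFor 3 bi (SFor 4 bj (SAsg (a, 3, 4)%N e)).

Section Frames.
Variable R : realType.
Implicit Types s : store R.

Lemma den_arr p s a i j : a \notin warr p -> arr (den p s) a i j = arr s a i j.
Proof.
elim: p s => [|[[b i1] j1] e|i1 j1|p IHp q IHq|e1 e2 p IHp q IHq|i1 b p IHp] s //=.
- by rewrite inE => /negPf ->.
- by rewrite mem_cat negb_or => /andP[ap aq]; rewrite IHq // IHp.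
- by rewrite mem_cat negb_or => /andP[ap aq]; case: ifP => _; [exact: IHp|exact: IHq].
move=> ap; apply: (iter_up_ind (P := fun _ s' => arr s' a i j = arr s a i j)) => //.
by move=> k s' _ e; rewrite IHp.
Qed.

Lemma den_wreg p s i : i \notin wreg p -> reg (den p s) i = reg s i.
Proof.
elim: p s => [|[[b i1] j1] e|i1 j1|p IHp q IHq|e1 e2 p IHp q IHq|i1 b p IHp] s //=.
- by rewrite inE => /negPf ->.
- by rewrite mem_cat negb_or => /andP[ap aq]; rewrite IHq // IHp.
- by rewrite mem_cat negb_or => /andP[ap aq]; case: ifP => _; [exact: IHp|exact: IHq].
rewrite inE negb_or => /andP[/negPf ii ip]; rewrite ii.
apply: (iter_up_ind (P := fun _ s' => reg s' i = reg s i)) => //.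
by move=> k s' _ e; rewrite IHp //= ii.
Qed.

Lemma eval_reads_only a i j e k s s' : wfE k e -> reads_only a i j e ->
  (1 < k)%N -> (i < k)%N -> (j < k)%N ->
  (forall l, (l < k)%N -> reg s l = reg s' l) ->
  (forall b u v, b != a -> arr s b u v = arr s' b u v) ->
  arr s a (reg s i) (reg s j) = arr s' a (reg s i) (reg s j) ->
  eval k e s = eval k e s'.
Proof.
elim: e k s s' => [c|[[b i'] j']|o e1 IH1 e2 IH2|e IH|i' j'|e1 IH1 e2 IH2 e3 IH3 e4 IH4|b e IH] k s s' //=.
- move=> /and3P[_ hi hj] ro _ ik jk er ea eij; rewrite -!er //.
  case: (eqVneq b a) ro => [-> /andP[/eqP -> /eqP ->] //|nb _]; exact: ea.
- by move=> /andP[w1 w2] /andP[r1 r2] *; rewrite (IH1 k s s') // (IH2 k s s').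
- by move=> *; rewrite (IH k s s').
- by move=> /andP[hi hj] _ _ _ _ er _ _; rewrite !er.
- move=> /and4P[w1 w2 w3 w4] /and4P[r1 r2 r3 r4] *.
  by rewrite (IH1 k s s') // (IH2 k s s') // (IH3 k s s') // (IH4 k s s').
move=> /andP[hb w] ro k1 ik jk er ea eij.
rewrite er; last exact: leq_trans hb k1.
apply: eq_bigr => l _; apply: IH => //=; try exact: ltnW.
  by move=> l' hl'; case: eqP => // /eqP nl; apply: er; rewrite ltn_neqAle nl -ltnS.
by rewrite !ltn_eqF.
Qed.

Lemma den_row_map a i j b e s : wfE level e -> reads_only a i j e ->
  (i < level)%N -> (j < level)%N -> i != j ->
  forall i' j', arr (den (SFor j b (SAsg (a, i, j) e)) s) a i' j' =
    if (i' == reg s i) && (j' < reg s b)%N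
    then eval level e (set_reg s j j') else arr s a i' j'.
Proof.
move=> w ro hi hj ij i' j' /=.
set f := fun l => _; pose u l := iter_up l f s.
have inv l : [/\ (forall r, r != j -> reg (u l) r = reg s r),
    (forall b u' v, b != a -> arr (u l) b u' v = arr s b u' v) &
    (forall u' v, arr (u l) a u' v = if (u' == reg s i) && (v < l)%N
       then eval level e (set_reg s j v) else arr s a u' v)].
  elim: l => [|l [IH1 IH2 IH3]].
    by split=> // u' v; rewrite ltn0 andbF.
  rewrite /u /= -/(u l) /f /=; split.
  - by move=> r rj; rewrite (negPf rj) IH1.
  - by move=> b' u' v nb; rewrite (negPf nb) /= IH2.
  move=> u' v; rewrite !eqxx (negPf ij) /= IH1 // ltnS leq_eqVlt.
  case: (u' =P reg s i) => [->|/eqP/negPf ne] /=; last by rewrite IH3 ne.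
  case: (v =P l) => [->|_] /=; last first.
    by rewrite IH3 eqxx.
  apply: (@eval_reads_only a i j) => //=.
  - by move=> r _; case: eqP => // /eqP; exact: IH1.
  by rewrite (negPf ij) eqxx IH3 IH1 // ltnn andbF.
by have [_ _ ->] := inv (reg s b).
Qed.

Lemma den_vmap a b e s : wfE level e -> reads_only a 2 4 e ->
  forall i' j', arr (den (vmap a b e) s) a i' j' =
    if (i' == reg s 2) && (j' < reg s b)%N
    then eval level e (set_reg s 4 j') else arr s a i' j'.
Proof. by move=> w ro; exact: den_row_map. Qed.

Lemma den_mmap a bi bj e s : wfE level e -> reads_only a 3 4 e ->
  (bi < 2)%N -> (bj < 2)%N ->
  forall i' j', arr (den (mmap a bi bj e) s) a i' j' =
    if (i' < reg s bi)%N && (j' < reg s bj)%N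
    then eval level e (set_reg (set_reg s 3 i') 4 j') else arr s a i' j'.
Proof.
move=> w ro hbi hbj i' j'.
pose q := SFor 4 bj (SAsg (a, 3, 4)%N e).
change (arr (set_reg (iter_up (reg s bi) (fun l s' => den q (set_reg s' 3 l)) s)
  3 (reg s bi)) a i' j' = if (i' < reg s bi)%N && (j' < reg s bj)%N
    then eval level e (set_reg (set_reg s 3 i') 4 j') else arr s a i' j').
set f := fun l => _; pose u l := iter_up l f s; rewrite -/(u _) /=.
have b3 : (bj == 3) = false by lia.
have inv l : [/\ (forall r, r != 3 -> r != 4 -> reg (u l) r = reg s r),
    (forall b u' v, b != a -> arr (u l) b u' v = arr s b u' v) &
    (forall u' v, arr (u l) a u' v = if (u' < l)%N && (v < reg s bj)%N
       then eval level e (set_reg (set_reg s 3 u') 4 v) else arr s a u' v)].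
  elim: l => [|l [IH1 IH2 IH3]]; first by split=> // u' v; rewrite ltn0.
  have uE : u l.+1 = den q (set_reg (u l) 3 l) by [].
  split.
  - move=> r r3 r4; rewrite uE den_wreg; last by rewrite inE.
    by rewrite /= (negPf r3) IH1.
  - by move=> b u' v nb; rewrite uE den_arr ?inE //= IH2.
  move=> u' v; rewrite uE den_row_map //= b3 IH1 //; try lia.
  rewrite ltnS [(u' <= l)%N]leq_eqVlt; case: (u' =P l) => [->|_] /=; last by rewrite IH3.
  case: ifP => vb; last by rewrite IH3 ltnn.
  apply: (@eval_reads_only a 3 4) => //=.
  - move=> r _; case: eqP => // /eqP r4; case: eqP => // /eqP r3; exact: IH1.
  by rewrite IH3 ltnn.
by have [_ _ ->] := inv (reg s bi).
Qed.

End Frames.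

(** * The program *)

Definition ent a i j : expr := EV (a, i, j).
Definition sc a : expr := EV (a, 2, 2)%N.
Definition eadd := EB RAdd.
Definition esub := EB RSub.
Definition emul := EB RMul.
Definition equo := EB RDiv.
Definition asg a e : stmt := SAsg (a, 2, 2)%N e.
Definition seqs (ps : seq stmt) : stmt := foldr SSeq SSkip ps.

(* Index registers: 0 and 1 hold m and n, 2 holds 0; 3 and 4 are used by the
   maps, 5 holds a selected column, 6 and 7 are loop counters.
   Arrays: 0 A; 1 x; 2 S; 3 T; 4 output; 5 norms of the columns; 6 the matrix
   A^T Q A; 7 the vector A^T Q y; 8 Pi x; 9 Pi; 10 a list of vectors; 11 the
   projection to the orthogonal complement of their span; 12 a vector.
   Scalars: 20 epsilon; 21 kappa; 22 the inverse of theta; 23 the squared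
   Q-norm of y; 24 rank of A_S; 26 number of independent vectors met;
   27 number of nonpositive entries of Pi x; 31 Delta; 32 m; 40 zero. *)

Definition proj_init (d : nat) : stmt :=
  SSeq (mmap 11 d d (EEq 3 4)) (asg 26 (EC 0)).

(** One Gram-Schmidt step: with w the given row of array 10 and P the current projection, (wP)^T
    (wP) / ||wP||^2 is subtracted from P unless wP = 0, and the rank is counted along the way. *)
Definition proj_step (r d : nat) : stmt :=
  seqs [:: vmap 12 d (ESum d (emul (ent 10 r 10) (ent 11 10 4)));
    asg 25 (ESum d (emul (ent 12 2 10) (ent 10 r 10)));
    SIf (EC 0) (sc 25)
      (SSeq (mmap 11 d d (esub (ent 11 3 4)
               (equo (emul (ent 12 2 3) (ent 12 2 4)) (sc 25))))
            (asg 26 (eadd (sc 26) (EC 1))))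
      SSkip].

Definition proj (k d : nat) : stmt :=
  SSeq (proj_init d) (SFor 6 k (proj_step 6 d)).

Definition constants : stmt :=
  seqs [:: vmap 5 1 (ES (ESum 0 (emul (ent 0 10 4) (ent 0 10 4))));
    asg 32 (ESum 0 (EC 1));
    asg 20 (equo (EC 1) (emul (EC 11) (sc 32)));
    asg 21 (equo (EC 1) (emul (eadd (EC 1) (emul (EC 3) (sc 20)))
                            (eadd (EC 1) (emul (EC 3) (sc 20)))));
    mmap 6 1 1 (ESum 0 (emul (ent 0 10 3) (ent 0 10 4)))].

(** Looks for a longest column outside the span of those chosen so far; norms are positive, so
    scalar 28 stays 0 exactly when there is none. *)
Definition greedy_scan : stmt :=
  SSeq (asg 28 (EC 0))
    (SFor 6 1 (SSeq
      (asg 25 (ESum 0 (ESum 0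
         (emul (emul (ent 10 6 10) (ent 11 10 11)) (ent 10 6 11)))))
      (SIf (EC 0) (sc 25)
         (SIf (sc 28) (ent 5 2 6) (SSeq (asg 28 (ent 5 2 6)) (SIdx 5 6)) SSkip)
         SSkip))).

Definition greedy_round : stmt :=
  SSeq greedy_scan
    (SIf (EC 0) (sc 28)
       (SSeq (proj_step 5 0) (asg 31 (emul (sc 31) (sc 28)))) SSkip).

Definition greedy : stmt :=
  seqs [:: mmap 10 1 0 (ent 0 4 3); proj_init 0; asg 31 (EC 1);
    SFor 7 1 greedy_round;
    asg 22 (emul (emul (sc 32) (sc 32)) (emul (sc 31) (sc 31)))].

Definition on_S (i : nat) (e : expr) : expr := EIf (EC 0) (ent 2 2 i) e (EC 0).

Definition restart_vectors : stmt :=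
  seqs [:: vmap 3 1 (EC 0); vmap 1 1 (EC 1);
    vmap 7 1 (ESum 1 (on_S 10 (equo (ent 6 4 10) (ent 5 2 10))));
    asg 23 (ESum 1 (on_S 10 (equo (ent 7 2 10) (ent 5 2 10))))].

(** The m rows of the normalised matrix, with the columns outside S zeroed, are orthogonalised in
    dimension n. The order of m n^2 operations is affordable because this happens only at the start
    and at removals. *)
Definition restart_projection : stmt :=
  seqs [:: mmap 10 0 1 (on_S 4 (equo (ent 0 3 4) (ent 5 2 4)));
    proj 0 1;
    mmap 9 1 1 (ent 11 3 4);
    vmap 8 1 (ESum 1 (emul (ent 9 4 10) (on_S 10 (ent 1 2 10))));
    asg 24 (sc 26)].

Definition restart_stmt : stmt := SSeq restart_vectors restart_projection.

Definition check_stmt : stmt :=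
  asg 27 (ESum 1 (on_S 10 (EIf (EC 0) (ent 8 2 10) (EC 0) (EC 1)))).

Definition init_stmt : stmt :=
  seqs [:: constants; greedy; vmap 2 1 (EC 1); restart_stmt; check_stmt].

Definition select : stmt :=
  seqs [:: asg 28 (sc 30); SIdx 5 6; asg 29 (EC 1)].

Definition argmin_step : stmt :=
  SIf (EC 0) (ent 2 2 6)
    (SSeq (asg 30 (equo (ent 7 2 6) (ES (ent 6 6 6))))
       (SIf (sc 29) (EC 1) select (SIf (sc 30) (sc 28) select SSkip)))
    SSkip.

Definition argmin_stmt : stmt :=
  seqs [:: asg 29 (EC 0); SFor 6 1 argmin_step;
    asg 34 (ent 7 2 5);
    asg 35 (emul (emul (esub (EC 0) (sc 20)) (ES (ent 6 5 5))) (ES (sc 23)))].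

(** Scalars 33 and 36 are saved before the maps because entry k of array 7 changes under way. The
    new squared norm is s - p^2 / F, since the new y is orthogonal to a_k. *)
Definition update_stmt : stmt :=
  seqs [:: asg 33 (equo (ent 7 2 5) (ent 6 5 5));
    asg 23 (esub (sc 23) (emul (sc 33) (ent 7 2 5)));
    vmap 7 1 (esub (ent 7 2 4) (emul (sc 33) (ent 6 4 5)));
    asg 36 (emul (sc 33) (ent 5 2 5));
    SAsg (1, 2, 5)%N (esub (ent 1 2 5) (sc 36));
    vmap 8 1 (esub (ent 8 2 4) (emul (sc 36) (ent 9 4 5)))].

(** Products with y are simply multiplied by 4 kappa. The rank of the unmarked columns is found from
    n vectors in dimension m, at the order of m^2 n operations; orthogonalising rows in dimension n
    would exceed the bound, as this is done at every rescaling. *)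
Definition rescale_stmt : stmt :=
  seqs [:: mmap 6 1 1 (emul (sc 21) (eadd (ent 6 3 4)
      (equo (emul (emul (EC 3) (ent 7 2 3)) (ent 7 2 4)) (sc 23))));
    vmap 7 1 (emul (emul (EC 4) (sc 21)) (ent 7 2 4));
    asg 23 (emul (emul (EC 4) (sc 21)) (sc 23));
    vmap 3 1 (EIf (ent 3 2 4) (ent 2 2 4)
      (EIf (sc 22) (equo (ES (ent 6 4 4)) (ent 5 2 4)) (EC 1) (EC 0)) (ent 3 2 4));
    mmap 10 1 0 (EIf (ent 3 2 3) (ent 2 2 3) (ent 0 4 3) (EC 0));
    proj 1 0].

Definition remove_stmt : stmt :=
  SSeq (vmap 2 1 (EIf (ent 3 2 4) (ent 2 2 4) (EC 1) (EC 0))) restart_stmt.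

Definition output_stmt : stmt := vmap 4 1 (on_S 4 (equo (ent 8 2 4) (ent 5 2 4))).

Definition loop_body : cmd :=
  Seq (compS argmin_stmt)
    (Seq (If (RLt (34, 2, 2) (35, 2, 2))%N (compS update_stmt)
           (Seq (compS rescale_stmt)
              (If (RLt (26, 2, 2) (24, 2, 2))%N (compS remove_stmt) Skip)))
       (Seq (compS check_stmt) Mark)).

Definition program : cmd :=
  Seq (compS init_stmt) (Seq Mark
    (Seq (While (RLt (40, 2, 2) (27, 2, 2))%N loop_body) (compS output_stmt))).

Definition prot0 : seq nat := [:: 0; 1; 2]%N.

Lemma wf_init : wfS prot0 init_stmt. Proof. by []. Qed.
Lemma wf_argmin : wfS prot0 argmin_stmt. Proof. by []. Qed.
Lemma wf_update : wfS prot0 update_stmt. Proof. by []. Qed.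
Lemma wf_rescale : wfS prot0 rescale_stmt. Proof. by []. Qed.
Lemma wf_remove : wfS prot0 remove_stmt. Proof. by []. Qed.
Lemma wf_check : wfS prot0 check_stmt. Proof. by []. Qed.
Lemma wf_output : wfS prot0 output_stmt. Proof. by []. Qed.

(** * Incremental computation of an orthogonal projection *)

Section ProjectionUpdate.
Variables (R : realType) (K D : nat) (W : 'M[R]_(K, D)).
Implicit Types (G : {set 'I_K}) (P : 'M[R]_D).

Definition sel_rows G : 'M[R]_(K, D) :=
  \matrix_i (if i \in G then row i W else 0).

(** [P] is the orthogonal projection onto the complement of the span of the rows in [G]. *)
Definition proj_inv G P :=
  [/\ P^T = P, sel_rows G *m P = 0 & (1%:M - P <= sel_rows G)%MS].

Lemma sel_rowsT : sel_rows setT = W.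
Proof. by apply/row_matrixP => i; rewrite rowK inE. Qed.

Lemma sel_rows_sub G (p : nat) (U : 'M[R]_(p, D)) :
  (forall i, i \in G -> (row i W <= U)%MS) -> (sel_rows G <= U)%MS.
Proof.
by move=> h; apply/row_subP => i; rewrite rowK; case: ifP => [/h //|_]; rewrite sub0mx.
Qed.

Lemma row_sub_sel G i : i \in G -> (row i W <= sel_rows G)%MS.
Proof. by move=> iG; have := row_sub i (sel_rows G); rewrite rowK iG. Qed.

Lemma sel_rowsS G G' : G \subset G' -> (sel_rows G <= sel_rows G')%MS.
Proof. by move=> s; apply: sel_rows_sub => i /(subsetP s); exact: row_sub_sel. Qed.

Lemma proj_inv0 : proj_inv set0 1%:M.
Proof.
split; [exact: trmx1| |by rewrite subrr sub0mx].
by rewrite mulmx1; apply/row_matrixP => i; rewrite rowK inE row0.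
Qed.

Lemma rank_add_row (U : 'M[R]_(K, D)) (b : 'rV_D) :
  ~~ (b <= U)%MS -> \rank (U + b)%MS = (\rank U).+1.
Proof.
move=> nb; apply/eqP; rewrite eqn_leq; apply/andP; split.
  apply: (leq_trans (mxrank_adds_leqif _ _)).
  by rewrite -[X in (_ <= X)%N]addn1 leq_add2l rank_leq_row.
rewrite ltn_neqAle (mxrank_leqif_sup (addsmxSl U b)) mxrankS ?addsmxSl // andbT.
by apply: contra nb => h; apply: submx_trans h; exact: addsmxSr.
Qed.

Lemma sel_rowsU1 i G : (sel_rows (i |: G) :=: sel_rows G + row i W)%MS.
Proof.
apply/eqmxP/andP; split.
  apply: sel_rows_sub => j; rewrite !inE => /orP[/eqP ->|jG].
    exact: addsmxSr.
  exact: submx_trans (row_sub_sel jG) (addsmxSl _ _).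
rewrite addsmx_sub sel_rowsS ?subsetUr //=.
by apply: row_sub_sel; rewrite setU11.
Qed.

Section Step.
Variables (G : {set 'I_K}) (P : 'M[R]_D) (i : 'I_K).
Hypothesis iP : proj_inv G P.
Definition pivot : 'rV[R]_D := row i W *m P.
Definition pivot_norm : R := (pivot *m (row i W)^T) 0 0.
Local Notation v := pivot.
Local Notation beta := pivot_norm.

Lemma proj_idem : P *m P = P.
Proof.
have [_ GP /submxP [X e]] := iP.
have -> : P *m P = P - (1%:M - P) *m P by rewrite mulmxBl mul1mx opprB addrC subrK.
by rewrite e -mulmxA GP mulmx0 subr0.
Qed.

Lemma pivot_normE : beta = dotQ 1%:M v^T v^T.
Proof.
have [sP _ _] := iP.
rewrite /dotQ mulmx1 trmxK /pivot_norm /pivot trmx_mul sP mulmxA.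
by rewrite -(mulmxA _ P P) proj_idem.
Qed.

Lemma pivot_norm_ge0 : 0 <= beta.
Proof. by rewrite pivot_normE dotQ1_ge0. Qed.

Lemma pivot_norm0 : (beta == 0) = (row i W <= sel_rows G)%MS.
Proof.
have [sP GP le] := iP; apply/eqP/idP => [b0|/submxP [c e]].
  have v0 : v = 0.
    by apply: trmx_inj; rewrite trmx0; apply: dotQ1_eq0; rewrite -pivot_normE.
  have -> : row i W = row i W *m (1%:M - P) by rewrite mulmxBr mulmx1 -/v v0 subr0.
  exact: submx_trans (submxMl _ _) le.
have v0 : v = 0 by rewrite /pivot e -mulmxA GP mulmx0.
by rewrite /pivot_norm v0 mul0mx mxE.
Qed.

Definition updated_proj : 'M[R]_D :=
  if 0 < beta then P - beta^-1 *: (v^T *m v) else P.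

(** By idempotence [beta] is the squared length of the projected row [v], so it vanishes exactly
    when the row is already in the span. Otherwise the direction [v] is projected out and the rank
    grows by one. *)
Lemma proj_inv_step : proj_inv (i |: G) updated_proj /\
  \rank (sel_rows (i |: G)) = (\rank (sel_rows G) + (0 < beta)%R)%N.
Proof.
have [sP GP le] := iP; have b0 := pivot_norm_ge0.
rewrite /updated_proj sel_rowsU1; case: (ltP 0 beta) => [bp|bn]; last first.
  have /eqP : beta = 0 by apply/eqP; rewrite eq_le bn b0.
  rewrite pivot_norm0 => inG.
  have eqS : (sel_rows G + row i W :=: sel_rows G)%MS by apply/addsmx_idPl.
  rewrite addn0 eqS; split=> //; split=> //.
    apply/row_matrixP => j; rewrite row_mul rowK row0 !inE.
    have Gv l : l \in G -> row l W *m P = 0.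
      by move=> lG; have := congr1 (row l) GP; rewrite row_mul rowK lG row0.
    case: (eqVneq j i) => [->|_] /=; last first.
      by case: ifP => [/Gv //|_]; rewrite mul0mx.
    by move/submxP: inG => [c ->]; rewrite -mulmxA GP mulmx0.
  by rewrite sel_rowsU1 (submx_trans le) ?addsmxSl.
have bne : beta != 0 by rewrite gt_eqF.
split; last first.
  by rewrite addn1 rank_add_row // -pivot_norm0.
have vT : v^T = P *m (row i W)^T by rewrite trmx_mul sP.
have vv : v *m (row i W)^T = beta%:M by rewrite [LHS]mx11_scalar.
have bv : row i W *m v^T = beta%:M.
  by apply: trmx_inj; rewrite trmx_mul trmxK vv !tr_scalar_mx.
split.
- by rewrite linearB linearZ /= trmx_mul trmxK sP.
- apply/row_matrixP => j; rewrite row_mul rowK row0 !inE.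
  have Gv l : l \in G -> row l W *m P = 0.
    by move=> lG; have := congr1 (row l) GP; rewrite row_mul rowK lG row0.
  case: (eqVneq j i) => [->|_] /=.
    rewrite mulmxBr -scalemxAr mulmxA bv mul_scalar_mx scalerA mulVf //.
    by rewrite scale1r subrr.
  case: ifP => [/Gv jG|_]; last by rewrite mul0mx.
  have jv : row j W *m v^T = 0 by rewrite vT mulmxA jG mul0mx.
  by rewrite mulmxBr -scalemxAr jG (mulmxA _ v^T) jv mul0mx scaler0 subr0.
rewrite sel_rowsU1 opprB addrA addrAC.
apply: addmx_sub; first exact: submx_trans le (addsmxSl _ _).
apply/scalemx_sub/(submx_trans (submxMl _ _)).
have -> : v = row i W - row i W *m (1%:M - P).
  by rewrite mulmxBr mulmx1 opprB addrC subrK.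
rewrite addmx_sub ?addsmxSr // eqmx_opp.
exact: submx_trans (submx_trans (submxMl _ _) le) (addsmxSl _ _).
Qed.

End Step.

End ProjectionUpdate.

(** * The projection held in memory *)

Section ProjectionProgram.
Variables (R : realType) (K D : nat).
Implicit Types (s : store R) (G : {set 'I_K}).

Lemma den_seq p q s : den (SSeq p q) s = den q (den p s).
Proof. by []. Qed.

Lemma den_seqs_cons p ps s : den (seqs (p :: ps)) s = den (seqs ps) (den p s).
Proof. by []. Qed.

Lemma den_seqs_nil s : den (seqs [::]) s = s.
Proof. by []. Qed.

Lemma den_if e1 e2 p q s : den (SIf e1 e2 p q) s =
  if eval level e1 s < eval level e2 s then den p s else den q s.
Proof. by []. Qed.

Definition denE := (den_seqs_cons, den_seqs_nil, den_seq, den_if).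

Lemma den_asg a e s : reg s 2 = 0%N ->
  arr (den (asg a e) s) a 0 0 = eval level e s.
Proof. by move=> z; rewrite /= z !eqxx. Qed.

Definition holds_proj (W : 'M[R]_(K, D)) G s :=
  (forall (i : 'I_K) (j : 'I_D), arr s 10 i j = W i j) /\
  exists P, [/\ proj_inv W G P, forall i j : 'I_D, arr s 11 i j = P i j &
    arr s 26 0 0 = (\rank (sel_rows W G))%:R].

Lemma proj_init_ok (W : 'M[R]_(K, D)) d s :
  (d < 2)%N -> reg s d = D -> reg s 2 = 0%N ->
  (forall (i : 'I_K) (j : 'I_D), arr s 10 i j = W i j) ->
  holds_proj W set0 (den (proj_init d) s).
Proof.
move=> d2 dD z hW; split=> [i j|].
  by rewrite den_arr // -hW.
exists 1%:M; split=> [|i j|]; first exact: proj_inv0.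
  rewrite /proj_init denE.
  by rewrite den_arr // den_mmap // dD !ltn_ord /= mxE.
rewrite /proj_init denE.
rewrite den_asg ?den_wreg //=.
have -> : sel_rows W set0 = 0 by apply/row_matrixP => i; rewrite rowK inE row0.
by rewrite mxrank0.
Qed.

(** Register 5 addresses the column chosen by the greedy scan, register 6 is the counter of
    [proj]. *)
Lemma proj_step_ok (W : 'M[R]_(K, D)) G d r s (i : 'I_K) :
  (d < 2)%N -> reg s d = D -> reg s 2 = 0%N -> r \in [:: 5; 6]%N ->
  reg s r = i -> holds_proj W G s ->
  holds_proj W (i |: G) (den (proj_step r d) s).
Proof.
move=> d2 dD z hr ri [hW [P [iP hP hc]]].
have b4 : (d == 4) = false by lia.
have b10 : (d == 10) = false by lia.
pose p1 := vmap 12 d (ESum d (emul (ent 10 r 10) (ent 11 10 4))).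
pose p2 := asg 25 (ESum d (emul (ent 12 2 10) (ent 10 r 10))).
pose p3 := mmap 11 d d (esub (ent 11 3 4) (equo (emul (ent 12 2 3) (ent 12 2 4)) (sc 25))).
pose p4 := asg 26 (eadd (sc 26) (EC 1)).
have [s1 e1] : {s1 | s1 = den p1 s} by exists (den p1 s).
have [s2 e2] : {s2 | s2 = den p2 s1} by exists (den p2 s1).
have w1 : wfE level (ESum d (emul (ent 10 r 10) (ent 11 10 4))).
  by rewrite /= d2; move: hr; rewrite !inE => /orP[] /eqP ->.
have s1E (j : 'I_D) : arr s1 12 0 j = pivot W P i 0 j.
  rewrite e1 den_vmap // z dD ltn_ord /= b4 dD mxE; apply: eq_bigr => l _.
  rewrite mxE -hW -hP -ri; congr (arr s 10 _ _ * _).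
  by move: hr; rewrite !inE => /orP[] /eqP ->.
have s1r t : t \in [:: 0; 1; 2; 5; 6]%N -> reg s1 t = reg s t.
  by move=> ht; rewrite e1; apply: den_wreg; move: ht; rewrite !inE => /or4P[/eqP->|/eqP->|/eqP->|/orP[]/eqP->].
have s1a a u w : a != 12 -> arr s1 a u w = arr s a u w.
  by move=> ha; rewrite e1; apply: den_arr; rewrite inE.
have dl : d \in [:: 0; 1; 2; 5; 6]%N by case: d d2 {dD b4 b10 p1 p2 p3 e1 e2 w1 s1E s1r s1a} => [|[|]].
have rl : r \in [:: 0; 1; 2; 5; 6]%N by move: hr; rewrite !inE => /orP[] /eqP ->.
have s2E : arr s2 25 0 0 = pivot_norm W P i.
  rewrite e2 den_asg ?s1r // [LHS]/= s1r // dD /pivot_norm mxE; apply: eq_bigr => l _.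
  rewrite -s1E [_^T _ _]mxE [row _ _ _ _]mxE -hW -ri s1r // z; congr (_ * _).
  rewrite s1a //; congr (arr s 10 _ _).
  by move: hr; rewrite !inE => /orP[] /eqP -> /=; rewrite s1r.
have s2r t : t \in [:: 0; 1; 2; 5; 6]%N -> reg s2 t = reg s t by rewrite e2; exact: s1r.
have s2a a u w : a != 12 -> a != 25 -> arr s2 a u w = arr s a u w.
  by move=> h1 h2; rewrite e2 den_arr ?inE // s1a.
have dE : den (proj_step r d) s =
    if 0 < pivot_norm W P i then den p4 (den p3 s2) else s2.
  by rewrite /proj_step !denE -/p1 -/p2 -e1 -e2 -s2E [eval _ _ _]/= [eval _ (sc 25) _]/= s2r // z.
have [pP rk] := proj_inv_step i iP.
split=> [i' j'|].
  rewrite dE; case: ifP => _; last by rewrite s2a.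
  by rewrite den_arr // den_arr // s2a.
exists (updated_proj W P i); split=> // [u w|]; rewrite dE ?rk /updated_proj.
  case: ifP => bp; last by rewrite s2a.
  rewrite den_arr // den_mmap // s2r // dD !ltn_ord /= s2r // z s2E.
  rewrite !(s2a 11) // hP [in RHS]mxE [X in _ = _ + X]mxE [X in _ = _ - X]mxE.
  rewrite [(_ *m _) u w]mxE big_ord1 [_^T _ _]mxE mulrC.
  by rewrite e2 !den_arr // !s1E.
case: ifP => bp; last by rewrite s2a // addn0.
have z3 : reg (den p3 s2) 2 = 0%N by rewrite den_wreg // s2r.
rewrite den_asg //; set e26 := eval _ _ _.
have -> : e26 = arr (den p3 s2) 26 (reg (den p3 s2) 2) (reg (den p3 s2) 2) + 1.
  by [].
by rewrite z3 den_arr // s2a // hc natrD.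
Qed.

Lemma proj_ok (W : 'M[R]_(K, D)) k d s :
  (k < 2)%N -> (d < 2)%N -> reg s k = K -> reg s d = D -> reg s 2 = 0%N ->
  (forall (i : 'I_K) (j : 'I_D), arr s 10 i j = W i j) ->
  holds_proj W setT (den (proj k d) s).
Proof.
move=> k2 d2 kK dD z hW.
have [s0 e0] : {s0 | s0 = den (proj_init d) s} by exists (den (proj_init d) s).
have h0 := proj_init_ok d2 dD z hW; rewrite -e0 in h0.
rewrite /proj den_seq -e0.
have r0 t : (t < 3)%N -> reg s0 t = reg s t.
  by move=> ht; rewrite e0 den_wreg // !inE; lia.
pose f l s' := den (proj_step 6 d) (set_reg s' 6 l).
rewrite [den _ _]/(set_reg (iter_up (reg s0 k) f s0) 6 (reg s0 k)).
rewrite r0 ?kK; last by lia.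
pose I l s' := [/\ (l <= K)%N, reg s' d = D, reg s' 2 = 0%N &
  holds_proj W [set i : 'I_K | (i < l)%N] s'].
suff [_ _ _ hp] : I K (iter_up K f s0).
  have -> : setT = [set i : 'I_K | (i < K)%N].
    by apply/setP => i; rewrite !inE ltn_ord.
  exact: hp.
apply: (iter_up_ind (P := I)) => [|l s' lK [_ dD' z' hp]].
  split=> //.
  - by rewrite r0 //; lia.
  - by rewrite r0.
have d6 : (d == 6) = false by lia.
split=> //; rewrite /f.
- by rewrite den_wreg /= ?d6 // !inE; lia.
- by rewrite den_wreg.
have -> : [set i : 'I_K | (i < l.+1)%N] = Ordinal lK |: [set i : 'I_K | (i < l)%N].
  by apply/setP => i; rewrite !inE ltnS leq_eqVlt.
by apply: proj_step_ok => //=; rewrite d6.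
Qed.

End ProjectionProgram.

(** * The greedy computation of Delta *)

Section Greedy.
Variables (R : realType) (m n : nat) (A : 'M[int]_(m, n)).
Hypothesis hA : forall j, col j A != 0.
Local Notation a := (column R A).
Local Notation nu j := (norm2 (a j)).
Local Notation Dl := (Delta R A).
Local Notation W := ((Areal R A)^T).
Implicit Types (G B : {set 'I_n}) (s : store R).

Lemma sel_row_cols G : (sel_rows W G :=: (cols (Areal R A) G)^T)%MS.
Proof.
apply/eqmxP/andP; split.
  apply: sel_rows_sub => i iG.
  have -> : row i W = row (enum_rank_in iG i) (cols (Areal R A) G)^T.
    by apply/rowP => j; rewrite !mxE enum_rankK_in.
  exact: row_sub.
apply/row_subP => k.
have -> : row k (cols (Areal R A) G)^T = row (enum_val k) W.
  by apply/rowP => j; rewrite !mxE.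
exact/row_sub_sel/enum_valP.
Qed.

Lemma rank_sel_cols G : \rank (sel_rows W G) = \rank (cols (Areal R A) G).
Proof. by rewrite sel_row_cols mxrank_tr. Qed.

Lemma rank_sel_card G : (\rank (sel_rows W G) <= #|G|)%N.
Proof. by rewrite rank_sel_cols rank_leq_col. Qed.

Definition optimal B :=
  \rank (sel_rows W B) = #|B| /\ \prod_(j in B) nu j = Dl.

Lemma optimal_ge B : \rank (sel_rows W B) = #|B| ->
  Dl <= \prod_(j in B) nu j -> optimal B.
Proof.
move=> rB ge; split=> //; apply/eqP; rewrite eq_le ge andbT.
by apply: (le_bigmax_cond _ (fun B : {set 'I_n} => \prod_(j in B) nu j));
  rewrite -rank_sel_cols rB.
Qed.

Lemma optimal_exists : exists B, optimal B.
Proof.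
have P0 : (#|set0 : {set 'I_n}| == \rank (cols (Areal R A) set0)).
  by rewrite -rank_sel_cols eqn_leq rank_sel_card cards0 leq0n.
have [||B PB DB] := @eq_bigmax _ _ {set 'I_n} 0 set0
   (fun B => #|B| == \rank (cols (Areal R A) B)) (fun B => \prod_(j in B) nu j).
- exact: P0.
- by move=> B _; apply: prodr_ge0 => j _; exact: norm2_ge0.
exists B; split; last by rewrite -DB.
by rewrite rank_sel_cols; apply/esym/eqP.
Qed.

Lemma independent_notin B G b : \rank (sel_rows W B) = #|B| -> G \subset B ->
  b \in B -> b \notin G -> ~~ (row b W <= sel_rows W G)%MS.
Proof.
move=> rB GB bB bG; apply/negP => bs.
have GD : G \subset B :\ b by rewrite subsetD1 GB.
have le : (sel_rows W B <= sel_rows W (B :\ b))%MS.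
  apply: sel_rows_sub => j jB; have [->|jb] := eqVneq j b.
    exact: submx_trans bs (sel_rowsS W GD).
  by apply: row_sub_sel; rewrite !inE jb.
have := leq_trans (mxrankS le) (rank_sel_card _).
by rewrite rB (cardsD1 b B) bB ltnn.
Qed.

(** If [k] lies outside the span of [B] it is added, and a norm at least 1 does not lower the
    product. Otherwise it replaces an element [b] of its expansion that is not in [G]; since [b] was
    a candidate too, its norm is at most that of [k]. *)
Lemma greedy_exchange B G k : optimal B -> G \subset B ->
  ~~ (row k W <= sel_rows W G)%MS ->
  (forall j, ~~ (row j W <= sel_rows W G)%MS -> nu j <= nu k) ->
  exists B', optimal B' /\ k |: G \subset B'.
Proof.
move=> [rB pB] GB kG kmax.
have [kB|kB] := boolP (k \in B); first by exists B; rewrite subUset sub1set kB.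
have [ks|ks] := boolP (row k W <= sel_rows W B)%MS; last first.
  exists (k |: B); split; last exact: setUS.
  apply: optimal_ge; first by rewrite sel_rowsU1 rank_add_row // rB cardsU1 kB.
  by rewrite big_setU1 //= pB ler_peMl ?(nu_ge1 R hA) // ltW // Delta_gt0.
have /submxP [c kE] := ks.
have kE' : row k W = \sum_(b in B) c 0 b *: row b W.
  rewrite kE mulmx_sum_row (bigID (mem B)) /= [X in _ + X]big1 ?addr0.
    by apply: eq_bigr => b bB; rewrite rowK bB.
  by move=> b /negPf bB; rewrite rowK bB scaler0.
have [b bB /andP[bG cb]] : exists2 b, b \in B & (b \notin G) && (c 0 b != 0).
  apply/exists_inP; apply: contraNT kG; rewrite negb_exists_in => /forall_inP h.
  rewrite kE' summx_sub // => b bB; have := h b bB.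
  rewrite negb_and negbK => /orP[bG|/negPn/eqP ->].
    by rewrite scalemx_sub // row_sub_sel.
  by rewrite scale0r sub0mx.
have bs := independent_notin rB GB bB bG.
have kb : k \notin B :\ b by rewrite inE negb_and kB orbT.
pose B' := k |: (B :\ b).
have cB : #|B'| = #|B| by rewrite cardsU1 kb (cardsD1 b B) bB.
exists B'; split; last by rewrite setUS // subsetD1 GB.
apply: optimal_ge.
  apply/eqP; rewrite eqn_leq rank_sel_card cB -rB mxrankS //.
  apply: sel_rows_sub => j jB; have [->|jb] := eqVneq j b; last first.
    by apply: row_sub_sel; rewrite !inE jb jB orbT.
  have -> : row b W = (c 0 b)^-1 *: (row k W - \sum_(j in B :\ b) c 0 j *: row j W).
    by rewrite kE' (big_setD1 b) //= addrK scalerA mulVf // scale1r.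
  rewrite scalemx_sub // addmx_sub //; first by apply: row_sub_sel; rewrite setU11.
  rewrite eqmx_opp summx_sub // => i iB; rewrite scalemx_sub // row_sub_sel //.
  by rewrite inE iB orbT.
rewrite big_setU1 //= -pB (big_setD1 b) //= ler_wpM2r ?kmax //.
by apply: prodr_ge0 => j _; exact: norm2_ge0.
Qed.

Lemma optimal_closed B G : optimal B -> G \subset B ->
  (forall j, (row j W <= sel_rows W G)%MS) -> \prod_(j in G) nu j = Dl.
Proof.
move=> [rB <-] GB cl; suff -> : G = B by [].
apply/eqP; rewrite eqEsubset GB; apply/subsetP => b bB.
by apply: contraT => bG; have := independent_notin rB GB bB bG; rewrite cl.
Qed.

Definition greedy_ready s := [/\ reg s 0 = m, reg s 1 = n, reg s 2 = 0%N,
  forall j : 'I_n, arr s 5 0 j = nu j &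
  forall (j : 'I_n) (i : 'I_m), arr s 10 j i = W j i].

Lemma greedy_scan_ok s P G : greedy_ready s -> proj_inv W G P ->
  (forall i j : 'I_m, arr s 11 i j = P i j) ->
  let s' := den greedy_scan s in
  (arr s' 28 0 0 = 0 /\ forall j, (row j W <= sel_rows W G)%MS) \/
  exists k : 'I_n, [/\ reg s' 5 = k, arr s' 28 0 0 = nu k,
    ~~ (row k W <= sel_rows W G)%MS &
    forall j, ~~ (row j W <= sel_rows W G)%MS -> nu j <= nu k].
Proof.
move=> [r0 r1 z h5 h10] iP hP.
have betaE j : (0 < pivot_norm W P j) = ~~ (row j W <= sel_rows W G)%MS.
  by rewrite -(pivot_norm0 j iP) lt_neqAle eq_sym (pivot_norm_ge0 j iP) andbT.
pose p1 := asg 25 (ESum 0 (ESum 0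
   (emul (emul (ent 10 6 10) (ent 11 10 11)) (ent 10 6 11)))).
pose take := SSeq (asg 28 (ent 5 2 6)) (SIdx 5 6).
pose body := SSeq p1 (SIf (EC 0) (sc 25)
   (SIf (sc 28) (ent 5 2 6) take SSkip) SSkip).
have [s0 e0] : {s0 | s0 = den (asg 28 (EC 0)) s} by exists (den (asg 28 (EC 0)) s).
have r0' t : (t < 3)%N -> reg s0 t = reg s t by move=> _; rewrite e0 den_wreg.
pose f l s' := den body (set_reg s' 6 l).
pose Q l s' := (arr s' 28 0 0 = 0 /\
     forall j : 'I_n, (j < l)%N -> ~~ (0 < pivot_norm W P j)) \/
  exists k : 'I_n, [/\ reg s' 5 = k, arr s' 28 0 0 = nu k,
    0 < pivot_norm W P k &
    forall j : 'I_n, (j < l)%N -> 0 < pivot_norm W P j -> nu j <= nu k].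
pose I l s' := [/\ (forall t, (t < 3)%N -> reg s' t = reg s t),
  (forall b u v, b \notin [:: 25; 28]%N -> arr s' b u v = arr s b u v) & Q l s'].
have : I n (iter_up n f s0).
  apply: (iter_up_ind (P := I)) => [|l s' ln [hr ha hQ]].
    split=> [t ht|b u v|]; first exact: r0'.
      by rewrite !inE negb_or => /andP[_ b28]; rewrite e0 den_arr ?inE.
    by left; split=> //; rewrite e0 den_asg.
  have [s1 es1] : {s1 | s1 = den p1 (set_reg s' 6 l)} by exists (den p1 (set_reg s' 6 l)).
  have fE : f l s' = den (SIf (EC 0) (sc 25) (SIf (sc 28) (ent 5 2 6) take SSkip) SSkip) s1.
    by rewrite /f /body den_seq es1.
  have r6 : reg s1 6 = l by rewrite es1 den_wreg.
  have hr1 t : (t < 3)%N -> reg s1 t = reg s t.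
    by move=> ht; rewrite es1 den_wreg //= ltn_eqF ?hr // (ltn_trans ht).
  have ha1 b u v : b \notin [:: 25]%N -> arr s1 b u v = arr s' b u v.
    by move=> hb; rewrite es1 den_arr.
  have b25 : arr s1 25 0 0 = pivot_norm W P (Ordinal ln).
    rewrite es1 den_asg /=; last by rewrite hr.
    rewrite hr // r0 /pivot_norm mxE exchange_big; apply: eq_bigr => v _ /=.
    rewrite [_^T _ _]mxE [row _ _ _ _]mxE [pivot _ _ _ _ _]mxE mulr_suml.
    apply: eq_bigr => u _; rewrite [row _ _ _ _]mxE -h10 -h10 -hP.
    by rewrite !ha.
  have ex2 c : c != 25 -> forall u v, arr s1 c u v = arr s' c u v.
    by move=> hc u v; apply: ha1; rewrite inE.
  have s5 : arr s1 5 0 l = nu (Ordinal ln) by rewrite ex2 // ha // -h5.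
  rewrite fE !den_if [eval _ (EC 0) _]/= [eval _ (sc 25) _]/= [eval _ (sc 28) _]/=
    [eval _ (ent 5 2 6) _]/= hr1 // z b25 ex2 // r6 s5.
  have lastj (j : 'I_n) : (j < l.+1)%N -> (j < l)%N \/ j = Ordinal ln.
    by rewrite ltnS leq_eqVlt => /orP[/eqP e|]; [right; exact: val_inj|left].
  case: ifP => bp; last first.
    split=> [t ht|b u v hb2|]; first exact: hr1.
      by rewrite ha1 ?ha //; move: hb2; rewrite !inE; case: (b == 25).
    case: hQ => [[h28 hn]|[k [k5 k28 kp kn]]]; [left|right].
      split; first by rewrite ex2.
      by move=> j /lastj [/hn //|->]; rewrite bp.
    exists k; split=> //; rewrite ?ex2 //.
      by rewrite es1 den_wreg.
    by move=> j /lastj [/kn //|-> ]; rewrite bp.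
  case: ifP => better; last first.
    split=> [t ht|b u v hb2|]; first exact: hr1.
      by rewrite ha1 ?ha //; move: hb2; rewrite !inE; case: (b == 25).
    case: hQ => [[h28 hn]|[k [k5 k28 kp kn]]].
      by move: better; rewrite h28 (nu_gt0 R hA).
    right; exists k; split=> //; rewrite ?ex2 //.
      by rewrite es1 den_wreg.
    move=> j /lastj [/kn //|-> _]; rewrite -k28.
    by rewrite leNgt; apply: negbT.
  have nup := nu_gt0 R hA (Ordinal ln).
  split=> [t ht|b u v hb2|].
  - rewrite den_wreg ?hr1 //; rewrite !inE; lia.
  - have [h25 h28] : b != 25 /\ b != 28 by move: hb2; rewrite !inE negb_or => /andP.
    by rewrite den_arr ?inE // ha1 ?inE // ha.
  right; exists (Ordinal ln); split=> //=.
  - by rewrite hr1 // z r6 s5.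
  move=> j /lastj [jl bj|-> _ //].
  case: hQ => [[h28 hn]|[k [k5 k28 kp kn]]]; first by have := hn j jl; rewrite bj.
  by apply: (le_trans (kn j jl bj)); rewrite -k28; exact: ltW.
have -> : iter_up n f s0 = iter_up (reg s0 1) f s0 by rewrite r0' // r1.
move=> [_ _ hQ]; rewrite /greedy_scan den_seq -e0.
case: hQ => [[h28 hn]|[k [k5 k28 kp kn]]]; [left|right].
  split=> [//|j]; apply: negbNE; rewrite -betaE; exact: hn.
by exists k; split=> //; [rewrite -betaE|move=> j; rewrite -betaE => bj; exact: kn].
Qed.

Definition greedy_inv G s :=
  [/\ greedy_ready s, exists2 B, optimal B & G \subset B, holds_proj W G s &
    arr s 31 0 0 = \prod_(j in G) nu j].

Lemma greedy_round_ok s G : greedy_inv G s ->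
  let s' := den greedy_round s in
  (greedy_inv G s' /\ forall j, (row j W <= sel_rows W G)%MS) \/
  exists2 k, k \notin G & greedy_inv (k |: G) s'.
Proof.
move=> [ready [B oB GB] [h10 [P [iP hP hc]]] h31].
have [r0 r1 z h5 h10'] := ready.
have [s1 e1] : {s1 | s1 = den greedy_scan s} by exists (den greedy_scan s).
have scan := greedy_scan_ok ready iP hP; cbv zeta in scan; rewrite -e1 in scan.
have hr t : (t < 3)%N -> reg s1 t = reg s t.
  by move=> ht; rewrite e1 den_wreg // !inE; lia.
have ha b u v : b != 25 -> b != 28 -> arr s1 b u v = arr s b u v.
  by move=> b25 b28; rewrite e1 den_arr // !inE (negPf b25) (negPf b28).
have ready1 : greedy_ready s1.
  by split; rewrite ?hr //; move=> *; rewrite ha.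
have hp1 : holds_proj W G s1.
  split=> [i j|]; first by rewrite ha.
  by exists P; split=> // [i j|]; rewrite ha.
rewrite /greedy_round den_seq -e1 den_if [eval _ (EC 0) _]/= [eval _ (sc 28) _]/= hr // z.
case: scan => [[h28 cl]|[k [k5 k28 kG kmax]]].
  left; rewrite h28 ltxx [den SSkip _]/=; split=> //; split=> //; first by exists B.
  by rewrite ha.
right; exists k.
  by apply: contra kG => kG; exact: row_sub_sel.
rewrite k28 (nu_gt0 R hA) den_seq.
have [s2 e2] : {s2 | s2 = den (proj_step 5 0) s1} by exists (den (proj_step 5 0) s1).
have hr2 t : (t < 3)%N -> reg s2 t = reg s t.
  by move=> ht; rewrite e2 den_wreg ?hr // !inE; lia.
have ha2 b u v : b \notin [:: 12; 25; 11; 26]%N -> arr s2 b u v = arr s1 b u v.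
  by move=> hb; rewrite e2 den_arr.
have hp2 : holds_proj W (k |: G) s2.
  by rewrite e2; apply: proj_step_ok => //; rewrite ?hr.
rewrite -e2.
have z2 : reg s2 2 = 0%N by rewrite hr2.
have [B' [oB' GB']] := greedy_exchange oB GB kG kmax.
have ha3 b u v : b != 31 -> arr (den (asg 31 (emul (sc 31) (sc 28))) s2) b u v = arr s2 b u v.
  by move=> hb; rewrite den_arr ?inE.
have kG' : k \notin G by apply: contra kG => kG; exact: row_sub_sel.
split.
- split; rewrite ?den_wreg ?hr2 //.
    by move=> j; rewrite ha3 // ha2 // ha.
  by move=> j i; rewrite ha3 // ha2 // ha.
- by exists B'.
- have [g10 [P2 [iP2 hP2 hc2]]] := hp2; split=> [i j|]; first by rewrite ha3.
  by exists P2; split=> // [i j|]; rewrite ha3.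
rewrite den_asg // [LHS]/= z2 !ha2 // ha // h31 k28 big_setU1 //=.
by rewrite mulrC.
Qed.

Lemma greedy_ok s : reg s 0 = m -> reg s 1 = n -> reg s 2 = 0%N ->
  (forall j : 'I_n, arr s 5 0 j = nu j) ->
  (forall (i : 'I_m) (j : 'I_n), arr s 0 i j = (A i j)%:~R) ->
  arr s 32 0 0 = m%:R -> arr (den greedy s) 22 0 0 = (theta R A)^-1.
Proof.
move=> r0 r1 z h5 h0 h32.
pose p1 := mmap 10 1 0 (ent 0 4 3).
have [s1 e1] : {s1 | s1 = den p1 s} by exists (den p1 s).
have [s2 e2] : {s2 | s2 = den (proj_init 0) s1} by exists (den (proj_init 0) s1).
have [s3 e3] : {s3 | s3 = den (asg 31 (EC 1)) s2} by exists (den (asg 31 (EC 1)) s2).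
have hr1 t : (t < 3)%N -> reg s1 t = reg s t.
  by move=> ht; rewrite e1 den_wreg // !inE; lia.
have hr2 t : (t < 3)%N -> reg s2 t = reg s t.
  by move=> ht; rewrite e2 den_wreg ?hr1 // !inE; lia.
have hr3 t : (t < 3)%N -> reg s3 t = reg s t.
  by move=> ht; rewrite e3 den_wreg ?hr2.
have h10 (j : 'I_n) (i : 'I_m) : arr s1 10 j i = W j i.
  by rewrite e1 den_mmap //= r0 r1 !ltn_ord /= h0 !mxE.
have hp2 : holds_proj W set0 s2 by rewrite e2; apply: proj_init_ok; rewrite ?hr1.
have a3 b u v : b \notin [:: 10; 11; 26; 31]%N -> arr s3 b u v = arr s b u v.
  rewrite !inE !negb_or => /and4P[b1 b2 b3 b4].
  rewrite e3 den_arr ?inE // e2 den_arr ?inE ?negb_or ?b2 //.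
  by rewrite e1 den_arr ?inE.
have a32 b u v : b != 31 -> arr s3 b u v = arr s2 b u v.
  by move=> hb; rewrite e3 den_arr ?inE.
have a21 u v : arr s2 10 u v = arr s1 10 u v by rewrite e2 den_arr.
have inv0 : greedy_inv set0 s3.
  split.
  - by split; rewrite ?hr3 // => *; [rewrite a3|rewrite a32 // a21 h10].
  - by have [B oB] := optimal_exists; exists B => //; exact: sub0set.
  - have [g10 [P [iP hP hc]]] := hp2; split=> [i j|]; first by rewrite a32.
    by exists P; split=> // [i j|]; rewrite a32.
  - by rewrite big_set0 e3 den_asg ?hr2.
pose f l s' := den greedy_round (set_reg s' 7 l).
have iset l s' G : greedy_inv G s' -> greedy_inv G (set_reg s' 7 l) by [].
(* Until the chosen columns span everything each round adds one, so n rounds suffice. *)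
pose I l s' := arr s' 32 0 0 = m%:R /\ exists G, greedy_inv G s' /\
  (#|G| = l \/ forall j, (row j W <= sel_rows W G)%MS).
have : I n (iter_up n f s3).
  apply: (iter_up_ind (P := I)) => [|l s' ln [s32 [G [iG hG]]]].
    split; first by rewrite a3.
    by exists set0; split=> //; left; rewrite cards0.
  split; first by rewrite /f den_arr.
  case: (greedy_round_ok (iset l s' G iG)) => [[iG' cl]|[k kG iG']].
    by exists G; split=> //; right.
  exists (k |: G); split=> //; case: hG => [cG|cl]; [left|right].
    by rewrite cardsU1 kG cG.
  by move=> j; apply: submx_trans (cl j) _; apply: sel_rowsS; exact: subsetUr.
have [s4 e4] : {s4 | s4 = set_reg (iter_up n f s3) 7 n}.
  by exists (set_reg (iter_up n f s3) 7 n).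
move=> [s32 [G [[[_ _ z4 _ _] [B oB GB] _ h31] hG]]].
have cl j : (row j W <= sel_rows W G)%MS.
  case: hG => // cG; apply: row_sub_sel.
  have -> : G = setT by apply/eqP; rewrite eqEcard subsetT cardsT card_ord cG leqnn.
  by rewrite inE.
have -> : den greedy s = den (asg 22 (emul (emul (sc 32) (sc 32)) (emul (sc 31) (sc 31)))) s4.
  rewrite /greedy !den_seqs_cons den_seqs_nil -/p1 -e1 -e2 -e3 e4.
  by congr den; rewrite -[in RHS](etrans (hr3 1%N isT) r1).
have z4' : reg s4 2 = 0%N by rewrite e4.
rewrite den_asg // [LHS]/= z4' e4 [arr _ _ _ _]/= s32 h31 (optimal_closed oB GB cl).
by rewrite theta_inv; ring.
Qed.

End Greedy.

(** Names an intermediate store opaquely, so that simplification does not unfold the whole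
    computation behind it. *)
Ltac freeze s' e p s :=
  pose proof (exist (fun s' => s' = den p s) (den p s) erefl) as [s' e].

(** * Stores that represent a state of the algorithm *)

Section Simulation.
Variables (R : realType) (m n : nat) (A : 'M[int]_(m, n)).
Hypothesis hA : forall j, col j A != 0.
Local Notation a := (column R A).
Local Notation nu j := (norm2 (a j)).
Local Notation h j := (normalize (a j)).
Local Notation rk S := (\rank (cols (Areal R A) S)).
Local Notation W := ((Areal R A)^T).
Implicit Types (s : store R) (st : state R m n) (S : {set 'I_n}) (Q : 'M[R]_m).

Record consts s : Prop := Consts {
  reg_m : reg s 0 = m;
  reg_n : reg s 1 = n;
  reg_0 : reg s 2 = 0%N;
  arr_A : forall (i : 'I_m) (j : 'I_n), arr s 0 i j = (A i j)%:~R;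
  arr_nu : forall j : 'I_n, arr s 5 0 j = nu j;
  arr_eps : arr s 20 0 0 = epsilon R m;
  arr_kap : arr s 21 0 0 = kappa R m;
  arr_th : arr s 22 0 0 = (theta R A)^-1;
  arr_zero : arr s 40 0 0 = 0 }.

Definition set_array s b S := forall j : 'I_n, arr s b 0 j = (j \in S)%:R.

Definition gram_array s Q :=
  forall i j : 'I_n, arr s 6 i j = dotQ Q (a i) (a j).

(** Entries of x, Pi and Pi x are constrained on S only; [enum_val] translates between indices of
    the submatrix and column indices, as the program keeps all arrays at full size. *)
Record simulates s st : Prop := Simulates {
  sim_S : set_array s 2 (st_S st);
  sim_T : set_array s 3 (st_T st);
  sim_x : forall j : 'I_n, j \in st_S st -> arr s 1 0 j = st_x st j 0;
  sim_F : gram_array s (st_Q st);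
  sim_p : forall j : 'I_n, arr s 7 0 j = dotQ (st_Q st) (a j) (st_y st);
  sim_s : arr s 23 0 0 = dotQ (st_Q st) (st_y st) (st_y st);
  sim_Pi : forall k l : 'I_#|st_S st|,
    arr s 9 (enum_val k) (enum_val l) = Pi_of R A (st_S st) k l;
  sim_w : forall k : 'I_#|st_S st|, arr s 8 0 (enum_val k) = Pix A st k 0;
  sim_rk : arr s 24 0 0 = (rk (st_S st))%:R }.

Lemma consts_den p s : consts s ->
  ~~ has [in warr p] [:: 0; 5; 20; 21; 22; 40]%N ->
  ~~ has [in wreg p] [:: 0; 1; 2]%N -> consts (den p s).
Proof.
move=> [r0 r1 r2 c1 c2 c3 c4 c5 c6] /hasPn ha /hasPn hr.
have aE b u v : b \in [:: 0; 5; 20; 21; 22; 40]%N -> arr (den p s) b u v = arr s b u v.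
  by move=> hb; apply: den_arr; exact: ha.
have rE t : t \in [:: 0; 1; 2]%N -> reg (den p s) t = reg s t.
  by move=> ht; apply: den_wreg; exact: hr.
by split; rewrite ?rE //; move=> *; rewrite aE.
Qed.

Lemma lt0_mem (b : bool) : (0 < b%:R :> R) = b.
Proof. by case: b; rewrite ?ltr01 ?ltxx. Qed.

Lemma sum_on_S s S (F : nat -> R) : set_array s 2 S ->
  \sum_(l < n) (if 0%:R < arr s 2 0 l then F l else 0%:R) =
  \sum_(j in S) F (j : 'I_n).
Proof.
move=> hS; rewrite [RHS]big_mkcond; apply: eq_bigr => j _.
by rewrite hS lt0_mem.
Qed.

Lemma constants_ok s : reg s 0 = m -> reg s 1 = n -> reg s 2 = 0%N ->
  (forall (i : 'I_m) (j : 'I_n), arr s 0 i j = (A i j)%:~R) ->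
  let s' := den constants s in
  [/\ [/\ reg s' 0 = m, reg s' 1 = n & reg s' 2 = 0%N],
      (forall j : 'I_n, arr s' 5 0 j = nu j),
      arr s' 20 0 0 = epsilon R m, arr s' 21 0 0 = kappa R m &
      arr s' 32 0 0 = m%:R /\ gram_array s' 1%:M].
Proof.
move=> r0 r1 r2 h0 s'.
have hr t : (t < 3)%N -> reg s' t = reg s t.
  by move=> ht; rewrite /s' den_wreg // !inE; lia.
pose p1 := vmap 5 1 (ES (ESum 0 (emul (ent 0 10 4) (ent 0 10 4)))).
freeze s1 e1 p1 s.
pose p2 := asg 32 (ESum 0 (EC 1)).
freeze s2 e2 p2 s1.
pose p3 := asg 20 (equo (EC 1) (emul (EC 11) (sc 32))).
freeze s3 e3 p3 s2.
pose p4 := asg 21 (equo (EC 1) (emul (eadd (EC 1) (emul (EC 3) (sc 20)))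
                            (eadd (EC 1) (emul (EC 3) (sc 20))))).
freeze s4 e4 p4 s3.
pose p5 := mmap 6 1 1 (ESum 0 (emul (ent 0 10 3) (ent 0 10 4))).
freeze s5 e5 p5 s4.
have sE : s' = s5.
  by rewrite /s' /constants !den_seqs_cons den_seqs_nil -/p1 -/p2 -/p3 -/p4 -/p5
    -e1 -e2 -e3 -e4 -e5.
have hr1 t : (t < 3)%N -> reg s1 t = reg s t.
  by move=> ht; rewrite e1 den_wreg // !inE; lia.
have hr2 t : (t < 3)%N -> reg s2 t = reg s t by move=> ht; rewrite e2 den_wreg // hr1.
have hr3 t : (t < 3)%N -> reg s3 t = reg s t by move=> ht; rewrite e3 den_wreg // hr2.
have hr4 t : (t < 3)%N -> reg s4 t = reg s t by move=> ht; rewrite e4 den_wreg // hr3.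
have nuE (j : 'I_n) : arr s1 5 0 j = nu j.
  rewrite e1 den_vmap // r2 r1 ltn_ord /= r0 /norm2; congr Num.sqrt.
  by apply: eq_bigr => i _; rewrite h0 columnE expr2.
have mE : arr s2 32 0 0 = m%:R.
  rewrite e2 den_asg ?hr1 // [LHS]/= hr1 // r0.
  by rewrite sumr_const card_ord.
have eE : arr s3 20 0 0 = epsilon R m.
  by rewrite e3 den_asg ?hr2 // [LHS]/= hr2 // r2 mE mul1r.
have kE : arr s4 21 0 0 = kappa R m.
  by rewrite e4 den_asg ?hr3 // [LHS]/= hr3 // r2 eE mul1r -expr2.
rewrite !hr //; split=> //; rewrite ?sE.
- move=> j; rewrite e5 den_arr ?inE // e4 den_arr ?inE // e3 den_arr ?inE //.
  by rewrite e2 den_arr ?inE.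
- by rewrite e5 den_arr ?inE // e4 den_arr ?inE.
- by rewrite e5 den_arr ?inE.
split.
  by rewrite e5 den_arr ?inE // e4 den_arr ?inE // e3 den_arr ?inE.
move=> i j; rewrite e5 den_mmap // !hr4 // r1 !ltn_ord /= hr4 // r0 dotQ1E.
apply: eq_bigr => l _; rewrite !columnE.
rewrite e4 !den_arr ?inE // e3 !den_arr ?inE // e2 !den_arr ?inE //.
by rewrite e1 !den_arr ?inE // !h0.
Qed.

Lemma unit_rows_cols S (X : 'M[R]_(m, n)) :
  (forall i j, X i j = if j \in S then h j i 0 else 0) ->
  X^T = sel_rows (unit_rows R A) S.
Proof.
move=> hX; apply/row_matrixP => j; rewrite rowK; apply/rowP => i.
by rewrite !mxE hX; case: ifP => _; rewrite !mxE.
Qed.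

Lemma rank_unit_cols S (X : 'M[R]_(m, n)) :
  (forall i j, X i j = if j \in S then h j i 0 else 0) -> \rank X = rk S.
Proof.
move=> /unit_rows_cols XE; rewrite -mxrank_tr XE -[RHS]mxrank_tr.
apply/eqmx_rank/andP; split.
  by apply: sel_rows_sub => j; exact: unit_row_sub_cols.
by apply: (cols_sub hA) => j; exact: row_sub_sel.
Qed.

(** The zero columns split off: the kernel of [X] is the kernel of the columns in S plus the
    coordinate space outside S. The S-block of its projection thus satisfies [is_ker_proj], and
    uniqueness identifies it. *)
Lemma Pi_of_restrict S (X : 'M[R]_(m, n)) P :
  (forall i j, X i j = if j \in S then h j i 0 else 0) ->
  proj_inv X setT P ->
  forall k l, P (enum_val k) (enum_val l) = Pi_of R A S k l.
Proof.
move=> hX [sP XP /submxP [Y YE]] k l.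
rewrite sel_rowsT in XP YE.
pose e (k : 'I_#|S|) : 'I_n := enum_val k.
have -> : P (enum_val k) (enum_val l) = mxsub e e P k l by rewrite mxE.
have BE i t : hat_cols R A S i t = X i (e t).
  by rewrite hat_colsE hX enum_valP.
congr (fun_of_matrix _ k l); apply: is_ker_proj_unique (is_ker_projP _).
split.
- apply/matrixP => i t; rewrite !mxE; have /matrixP/(_ i (e t)) := XP.
  rewrite !mxE => z0; rewrite -[RHS]z0.
  rewrite [RHS](bigID (mem S)) /= [X in _ = _ + X]big1 ?addr0.
    by rewrite [RHS]big_enum_val; apply: eq_bigr => u _; rewrite BE !mxE.
  by move=> j jS; rewrite hX (negPf jS) mul0r.
- by apply/matrixP => i t; rewrite -[in RHS]sP !mxE.
exists ((rowsub e Y)^T).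
have eqP1 : 1%:M - mxsub e e P = rowsub e Y *m hat_cols R A S.
  apply/matrixP => i t; have /matrixP/(_ (e i) (e t)) := YE.
  rewrite !mxE (inj_eq enum_val_inj) => ->.
  by apply: eq_bigr => u _; rewrite BE mxE.
by rewrite -trmx_mul -eqP1 linearB /= trmx1 trmx_mxsub sP.
Qed.

Lemma restart_vectors_ok s S Q y : consts s -> set_array s 2 S ->
  gram_array s Q -> y = \sum_(j in S) h j ->
  let s' := den restart_vectors s in
  [/\ set_array s' 3 set0, (forall j : 'I_n, arr s' 1 0 j = 1),
      (forall j : 'I_n, arr s' 7 0 j = dotQ Q (a j) y) &
      arr s' 23 0 0 = dotQ Q y y].
Proof.
move=> cs hS hF yE s'.
pose p1 := vmap 3 1 (EC 0); freeze s1 e1 p1 s.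
pose p2 := vmap 1 1 (EC 1); freeze s2 e2 p2 s1.
pose p3 := vmap 7 1 (ESum 1 (on_S 10 (equo (ent 6 4 10) (ent 5 2 10)))).
freeze s3 e3 p3 s2.
pose p4 := asg 23 (ESum 1 (on_S 10 (equo (ent 7 2 10) (ent 5 2 10)))).
freeze s4 e4 p4 s3.
have sE : s' = s4.
  by rewrite /s' /restart_vectors !den_seqs_cons den_seqs_nil -/p1 -/p2 -/p3 -/p4
    -e1 -e2 -e3 -e4.
have c1 : consts s1 by rewrite e1; exact: consts_den.
have c2 : consts s2 by rewrite e2; exact: consts_den.
have c3 : consts s3 by rewrite e3; exact: consts_den.
have a2 b u v : b != 3 -> b != 1 -> arr s2 b u v = arr s b u v.
  by move=> b3 b1; rewrite e2 den_arr ?inE // e1 den_arr ?inE.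
have S2 : set_array s2 2 S by move=> j; rewrite a2.
have S3 : set_array s3 2 S by move=> j; rewrite e3 den_arr.
have pE (j : 'I_n) : arr s3 7 0 j = dotQ Q (a j) y.
  rewrite e3 den_vmap // (reg_0 c2) (reg_n c2) ltn_ord /= (reg_n c2) (reg_0 c2).
  rewrite (sum_on_S (fun l => arr s2 6 j l / arr s2 5 0 l) S2) yE dotQ_sumr.
  apply: eq_bigr => l _; rewrite (arr_nu c2) a2 // hF dotQZr.
  by rewrite mulrC.
split; rewrite ?sE.
- move=> j; rewrite e4 den_arr ?inE // e3 den_arr ?inE // e2 den_arr ?inE //.
  by rewrite e1 den_vmap // (reg_0 cs) (reg_n cs) ltn_ord.
- move=> j; rewrite e4 den_arr ?inE // e3 den_arr ?inE // e2 den_vmap //.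
  by rewrite (reg_0 c1) (reg_n c1) ltn_ord.
- by move=> j; rewrite e4 den_arr ?inE.
rewrite e4 den_asg ?(reg_0 c3) // [LHS]/= (reg_n c3) (reg_0 c3).
rewrite (sum_on_S (fun l => arr s3 7 0 l / arr s3 5 0 l) S3).
rewrite {1}yE dotQ_suml; apply: eq_bigr => l _.
by rewrite pE (arr_nu c3) dotQZl mulrC.
Qed.

Lemma restart_ok s S Q : consts s -> set_array s 2 S -> gram_array s Q ->
  simulates (den restart_stmt s) (restart A S Q).
Proof.
move=> cs hS hF.
have yE : st_y (restart A S Q) = \sum_(j in S) h j.
  rewrite /= hat_cols_entries; apply: eq_bigr => j _.
  by rewrite mxE scale1r.
have [hT hx hp hs] := restart_vectors_ok cs hS hF yE.
move: hT hx hp hs; freeze s1 e1 restart_vectors s; rewrite -e1 => hT hx hp hs.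
have c1 : consts s1 by rewrite e1; exact: consts_den.
have S1 : set_array s1 2 S by move=> j; rewrite e1 den_arr.
have F1 : gram_array s1 Q by move=> i j; rewrite e1 den_arr.
pose X : 'M[R]_(m, n) := \matrix_(i, j) (if j \in S then h j i 0 else 0).
have XE i j : X i j = if j \in S then h j i 0 else 0 by rewrite mxE.
pose p2 := mmap 10 0 1 (on_S 4 (equo (ent 0 3 4) (ent 5 2 4))).
freeze s2 e2 p2 s1.
have c2 : consts s2 by rewrite e2; exact: consts_den.
have h10 (i : 'I_m) (j : 'I_n) : arr s2 10 i j = X i j.
  rewrite e2 den_mmap // (reg_m c1) (reg_n c1) !ltn_ord /= (reg_0 c1) S1 lt0_mem.
  rewrite XE; case: ifP => // _; rewrite (arr_A c1) (arr_nu c1).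
  by rewrite [h j]/normalize mxE columnE mulrC.
freeze s3 e3 (proj 0 1) s2.
have [_ [P [iP hP hc]]] : holds_proj X setT s3.
  by rewrite e3; apply: proj_ok; rewrite ?(reg_m c2) ?(reg_n c2) ?(reg_0 c2).
have c3 : consts s3 by rewrite e3; exact: consts_den.
freeze s4 e4 (mmap 9 1 1 (ent 11 3 4)) s3.
have c4 : consts s4 by rewrite e4; exact: consts_den.
have h9 (u v : 'I_n) : arr s4 9 u v = P u v.
  by rewrite e4 den_mmap // (reg_n c3) !ltn_ord /= hP.
pose p5 := vmap 8 1 (ESum 1 (emul (ent 9 4 10) (on_S 10 (ent 1 2 10)))).
freeze s5 e5 p5 s4.
have c5 : consts s5 by rewrite e5; exact: consts_den.
freeze s6 e6 (asg 24 (sc 26)) s5.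
have sE : den restart_stmt s = s6.
  by rewrite /restart_stmt den_seq -e1 /restart_projection !den_seqs_cons
   den_seqs_nil -/p2 -e2 -e3 -e4 -/p5 -e5 -e6.
have a41 b u v : b \notin [:: 10; 12; 25; 11; 26; 9]%N -> arr s4 b u v = arr s1 b u v.
  rewrite !inE !negb_or => /and5P[b1 b2 b3 b4 /andP[b5 b6]].
  rewrite e4 den_arr ?inE // e3 den_arr; last by rewrite /= !inE !negb_or b2 b3 b4 b5.
  by rewrite e2 den_arr ?inE.
have a61 b u v : b \notin [:: 10; 12; 25; 11; 26; 9; 8; 24]%N -> arr s6 b u v = arr s1 b u v.
  rewrite !inE !negb_or => /and5P[b1 b2 b3 b4 /and4P[b5 b6 b7 b8]].
  rewrite e6 den_arr ?inE // e5 den_arr ?inE // a41 //.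
  by rewrite !inE !negb_or b1 b2 b3 b4 b5 b6.
have S4 : set_array s4 2 S by move=> j; rewrite a41.
have PiE (k l : 'I_#|S|) : P (enum_val k) (enum_val l) = Pi_of R A S k l.
  exact: Pi_of_restrict XE iP k l.
rewrite sE; split=> /=.
- by move=> j; rewrite a61 ?S1.
- by move=> j; rewrite a61 ?hT.
- by move=> j _; rewrite a61 ?hx // mxE.
- by move=> i j; rewrite a61 ?F1.
- by move=> j; rewrite a61 ?hp.
- by rewrite a61 ?hs.
- move=> k l; rewrite e6 den_arr ?inE // e5 den_arr ?inE // h9.
  exact: PiE.
- move=> k; rewrite e6 den_arr ?inE // e5 den_vmap // (reg_0 c4) (reg_n c4).
  rewrite ltn_ord /= (reg_n c4) (reg_0 c4) /Pix mxE.
  have eqF (l : 'I_n) : arr s4 9 (enum_val k) l *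
      (if 0%:R < arr s4 2 0 l then arr s4 1 0 l else 0%:R) =
      (if l \in S then P (enum_val k) l else 0).
    rewrite h9 S4 lt0_mem a41 // hx; case: ifP => _; rewrite ?mulr1 ?mulr0 //.
  rewrite (eq_bigr _ (fun l _ => eqF l)) -big_mkcond big_enum_val /=.
  by apply: eq_bigr => l _; rewrite PiE !mxE mulr1.
- rewrite e6 den_asg ?(reg_0 c5) // [LHS]/= (reg_0 c5) e5 den_arr ?inE //.
  by rewrite e4 den_arr ?inE // hc sel_rowsT (rank_unit_cols XE).
Qed.

End Simulation.

(** * Termination test, choice of the column, update *)

Section Steps.
Variables (R : realType) (m n : nat) (A : 'M[int]_(m, n)).
Hypothesis hA : forall j, col j A != 0.
Hypothesis n_gt0 : (0 < n)%N.
Local Notation a := (column R A).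
Local Notation nu j := (norm2 (a j)).
Local Notation h j := (normalize (a j)).
Local Notation rk S := (\rank (cols (Areal R A) S)).
Implicit Types (s : store R) (st : state R m n) (S : {set 'I_n}) (Q : 'M[R]_m).

Lemma sim_den p s st : simulates A s st ->
  ~~ has [in warr p] [:: 1; 2; 3; 6; 7; 8; 9; 23; 24]%N -> simulates A (den p s) st.
Proof.
move=> [r1 r2 r3 r4 r5 r6 r7 r8 r9] /hasPn ha.
have aE b u v : b \in [:: 1; 2; 3; 6; 7; 8; 9; 23; 24]%N ->
    arr (den p s) b u v = arr s b u v.
  by move=> hb; apply: den_arr; exact: ha.
split.
- by move=> j; rewrite aE.
- by move=> j; rewrite aE.
- by move=> j jS; rewrite aE // r3.
- by move=> i j; rewrite aE.
- by move=> j; rewrite aE.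
- by rewrite aE.
- by move=> k l; rewrite aE.
- by move=> k; rewrite aE.
- by rewrite aE.
Qed.

Lemma finished_positive st : finished A st -> positive_Pix A st.
Proof.
case=> // S0 k; exfalso; have := ltn_ord k.
by rewrite [X in (_ < X)%N](_ : _ = 0%N) // S0 cards0.
Qed.

(** The count of nonpositive entries ranges over S and is 0 when S is empty, so one comparison
    covers both ways of being finished. *)
Lemma check_ok s st : consts A s -> simulates A s st ->
  let s' := den check_stmt s in
  [/\ consts A s', simulates A s' st &
   finished A st <-> ~~ (0 < arr s' 27 0 0)].
Proof.
move=> cs rs s'; split; [exact: consts_den|exact: sim_den|].
have -> : arr s' 27 0 0 = \sum_(j in st_S st) (if 0 < arr s 8 0 j then 0 else 1).
  rewrite den_asg ?(reg_0 cs) // [LHS]/= (reg_n cs) (reg_0 cs).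
  exact: (sum_on_S (fun l => if 0%:R < arr s 8 0 l then 0 else 1) (sim_S rs)).
have t0 (j : 'I_n) : 0 <= (if 0 < arr s 8 0 j then 0 else 1 : R) by case: ifP.
rewrite -leNgt le_eqVlt ltNge sumr_ge0 // orbF psumr_eq0 //.
apply: rwP; apply: (iffP allP) => [al|fin j _].
  right=> k; rewrite -(sim_w rs).
  have := al (enum_val k) (mem_index_enum _); rewrite enum_valP /=.
  by case: ifP => //; rewrite oner_eq0.
apply/implyP => jS; have := finished_positive fin (enum_rank_in jS j).
by rewrite -(sim_w rs) enum_rankK_in // => ->.
Qed.

Lemma normQ_arr s st j : simulates A s st ->
  Num.sqrt (arr s 6 (j : 'I_n) j) = normQ (st_Q st) (a j).
Proof. by move=> rs; rewrite (sim_F rs). Qed.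

Lemma argmin_ok s st : consts A s -> simulates A s st -> ~ finished A st ->
  let s' := den argmin_stmt s in
  exists k : 'I_n, [/\ consts A s', simulates A s' st, reg s' 5 = k, is_argmin A st k &
    (arr s' 34 0 0 < arr s' 35 0 0) = update_test A st k].
Proof.
move=> cs rs nf s'.
pose ratio j := dotQ (st_Q st) (a j) (st_y st) / normQ (st_Q st) (a j).
freeze s1 e1 (asg 29 (EC 0)) s.
pose f l s' := den argmin_step (set_reg s' 6 l).
(* Scalar 29 records whether a candidate has been met, which keeps stale contents of scalar 28 out
   of the comparison. *)
pose Q l s' := (arr s' 29 0 0 = 0 /\ forall j : 'I_n, (j < l)%N -> j \notin st_S st)
  \/ (arr s' 29 0 0 = 1 /\ exists k : 'I_n, [/\ k \in st_S st, reg s' 5 = k,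
     arr s' 28 0 0 = ratio k & forall j : 'I_n, (j < l)%N -> j \in st_S st ->
       ratio k <= ratio j]).
pose I l s' := [/\ consts A s', simulates A s' st & Q l s'].
have cs1 : consts A s1 by rewrite e1; exact: consts_den.
have : I n (iter_up n f s1).
  apply: (iter_up_ind (P := I)) => [|l s2 ln [c2 r2 hQ]].
    split=> //; first by rewrite e1; exact: sim_den.
    by left; split=> //; rewrite e1 den_asg // (reg_0 cs).
  have [s3 e3] : {s3 | s3 = set_reg s2 6 l} by exists (set_reg s2 6 l).
  have c3 : consts A s3 by rewrite e3; case: c2.
  have r3 : simulates A s3 st by rewrite e3; case: r2.
  have Q3 : Q l s3 by rewrite e3.
  have r6 : reg s3 6 = l by rewrite e3.
  have fE : f l s2 = den argmin_step s3 by rewrite e3.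
  split; [rewrite fE; exact: consts_den|rewrite fE; exact: sim_den|].
  have lastj (j : 'I_n) : (j < l.+1)%N -> (j < l)%N \/ j = Ordinal ln.
    by rewrite ltnS leq_eqVlt => /orP[/eqP e|]; [right; exact: val_inj|left].
  rewrite fE /argmin_step den_if [eval _ (EC 0) _]/= [eval _ (ent _ _ _) _]/=.
  rewrite (reg_0 c3) r6 (sim_S r3 (Ordinal ln)) lt0_mem.
  case: ifP => lS; last first.
    case: Q3 => [[h29 hn]|[h29 [k [kS k5 k28 kmin]]]]; [left|right]; split=> //.
      by move=> j /lastj [/hn //|->]; rewrite lS.
    by exists k; split=> // j /lastj [/kmin //|->]; rewrite lS.
  rewrite den_seq; freeze s4 e4 (asg 30 (equo (ent 7 2 6) (ES (ent 6 6 6)))) s3.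
  rewrite -e4.
  have c4 : consts A s4 by rewrite e4; exact: consts_den.
  have h30 : arr s4 30 0 0 = ratio (Ordinal ln).
    rewrite e4 den_asg ?(reg_0 c3) // [LHS]/= (reg_0 c3) r6 (sim_p r3 (Ordinal ln)).
    by rewrite (normQ_arr (Ordinal ln) r3).
  have a43 b u v : b != 30 -> arr s4 b u v = arr s3 b u v.
    by move=> hb; rewrite e4 den_arr ?inE.
  have r46 t : reg s4 t = reg s3 t by rewrite e4 den_wreg.
  rewrite !den_if [eval _ (EC 1) _]/= [eval _ (sc 29) _]/= [eval _ (sc 30) _]/=
    [eval _ (sc 28) _]/= (reg_0 c4) h30 a43 // [arr s4 28 _ _]a43 //.
  have sel : let s5 := den select s4 in
      [/\ arr s5 29 0 0 = 1, reg s5 5 = l & arr s5 28 0 0 = ratio (Ordinal ln)].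
    have z4 := reg_0 c4.
    by rewrite /= !z4 /= r46 r6; split.
  case: Q3 => [[h29 hn]|[h29 [k [kS k5 k28 kmin]]]].
    rewrite h29 ltr01; have [s29 s5 s28] := sel; right; split=> //.
    exists (Ordinal ln); split=> // j /lastj [/hn /negPf ->|->] //.
  rewrite h29 ltxx k28; case: ifP => lt.
    have [s29 s5 s28] := sel; right; split=> //.
    exists (Ordinal ln); split=> // j /lastj [jl jS|-> _ //].
    exact: le_trans (ltW lt) (kmin j jl jS).
  right; split; first by rewrite [den SSkip _]/= a43.
  exists k; split; rewrite /= ?r46 ?a43 //.
  by move=> j /lastj [/kmin //|-> _]; rewrite leNgt lt.
freeze s2 e2 (SFor 6 1 argmin_step) s1.
have -> : iter_up n f s1 = iter_up (reg s1 1) f s1 by rewrite (reg_n cs1).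
move=> [c0 r0 hQ0].
have s2E : s2 = set_reg (iter_up (reg s1 1) f s1) 6 (reg s1 1) by rewrite e2.
have c2 : consts A s2 by rewrite s2E; case: c0.
have r2 : simulates A s2 st by rewrite s2E; case: r0.
have Q2 : Q n s2 by rewrite s2E.
case: Q2 => [[_ hn]|[_ [k [kS k5 k28 kmin]]]].
  case: nf; left; apply/setP => j; rewrite inE; apply/negbTE/hn; exact: ltn_ord.
exists k.
freeze s3 e3 (asg 34 (ent 7 2 5)) s2.
freeze s4 e4 (asg 35 (emul (emul (esub (EC 0) (sc 20)) (ES (ent 6 5 5))) (ES (sc 23)))) s3.
have sE : s' = s4.
  by rewrite /s' /argmin_stmt !den_seqs_cons den_seqs_nil -e1 -e2 -e3 -e4.
have c3 : consts A s3 by rewrite e3; exact: consts_den.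
have r3 : simulates A s3 st by rewrite e3; exact: sim_den.
have k53 : reg s3 5 = k by rewrite e3 den_wreg.
rewrite sE; split.
- by rewrite e4; exact: consts_den.
- by rewrite e4; exact: sim_den.
- by rewrite e4 den_wreg.
- by split=> // i iS; apply: kmin.
rewrite update_testE.
have -> : arr s4 35 0 0 = - epsilon R m * normQ (st_Q st) (a k) *
    normQ (st_Q st) (st_y st).
  rewrite e4 den_asg ?(reg_0 c3) // [LHS]/= (reg_0 c3) k53 (arr_eps c3).
  by rewrite (normQ_arr k r3) (sim_s r3) sub0r.
have -> // : arr s4 34 0 0 = dotQ (st_Q st) (a k) (st_y st).
rewrite e4 den_arr ?inE // e3 den_asg ?(reg_0 c2) // [LHS]/= (reg_0 c2) k5.
by rewrite (sim_p r2).
Qed.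

Lemma update_ok s st (k : 'I_n) : consts A s -> simulates A s st -> reg s 5 = k ->
  psd (st_Q st) -> 0 < dotQ (st_Q st) (a k) (a k) -> k \in st_S st ->
  let s' := den update_stmt s in
  consts A s' /\ simulates A s' (update A st k).
Proof.
move=> cs rs r5 pQ F0 kS s'; split; first exact: consts_den.
set Q := st_Q st in pQ F0; have [sQ _] := pQ.
pose y := st_y st; pose p := dotQ Q (a k) y; pose F := dotQ Q (a k) (a k).
pose p1 := asg 33 (equo (ent 7 2 5) (ent 6 5 5)).
freeze s1 e1 p1 s.
pose p2 := asg 23 (esub (sc 23) (emul (sc 33) (ent 7 2 5))).
freeze s2 e2 p2 s1.
pose p3 := vmap 7 1 (esub (ent 7 2 4) (emul (sc 33) (ent 6 4 5))).
freeze s3 e3 p3 s2.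
pose p4 := asg 36 (emul (sc 33) (ent 5 2 5)).
freeze s4 e4 p4 s3.
pose p5 := SAsg (1, 2, 5)%N (esub (ent 1 2 5) (sc 36)).
freeze s5 e5 p5 s4.
pose p6 := vmap 8 1 (esub (ent 8 2 4) (emul (sc 36) (ent 9 4 5))).
freeze s6 e6 p6 s5.
have sE : s' = s6.
  by rewrite /s' /update_stmt !den_seqs_cons den_seqs_nil -/p1 -/p2 -/p3 -/p4
    -/p5 -/p6 -e1 -e2 -e3 -e4 -e5 -e6.
have c1 : consts A s1 by rewrite e1; exact: consts_den.
have c2 : consts A s2 by rewrite e2; exact: consts_den.
have c3 : consts A s3 by rewrite e3; exact: consts_den.
have c4 : consts A s4 by rewrite e4; exact: consts_den.
have c5 : consts A s5 by rewrite e5; exact: consts_den.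
have k1 : reg s1 5 = k by rewrite e1 den_wreg.
have k2 : reg s2 5 = k by rewrite e2 den_wreg.
have k3 : reg s3 5 = k by rewrite e3 den_wreg.
have k4 : reg s4 5 = k by rewrite e4 den_wreg.
have k5 : reg s5 5 = k by rewrite e5 den_wreg.
have a1 b u v : b != 33 -> arr s1 b u v = arr s b u v.
  by move=> hb; rewrite e1 den_arr ?inE.
have a2 b u v : b != 33 -> b != 23 -> arr s2 b u v = arr s b u v.
  by move=> hb hb'; rewrite e2 den_arr ?inE // a1.
have a3 b u v : b != 33 -> b != 23 -> b != 7 -> arr s3 b u v = arr s b u v.
  by move=> hb hb' hb2; rewrite e3 den_arr ?inE // a2.
have a4 b u v : b != 33 -> b != 23 -> b != 7 -> b != 36 -> arr s4 b u v = arr s b u v.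
  by move=> hb hb' hb2 hb3; rewrite e4 den_arr ?inE // a3.
have a5 b u v : b \notin [:: 33; 23; 7; 36; 1]%N -> arr s5 b u v = arr s b u v.
  rewrite !inE !negb_or => /and5P[b1 b2 b3 b4 b5].
  by rewrite e5 den_arr ?inE // a4.
have a6 b u v : b \notin [:: 33; 23; 7; 36; 1; 8]%N -> arr s6 b u v = arr s b u v.
  rewrite !inE !negb_or => /and5P[b1 b2 b3 b4 /andP[b5 b6]].
  by rewrite e6 den_arr ?inE // a5 // !inE !negb_or b1 b2 b3 b4 b5.
have c33 : arr s1 33 0 0 = p / F.
  rewrite e1 den_asg ?(reg_0 cs) // [LHS]/= (reg_0 cs) r5.
  by rewrite (sim_p rs k) (sim_F rs k k).
have d36 : arr s4 36 0 0 = p / F * nu k.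
  rewrite e4 den_asg ?(reg_0 c3) // [LHS]/= (reg_0 c3) k3 (arr_nu c3).
  by rewrite e3 den_arr ?inE // e2 den_arr ?inE // c33.
have nk := nu_gt0 R hA k.
have FE : F = nu k ^+ 2 * dotQ Q (h k) (h k).
  by rewrite -(normQ_sqr (h k) pQ) -exprMn -(normQ_column hA) normQ_sqr.
(* Scalar 36 is the step along [h k], obtained from the step along [a k] by multiplying with the
   norm of [a k]. *)
have dE : dotQ Q (h k) y / normQ Q (h k) ^+ 2 = p / F * nu k.
  rewrite normQ_sqr // FE /p (dotQ_columnl hA).
  have h0 : 0 < dotQ Q (h k) (h k).
    by move: F0; rewrite -/F FE pmulr_rgt0 ?exprn_gt0.
  by field; rewrite !gt_eqF.
have nF : normQ Q (a k) ^+ 2 = F by rewrite normQ_sqr.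
rewrite sE updateE -/Q -/y dE nF -/p; split=> /=.
- by move=> j; rewrite a6 // (sim_S rs).
- by move=> j; rewrite a6 // (sim_T rs).
- move=> j jS; rewrite e6 den_arr ?inE // e5 /= (reg_0 c4) k4 eqxx /=.
  rewrite !mxE eqxx andbT d36 a4 // a4 // -(sim_x rs) //.
  case: (eqVneq j k) => [->|jk]; first by rewrite eqxx mulr1.
  by rewrite (inj_eq val_inj) (negPf jk) mulr0 subr0.
- by move=> i j; rewrite a6 // (sim_F rs).
- move=> j; rewrite e6 den_arr ?inE // e5 den_arr ?inE // e4 den_arr ?inE //.
  rewrite e3 den_vmap // (reg_0 c2) (reg_n c2) ltn_ord /= (reg_0 c2) k2.
  rewrite (a2 7) // (a2 6) // (sim_p rs) (sim_F rs) e2 den_arr ?inE // c33.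
  by rewrite dotQDr dotQNr dotQZr.
- rewrite e6 den_arr ?inE // e5 den_arr ?inE // e4 den_arr ?inE // e3 den_arr ?inE //.
  rewrite e2 den_asg ?(reg_0 c1) // [LHS]/= (reg_0 c1) k1 c33 !a1 // (sim_p rs) (sim_s rs).
  rewrite -/Q -/y -/p !(dotQDl, dotQDr, dotQNl, dotQNr, dotQZl, dotQZr).
  rewrite (dotQC y (a k) sQ) -/p -/F.
  by field; rewrite gt_eqF.
- by move=> i j; rewrite a6 // (sim_Pi rs).
- move=> i; rewrite e6 den_vmap // (reg_0 c5) (reg_n c5) ltn_ord /= (reg_0 c5) k5.
  rewrite (a5 8) // (a5 9) // (sim_w rs) e5 den_arr ?inE // d36.
  have -> : arr s 9 (enum_val i) k = Pi_of R A (st_S st) i (enum_rank_in kS k).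
    by rewrite -(sim_Pi rs) enum_rankK_in.
  rewrite /Pix /=.
  have -> : entries (st_x st - (p / F * nu k) *: delta_mx k 0) (st_S st) =
      entries (st_x st) (st_S st) - (p / F * nu k) *: delta_mx (enum_rank_in kS k) 0.
    apply/colP => t; rewrite !mxE; congr (_ - _ * (_ && _)%:R).
    apply/eqP/eqP => [e|->]; last by rewrite enum_rankK_in.
    by apply: enum_val_inj; rewrite enum_rankK_in.
  by rewrite mulmxBr -scalemxAr -colE [in RHS]mxE [X in _ = _ + X]mxE
    [X in _ = _ - X]mxE [X in _ = _ - _ * X]mxE.
- by rewrite a6 // (sim_rk rs).
Qed.

End Steps.

(** * Rescaling, removal, output and initialisation *)

Section RescaleStep.
Variables (R : realType) (m n : nat) (A : 'M[int]_(m, n)).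
Hypothesis hA : forall j, col j A != 0.
Hypothesis n_gt0 : (0 < n)%N.
Local Notation a := (column R A).
Local Notation nu j := (norm2 (a j)).
Local Notation h j := (normalize (a j)).
Local Notation rk S := (\rank (cols (Areal R A) S)).
Local Notation W := ((Areal R A)^T).
Implicit Types (s : store R) (st : state R m n) (S : {set 'I_n}).

Let m_gt0 : (0 < m)%N := rows_gt0 hA (Ordinal n_gt0).

(** What [rescale_stmt] leaves in memory: the state before the rank test decides about a removal. *)
Definition rescaled st : state R m n :=
  State (st_x st) (st_y st) (st_S st) (marked A st)
    (rescaleQ (st_Q st) (st_y st)).

Lemma rescale_stmt_ok s st : consts A s -> simulates A s st ->
  psd (st_Q st) -> 0 < dotQ (st_Q st) (st_y st) (st_y st) ->
  let s' := den rescale_stmt s in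
  [/\ consts A s', simulates A s' (rescaled st) &
      arr s' 26 0 0 = (rk (st_S st :\: marked A st))%:R].
Proof.
move=> cs rs pQ y0 s'.
set Q := st_Q st in pQ y0; set y := st_y st in y0; have [sQ _] := pQ.
pose p1 := mmap 6 1 1 (emul (sc 21) (eadd (ent 6 3 4)
      (equo (emul (emul (EC 3) (ent 7 2 3)) (ent 7 2 4)) (sc 23)))).
freeze s1 e1 p1 s.
pose p2 := vmap 7 1 (emul (emul (EC 4) (sc 21)) (ent 7 2 4)).
freeze s2 e2 p2 s1.
pose p3 := asg 23 (emul (emul (EC 4) (sc 21)) (sc 23)).
freeze s3 e3 p3 s2.
pose p4 := vmap 3 1 (EIf (ent 3 2 4) (ent 2 2 4)
      (EIf (sc 22) (equo (ES (ent 6 4 4)) (ent 5 2 4)) (EC 1) (EC 0)) (ent 3 2 4)).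
freeze s4 e4 p4 s3.
pose p5 := mmap 10 1 0 (EIf (ent 3 2 3) (ent 2 2 3) (ent 0 4 3) (EC 0)).
freeze s5 e5 p5 s4.
freeze s6 e6 (proj 1 0) s5.
have sE : s' = s6.
  by rewrite /s' /rescale_stmt !den_seqs_cons den_seqs_nil -/p1 -/p2 -/p3 -/p4
    -/p5 -e1 -e2 -e3 -e4 -e5 -e6.
have c1 : consts A s1 by rewrite e1; exact: consts_den.
have c2 : consts A s2 by rewrite e2; exact: consts_den.
have c3 : consts A s3 by rewrite e3; exact: consts_den.
have c4 : consts A s4 by rewrite e4; exact: consts_den.
have c5 : consts A s5 by rewrite e5; exact: consts_den.
have a1 b u v : b != 6 -> arr s1 b u v = arr s b u v.
  by move=> hb; rewrite e1 den_arr ?inE.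
have a2 b u v : b != 7 -> arr s2 b u v = arr s1 b u v.
  by move=> hb; rewrite e2 den_arr ?inE.
have a3 b u v : b != 23 -> arr s3 b u v = arr s2 b u v.
  by move=> hb; rewrite e3 den_arr ?inE.
have a4 b u v : b != 3 -> arr s4 b u v = arr s3 b u v.
  by move=> hb; rewrite e4 den_arr ?inE.
have a5 b u v : b != 10 -> arr s5 b u v = arr s4 b u v.
  by move=> hb; rewrite e5 den_arr ?inE.
have a6 b u v : b \notin [:: 10; 11; 12; 25; 26]%N -> arr s6 b u v = arr s4 b u v.
  rewrite !inE !negb_or => /and5P[b1 b2 b3 b4 b5].
  by rewrite e6 den_arr ?a5 // /= !inE !negb_or b2 b3 b4 b5.
have a61 b u v : b \notin [:: 10; 11; 12; 25; 26; 3; 23; 7; 6]%N ->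
    arr s6 b u v = arr s b u v.
  rewrite !inE !negb_or => /and5P[b1 b2 b3 b4 /and5P[b5 b6 b7 b8 b9]].
  rewrite a6 ?a4 ?a3 ?a2 ?a1 //.
  by rewrite !inE !negb_or b1 b2 b3 b4 b5.
have F1 (i j : 'I_n) : arr s1 6 i j = dotQ (rescaleQ Q y) (a i) (a j).
  rewrite e1 den_mmap // (reg_n cs) !ltn_ord /= (reg_0 cs) (arr_kap cs) (sim_F rs).
  by rewrite !(sim_p rs) (sim_s rs) dotQ_rescale // (dotQC y (a j) sQ).
have S3 (j : 'I_n) : arr s3 2 0 j = (j \in st_S st)%:R.
  by rewrite a3 ?a2 ?a1 ?(sim_S rs).
have T3 (j : 'I_n) : arr s3 3 0 j = (j \in st_T st)%:R.
  by rewrite a3 ?a2 ?a1 ?(sim_T rs).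
have T4 (j : 'I_n) : arr s4 3 0 j = (j \in marked A st)%:R.
  rewrite e4 den_vmap // (reg_0 c3) (reg_n c3) ltn_ord /= (reg_0 c3) S3 T3.
  rewrite (arr_th c3) (arr_nu c3) a3 // a2 // F1 ltr_nat.
  rewrite -/(normQ (rescaleQ Q y) (a j)) (normQ_column hA) mulrAC.
  rewrite divff ?(nu_neq0 R hA) // mul1r !inE.
  case: (j \in st_T st); first by case: (j \in st_S st).
  by case: (j \in st_S st) => //=; case: ifP.
have S4 (j : 'I_n) : arr s4 2 0 j = (j \in st_S st)%:R by rewrite a4.
have h10 (j : 'I_n) (i : 'I_m) :
    arr s5 10 j i = sel_rows W (st_S st :\: marked A st) j i.
  rewrite e5 den_mmap // (reg_m c4) (reg_n c4) !ltn_ord /= (reg_0 c4) S4 T4.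
  rewrite ltr_nat (arr_A c4).
  have -> : sel_rows W (st_S st :\: marked A st) j i =
    (if j \in st_S st :\: marked A st then row j W else 0) 0 i.
    by rewrite mxE.
  rewrite in_setD; case: (j \in marked A st); case: (j \in st_S st) => /=;
    by rewrite !mxE.
have [_ [P [_ _ hc]]] : holds_proj (sel_rows W (st_S st :\: marked A st)) setT s6.
  by rewrite e6; apply: proj_ok; rewrite ?(reg_m c5) ?(reg_n c5) ?(reg_0 c5).
rewrite sE; split.
- by rewrite e6; exact: consts_den.
- split=> /=.
  + by move=> j; rewrite a61 // (sim_S rs).
  + by move=> j; rewrite a6 // T4.
  + by move=> j jS; rewrite a61 // (sim_x rs).
  + by move=> i j; rewrite a6 // a4 // a3 // a2 // F1.
  + move=> j; rewrite a6 // a4 // a3 // e2 den_vmap // (reg_0 c1) (reg_n c1) ltn_ord.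
    rewrite /= (reg_0 c1) (arr_kap c1) a1 // (sim_p rs) -/Q -/y.
    by rewrite dotQ_rescale_self.
  + rewrite a6 // a4 // e3 den_asg ?(reg_0 c2) // [LHS]/= (reg_0 c2) (arr_kap c2).
    by rewrite a2 // a1 // (sim_s rs) dotQ_rescale_self.
  + by move=> k l; rewrite a61 // (sim_Pi rs).
  + by move=> k; rewrite a61 // (sim_w rs).
  + by rewrite a61 // (sim_rk rs).
by rewrite hc sel_rowsT rank_sel_cols.
Qed.

Lemma remove_ok s st : consts A s -> simulates A s (rescaled st) ->
  let s' := den remove_stmt s in
  consts A s' /\ simulates A s'
    (restart A (st_S st :\: marked A st) (rescaleQ (st_Q st) (st_y st))).
Proof.
move=> cs rs s'; split; first exact: consts_den.
freeze s1 e1 (vmap 2 1 (EIf (ent 3 2 4) (ent 2 2 4) (EC 1) (EC 0))) s.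
have -> : s' = den restart_stmt s1 by rewrite /s' /remove_stmt den_seq -e1.
apply: restart_ok => //; first by rewrite e1; exact: consts_den.
  move=> j; rewrite e1 den_vmap // (reg_0 cs) (reg_n cs) ltn_ord /= (reg_0 cs).
  rewrite (sim_S rs) (sim_T rs) ltr_nat in_setD /=.
  by case: (j \in marked A st); case: (j \in st_S st).
by move=> i j; rewrite e1 den_arr // (sim_F rs).
Qed.

Lemma output_ok s st : consts A s -> simulates A s st -> finished A st ->
  returns A st (\col_(j < n) arr (den output_stmt s) 4 0 j).
Proof.
move=> cs rs fin.
have oE (j : 'I_n) : arr (den output_stmt s) 4 0 j =
    if j \in st_S st then arr s 8 0 j / nu j else 0.
  rewrite den_vmap // (reg_0 cs) (reg_n cs) ltn_ord /= (reg_0 cs) (sim_S rs).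
  by rewrite lt0_mem (arr_nu cs).
split=> // [k|i iS]; rewrite mxE oE; last by rewrite (negPf iS).
by rewrite enum_valP (sim_w rs).
Qed.

Lemma init_ok s : reg s 0 = m -> reg s 1 = n -> reg s 2 = 0%N ->
  (forall (i : 'I_m) (j : 'I_n), arr s 0 i j = (A i j)%:~R) ->
  arr s 40 0 0 = 0 ->
  let s' := den init_stmt s in let st := init_state R A in
  [/\ consts A s', simulates A s' st &
      finished A st <-> ~~ (0 < arr s' 27 0 0)].
Proof.
move=> r0 r1 r2 h0 h40 s' st.
have := constants_ok r0 r1 r2 h0; freeze s1 e1 constants s.
cbv zeta; rewrite -e1 => -[[m1 n1 z1] nu1 eps1 kap1 [mm1 F1]].
freeze s2 e2 greedy s1.
have A1 (i : 'I_m) (j : 'I_n) : arr s1 0 i j = (A i j)%:~R by rewrite e1 den_arr.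
have th2 : arr s2 22 0 0 = (theta R A)^-1 by rewrite e2; exact: greedy_ok.
have hr t : (t < 3)%N -> reg s2 t = reg s1 t.
  by move=> ht; rewrite e2 den_wreg // !inE; lia.
have c2 : consts A s2.
  split; rewrite ?hr //; try by move=> *; rewrite e2 den_arr.
  by rewrite e2 den_arr // e1 den_arr.
freeze s3 e3 (vmap 2 1 (EC 1)) s2.
have c3 : consts A s3 by rewrite e3; exact: consts_den.
have S3 : set_array s3 2 [set: 'I_n].
  by move=> j; rewrite e3 den_vmap // (reg_0 c2) (reg_n c2) ltn_ord inE.
have F3 : gram_array A s3 1%:M by move=> i j; rewrite e3 den_arr // e2 den_arr.
freeze s4 e4 restart_stmt s3.
have c4 : consts A s4 by rewrite e4; exact: consts_den.
have r4 : simulates A s4 st by rewrite e4; exact: restart_ok.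
have -> : s' = den check_stmt s4 by rewrite e4 e3 e2 e1.
exact: check_ok.
Qed.

End RescaleStep.

(** * Execution and accounting of time *)

Definition update_cost (m n : nat) : nat :=
  (cost m n argmin_stmt + cost m n update_stmt + cost m n check_stmt + 4)%N.
Definition rescale_cost (m n : nat) : nat :=
  (cost m n argmin_stmt + cost m n rescale_stmt + cost m n check_stmt + 4)%N.

Section Execution.
Variables (R : realType) (m n : nat) (A : 'M[int]_(m, n)).
Hypothesis hA : forall j, col j A != 0.
Hypothesis n_gt0 : (0 < n)%N.
Implicit Types (s : store R) (st : state R m n).
Local Notation cu := (update_cost m n).
Local Notation cr := (rescale_cost m n).
Local Notation cd := (cost m n remove_stmt).

Lemma comp_consts p s s1 : wfS prot0 p -> consts A s -> agree level s s1 ->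
  exists s2 t, [/\ exec (compS p) s1 s2 [::] t, agree level (den p s) s2 &
    (t <= cost m n p)%N].
Proof. by move=> w cs ag; apply: (comp_ok w) => //; case: cs. Qed.

(** Compiled code pollutes the scratch space, so the store of the machine represents a state through
    a reference store that it agrees with. *)
Definition implements s1 st := exists s,
  [/\ agree level s s1, consts A s, simulates A s st &
      finished A st <-> ~~ (0 < arr s 27 0 0)].

Lemma scalar_agree s s1 b : agree level s s1 -> consts A s -> (b < 100)%N ->
  get s1 (b, 2, 2)%N = arr s b 0 0.
Proof. by move=> ag cs hb; rewrite (agree_get ag) //= (reg_0 cs). Qed.

Lemma implements_holds s1 st : implements s1 st -> holds_state s1 st.
Proof.
move=> [s [[_ ea] cs rs _]] j; rewrite -!ea //; split=> [jS||].
- exact: (sim_x rs).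
- exact: (sim_S rs).
- exact: (sim_T rs).
Qed.

(** The time is charged to the three counters; a removal pays its own share on top of the rescaling
    that triggers it. *)
Lemma body_ok nu nr nd st s1 : reach A nu nr nd st -> implements s1 st ->
  ~ finished A st ->
  exists nu' nr' nd' st' s2 t,
    [/\ exec loop_body s1 s2 [:: s2] t, implements s2 st', step A st st',
        reach A nu' nr' nd' st' &
        (t.+1 + (nu * cu + nr * cr + nd * cd) <= nu' * cu + nr' * cr + nd' * cd)%N
        /\ (nu + nr < nu' + nr')%N].
Proof.
move=> re [s [ag cs rs _]] nf.
have I := reach_invariant hA n_gt0 re; have pQ := inv_psd I.
have [k [cs1 rs1 k1 km test1]] := argmin_ok cs rs nf.
have [s2 [t1 [ex1 ag1 le1]]] := comp_consts wf_argmin cs ag.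
set sa := den argmin_stmt s in cs1 rs1 k1 test1 ag1.
have check st' sb s3 : consts A sb -> simulates A sb st' -> agree level sb s3 ->
    exists s4 t, [/\ exec (Seq (compS check_stmt) Mark) s3 s4 [:: s4] t,
      implements s4 st' & (t <= cost m n check_stmt)%N].
  move=> cb rb agb; have [cc rc fc] := check_ok cb rb.
  have [s4 [t [ex agc le]]] := comp_consts wf_check cb agb.
  exists s4, (t + 0)%N; split; last by rewrite addn0.
    exact: (ExSeq ex (ExMark s4)).
  by exists (den check_stmt sb).
have testE : eval_test (RLt (34, 2, 2) (35, 2, 2))%N s2 = update_test A st k.
  by rewrite -test1 /eval_test !(scalar_agree ag1 cs1).
case: (boolP (update_test A st k)) => ut.
  have F0 : 0 < dotQ (st_Q st) (column R A k) (column R A k).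
    by rewrite -normQ_sqr // exprn_gt0 // (inv_normQ_gt0 hA n_gt0 k I).
  have [cs2 rs2] := update_ok hA cs1 rs1 k1 pQ F0 km.1.
  have [s3 [t2 [ex2 ag2 le2]]] := comp_consts wf_update cs1 ag1.
  have [s4 [t3 [ex3 im3 le3]]] := check _ _ _ cs2 rs2 ag2.
  exists nu.+1, nr, nd, (update A st k), s4, (t1 + (t2.+1 + t3))%N; split=> //.
  - apply: (ExSeq ex1); apply: (ExSeq (l1 := [::]) _ ex3); apply: ExIf.
    by rewrite testE ut.
  - by split=> //; exists k; rewrite ?ut.
  - exact: ReachUpdate re nf km ut.
  split; last by rewrite addSn.
  have cE : cu = (cost m n argmin_stmt + cost m n update_stmt +
    cost m n check_stmt + 4)%N by [].
  by rewrite mulSn; move: cE le1 le2 le3; clear; lia.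
have y0 := unfinished_pos hA n_gt0 I nf.
have [cs2 rs2 rk2] := rescale_stmt_ok hA cs1 rs1 pQ y0.
have [s3 [t2 [ex2 ag2 le2]]] := comp_consts wf_rescale cs1 ag1.
set sb := den rescale_stmt sa in cs2 rs2 rk2 ag2.
have test2 : eval_test (RLt (26, 2, 2) (24, 2, 2))%N s3 = rank_drops A st.
  by rewrite /eval_test !(scalar_agree ag2 cs2) // rk2 (sim_rk rs2) ltr_nat.
have reR := ReachRescale re nf km ut.
have stp : step A st (rescale A st) by split=> //; exists k; rewrite ?(negPf ut).
have rE := rescaleE A st.
have crE : cr = (cost m n argmin_stmt + cost m n rescale_stmt +
  cost m n check_stmt + 4)%N by [].
case: (boolP (rank_drops A st)) => dr.
  rewrite dr in rE; have [cs3 rs3] := remove_ok hA cs2 rs2.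
  have [s4 [t3 [ex3 ag3 le3]]] := comp_consts wf_remove cs2 ag2.
  have [s5 [t4 [ex4 im4 le4]]] := check _ _ _ cs3 rs3 ag3.
  exists nu, nr.+1, (nd + rank_drops A st)%N, (rescale A st), s5,
    (t1 + ((t2 + t3.+1).+1 + t4))%N.
  split=> //; last first.
  - split; last by rewrite addnS.
    by rewrite dr addn1 !mulSn; move: crE le1 le2 le3 le4; clear; lia.
  - by rewrite rE.
  apply: (ExSeq ex1); apply: (ExSeq (l1 := [::]) _ ex4); apply: ExIf.
  rewrite testE (negPf ut); apply: (ExSeq ex2 (l2 := [::])); apply: ExIf.
  by rewrite test2 dr.
rewrite (negPf dr) in rE.
have rs2' : simulates A sb (rescale A st) by rewrite rE.
have [s5 [t4 [ex4 im4 le4]]] := check _ _ _ cs2 rs2' ag2.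
exists nu, nr.+1, (nd + rank_drops A st)%N, (rescale A st), s5,
  (t1 + ((t2 + 1).+1 + t4))%N.
split=> //; last first.
- split; last by rewrite addnS.
  by rewrite (negPf dr) addn0 mulSn; move: crE le1 le2 le4; clear; lia.
apply: (ExSeq ex1); apply: (ExSeq (l1 := [::]) _ ex4); apply: ExIf.
rewrite testE (negPf ut); apply: (ExSeq ex2 (l2 := [::])); apply: ExIf.
by rewrite test2 (negPf dr); exact: ExSkip.
Qed.

Fixpoint steps st (sts : seq (state R m n)) : Prop :=
  if sts is st' :: sts' then step A st st' /\ steps st' sts' else True.

Fixpoint all_hold (log : seq (store R)) (sts : seq (state R m n)) : Prop :=
  match log, sts with
  | s :: log', st :: sts' => holds_state s st /\ all_hold log' sts'
  | [::], [::] => True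
  | _, _ => False
  end.

Definition loop : cmd := While (RLt (40, 2, 2) (27, 2, 2))%N loop_body.

(** Induction on the number of iterations still permitted by the bounds on updates and rescalings,
    which hold in every reachable state. *)
Lemma loop_ok nu nr nd st s1 : reach A nu nr nd st -> implements s1 st ->
  exists nu' nr' nd' sts log s2 t,
    [/\ exec loop s1 s2 log t, steps st sts, all_hold log sts,
        implements s2 (last st sts) /\ finished A (last st sts) &
        reach A nu' nr' nd' (last st sts) /\
        (t + (nu * cu + nr * cr + nd * cd) <= nu' * cu + nr' * cr + nd' * cd + 1)%N].
Proof.
pose K := (121 * 84 * (m ^ 3 * encoding_length A) + 14 * (m * encoding_length A))%N.
have [b] := ubnP (K - (nu + nr))%N.
elim: b nu nr nd st s1 => // b IH nu nr nd st s1 lb re im.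
have testE : eval_test (RLt (40, 2, 2) (27, 2, 2))%N s1 -> ~ finished A st.
  have [s [ag cs _ fE]] := im.
  rewrite /eval_test !(scalar_agree ag cs) // (arr_zero cs) => h /fE.
  by rewrite h.
have testF : ~~ eval_test (RLt (40, 2, 2) (27, 2, 2))%N s1 -> finished A st.
  have [s [ag cs _ fE]] := im.
  by rewrite /eval_test !(scalar_agree ag cs) // (arr_zero cs) => h; apply/fE.
case: (boolP (eval_test (RLt (40, 2, 2) (27, 2, 2))%N s1)) => test; last first.
  exists nu, nr, nd, [::], [::], s1, 1%N; split=> //.
  - exact: ExWhileStop.
  - by split=> //; exact: testF.
  by split=> //; rewrite addnC.
have [nu1 [nr1 [nd1 [st1 [s2 [t1 [ex1 im1 stp1 re1 [le1 lt1]]]]]]]] :=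
  body_ok re im (testE test).
have hu := updates_le hA n_gt0 re1; have hr := rescalings_le hA n_gt0 re1.
have lK : (nu1 + nr1 <= K)%N by rewrite leq_add.
have [|nu2 [nr2 [nd2 [sts [log [s3 [t2 [ex2 stp2 ho2 [im2 fin2] [re2 le2]]]]]]]]] :=
  IH nu1 nr1 nd1 st1 s2 _ re1 im1.
  move: lb lt1 lK; clear; lia.
exists nu2, nr2, nd2, (st1 :: sts), (s2 :: log), s3, (t1 + t2).+1; split.
- exact: (ExWhileStep test ex1 ex2).
- by split.
- by split=> //; exact: implements_holds.
- by split.
- by split=> //; move: le1 le2; clear; lia.
Qed.

Lemma all_hold_nth log sts s0 st0 i : all_hold log sts -> (i < size log)%N ->
  holds_state (nth s0 log i) (nth st0 sts i).
Proof.
elim: log sts i => [|s log IH] [|st sts] [|i] //= [hs al]; [by []|exact: IH].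
Qed.

Lemma all_hold_size log sts : all_hold log sts -> size log = size sts.
Proof. by elim: log sts => [|s log IH] [|st sts] //= [_ /IH ->]. Qed.

Lemma steps_nth st sts st0 i : steps st sts -> (i < size sts)%N ->
  step A (nth st0 (st :: sts) i) (nth st0 (st :: sts) i.+1).
Proof.
elim: sts st i => [|st1 sts IH] st [|i] //= [s1 ss]; first by [].
by move=> ilt; exact: IH.
Qed.

Lemma program_ok : exists t xbar nu nr nd st,
  [/\ executes_algorithm program A t xbar, reach A nu nr nd st,
      @returns R m n A st xbar &
      (t <= cost m n init_stmt + cost m n output_stmt + 1 +
            (nu * cu + nr * cr + nd * cd))%N].
Proof.
pose s := @input_store R m n A.
have A0 (i : 'I_m) (j : 'I_n) : arr s 0 i j = (A i j)%:~R.
  by rewrite /= !valK.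
have [c1 r1 f1] := init_ok hA n_gt0 (erefl : reg s 0 = m) (erefl : reg s 1 = n)
  (erefl : reg s 2 = 0%N) A0 (erefl : arr s 40 0 0 = 0).
have prP : [/\ 0 \in prot0, 1 \in prot0 & 2 \in prot0]%N by [].
have agr : agree level s s by split.
have [s1 [t1 [ex1 ag1 le1]]] := comp_ok (m := m) (n := n) wf_init prP agr erefl erefl.
have im1 : implements s1 (init_state R A) by exists (den init_stmt s).
have [nu [nr [nd [sts [log [s2 [t2 [ex2 stp ho [im2 fin] [re le2]]]]]]]]] :=
  loop_ok (ReachInit R A) im1.
have [sb [ag2 c2 r2 _]] := im2.
have [s3 [t3 [ex3 ag3 le3]]] := comp_consts wf_output c2 ag2.
have ret := output_ok c2 r2 fin.
have oE : output n s3 = \col_(j < n) arr (den output_stmt sb) 4 0 j.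
  by apply/colP => j; rewrite !mxE; have [_ ->] := ag3.
exists (t1 + (0 + (t2 + t3)))%N, (output n s3), nu, nr, nd, (last (init_state R A) sts).
split=> //; last first.
- by move: le1 le2 le3; clear; lia.
- by rewrite oE.
exists s3, (s1 :: log), (size sts), (fun i => nth (init_state R A) (init_state R A :: sts) i).
split.
- rewrite -[s1 :: log](cats0 (s1 :: log)) -cat1s -[_ ++ [::]]cat0s -catA.
  apply: (ExSeq ex1); apply: (ExSeq (ExMark s1)).
  exact: (ExSeq ex2 ex3).
- by split=> // i ilt; exact: steps_nth.
- by rewrite /= (all_hold_size ho).
- move=> [_|i ilt] /=; first exact: implements_holds.
  by apply: all_hold_nth => //; rewrite (all_hold_size ho).
by rewrite -[nth _ _ (size sts)]/(nth (init_state R A) (init_state R A :: sts) (size sts))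
  nth_last oE.
Qed.

End Execution.

(** * Operation counts *)

Section Costs.
Local Open Scope nat_scope.
Variables (m n : nat).
Hypotheses (m_gt0 : 0 < m) (n_gt0 : 0 < n).

Lemma update_cost_le : update_cost m n <= 1000 * n.
Proof. rewrite /update_cost /= /dim /=; move: n_gt0; clear; lia. Qed.

Lemma rescale_cost_le : rescale_cost m n <= 1000 * (n * n + m * m * n).
Proof.
have h1 : n <= n * n by rewrite leq_pmulr.
have h2 : m * n <= m * m * n by rewrite leq_mul2r leq_pmulr ?orbT.
have h3 : n <= m * n by rewrite leq_pmull.
have h4 : m * m <= m * m * n by rewrite leq_pmulr.
have h5 : m <= m * n by rewrite leq_pmulr.
rewrite /rescale_cost /= /dim /=; move: n_gt0 h1 h2 h3 h4 h5; clear; lia.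
Qed.

Lemma remove_cost_le : cost m n remove_stmt <= 1000 * (m * (n * n)).
Proof.
have h1 : n <= n * n by rewrite leq_pmulr.
have h2 : n * n <= m * (n * n) by rewrite leq_pmull.
have h3 : m * n <= m * (n * n) by rewrite leq_mul2l h1 orbT.
have h5 : m <= m * n by rewrite leq_pmulr.
rewrite /= /dim /=; move: n_gt0 h1 h2 h3 h5; clear; lia.
Qed.

Lemma init_cost_le : cost m n init_stmt <= 2000 * (m * m * (n * n)).
Proof.
have h1 : n <= n * n by rewrite leq_pmulr.
have h6 : m <= m * m by rewrite leq_pmulr.
have h2 : n * n <= m * (n * n) by rewrite leq_pmull.
have h7 : m * (n * n) <= m * m * (n * n) by rewrite leq_mul2r h6 orbT.
have h3 : m * n <= m * (n * n) by rewrite leq_mul2l h1 orbT.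
have h5 : m <= m * n by rewrite leq_pmulr.
have h8 : m * m * n <= m * m * (n * n) by rewrite leq_mul2l h1 orbT.
have h9 : m * m <= m * m * n by rewrite leq_pmulr.
rewrite /= /dim /=; move: n_gt0 h1 h2 h3 h5 h6 h7 h8 h9; clear; lia.
Qed.

Lemma output_cost_le : cost m n output_stmt <= 1000 * n.
Proof. rewrite /= /dim /=; move: n_gt0; clear; lia. Qed.

Lemma total_cost_le L nu nr nd : m * n <= L -> nu <= 121 * 84 * (m ^ 3 * L) ->
  nr <= 14 * (m * L) -> nd <= m ->
  cost m n init_stmt + cost m n output_stmt + 1 + (nu * update_cost m n +
    nr * rescale_cost m n + nd * cost m n remove_stmt) <=
  (20 * 1000 * 1000) * ((m ^ 3 * n + m * n ^ 2) * L).
Proof.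
move=> hL hu hr hd; pose M := (m ^ 3 * n + m * n ^ 2) * L.
have X1 : m ^ 3 * L * n <= M by rewrite /M mulnDl mulnAC leq_addr.
have X2 : m * L * (n * n) <= M by rewrite /M mulnDl mulnAC -mulnn leq_addl.
have X3 : m * L * (m * m * n) <= M.
  by apply: leq_trans X1; rewrite !expnS expn0 muln1; apply: eq_leq; ring.
(* The initialisation, and likewise the at most m removals together, cost the order of m^2 n^2,
   which [hL] turns into m n^2 L. *)
have X4 : m * (m * (n * n)) <= M.
  apply: leq_trans X2; rewrite (_ : m * (m * (n * n)) = m * n * (m * n)); last by ring.
  rewrite (_ : m * L * (n * n) = L * n * (m * n)); last by ring.
  by rewrite leq_mul2r (leq_trans hL) ?orbT // leq_pmulr.
have X5 : m * m * (n * n) <= M by apply: leq_trans X4; rewrite -mulnA.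
have X6 : n <= M.
  by apply: leq_trans X5; apply: leq_trans (leq_pmulr n n_gt0) _; rewrite leq_pmull ?muln_gt0 ?m_gt0.
have X7 : 1 <= M by apply: leq_trans X6.
have Y1 : nu * update_cost m n <= 121 * 84 * 1000 * M.
  apply: (leq_trans (leq_mul hu update_cost_le)).
  by rewrite mulnACA leq_mul2l X1 orbT.
have Y2 : nr * rescale_cost m n <= 14 * 1000 * (M + M).
  apply: (leq_trans (leq_mul hr rescale_cost_le)).
  by rewrite mulnACA leq_mul2l mulnDr leq_add ?orbT.
have Y3 : nd * cost m n remove_stmt <= 1000 * M.
  apply: (leq_trans (leq_mul hd remove_cost_le)).
  by rewrite mulnCA leq_mul2l X4 orbT.
have Y4 := leq_trans init_cost_le (leq_mul (leqnn 2000) X5).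
have Y5 := leq_trans output_cost_le (leq_mul (leqnn 1000) X6).
by move: X7 Y1 Y2 Y3 Y4 Y5; rewrite -/M; clearbody M; clear; lia.
Qed.

End Costs.

Theorem theoremA3 (R : realType) :
  exists (P : cmd) (C : nat),
  forall (m n : nat) (A : 'M[int]_(m, n)),
    (0 < n)%N -> (forall j : 'I_n, col j A != 0) ->
    [/\ ~ (exists run : nat -> state R m n, forall N, is_run A N run),
        forall (N : nat) (run : nat -> state R m n) (xbar : 'cV[R]_n),
          is_run A N run -> returns A (run N) xbar ->
          maximum_support_solution A xbar &
        exists (t : nat) (xbar : 'cV[R]_n),
          [/\ executes_algorithm P A t xbar,
              maximum_support_solution A xbar &
              (t <= C * ((m ^ 3 * n + m * n ^ 2) * encoding_length A))%N]].
Proof.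
exists program, (20 * 1000 * 1000)%N => m n A n_gt0 hA.
split; first exact: no_infinite_run.
  move=> N run xbar /run_reach [nu [nr [nd [_ re]]]].
  exact: returns_maximum re.
have [t [xbar [nu [nr [nd [st [ex re ret le]]]]]]] := program_ok R hA n_gt0.
exists t, xbar; split=> //; first exact: returns_maximum re ret.
apply: (leq_trans le); apply: total_cost_le => //.
- exact: rows_gt0 hA (Ordinal n_gt0).
- exact: dims_le_encoding.
- exact: updates_le re.
- exact: rescalings_le re.
- exact: restarts_le re.
Qed.
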